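(* Let $\mathcal M$ be an o-minimal expansion of an ordered group, with universe $M$ and language $\mathcal L$, and let $\mathcal N=\langle\mathcal M,P\rangle$ be the expansion of $\mathcal M$ by a unary predicate for a dense $\mathrm{dcl}$-independent set $P\subseteq M$. Then every group definable in $\mathcal N$ is definably isomorphic (in $\mathcal N$) to a group definable in $\mathcal M$.
   Context: $\mathrm{dcl}$ denotes definable closure in $\mathcal M$; $P$ being $\mathrm{dcl}$-independent means no $p\in P$ lies in $\mathrm{dcl}(P\setminus\{p\})$ (over the empty set). Definability is with parameters. A group definable in $\mathcal N$ is one whose universe and operation are definable in $\mathcal N$; a definable isomorphism is a group isomorphism whose graph is definable in $\mathcal N$. *)

(* Defs.v *)
From mathcomp Require Import all_boot.
Set Implicit Arguments. Unset Strict Implicit. Unset Printing Implicit Defensive.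

Inductive formula (I : Type) (ar : I -> nat) : Type :=
| FRel (i : I) (vs : (ar i).-tuple nat)
| FEq (a b : nat)
| FNot (f : formula ar)
| FAnd (f g : formula ar)
| FEx (x : nat) (f : formula ar).

Section Semantics.
Variables (M : Type) (I : Type) (ar : I -> nat)
          (rel : forall i : I, (ar i).-tuple M -> Prop).

Fixpoint sat (v : nat -> M) (f : formula ar) : Prop :=
  match f with
  | FRel i vs => rel (map_tuple v vs)
  | FEq a b => v a = v b
  | FNot g => ~ sat v g
  | FAnd g h => sat v g /\ sat v h
  | FEx x g => exists a : M, sat (fun k => if k == x then a else v k) g
  end.

Definition extend n (x : n.-tuple M) (w : nat -> M) : nat -> M :=
  fun k => nth (w k) x k.

(* X ⊆ M^n is definable with parameters: the parameters are the values of w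
   on the variables >= n *)
Definition definable n (X : n.-tuple M -> Prop) : Prop :=
  exists (f : formula ar) (w : nat -> M),
    forall x : n.-tuple M, X x <-> sat (extend x w) f.

Definition definable0 n (X : n.-tuple M -> Prop) : Prop :=
  exists f : formula ar, forall (x : n.-tuple M) (w : nat -> M),
    X x <-> sat (extend x w) f.

(* b ∈ dcl(A) : b is the unique solution of a parameter-free formula phi(y, a)
   with a a finite tuple from A (y is variable 0, a_j is variable j+1). *)
Definition in_dcl (A : M -> Prop) (b : M) : Prop :=
  exists (f : formula ar) (m : nat) (a : m.-tuple M),
    (forall j : 'I_m, A (tnth a j)) /\
    forall (y : M) (w : nat -> M), sat (extend [tuple of y :: a] w) f <-> y = b.

Definition dcl_independent (P : M -> Prop) : Prop :=
  forall p, P p -> ~ in_dcl (fun q => P q /\ q <> p) p.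

Definition is_group_on T (G : T -> Prop) (mul : T -> T -> T) : Prop :=
  exists (e : T) (inv : T -> T),
    G e /\
    (forall x y, G x -> G y -> G (mul x y)) /\
    (forall x, G x -> G (inv x)) /\
    (forall x y z, G x -> G y -> G z -> mul (mul x y) z = mul x (mul y z)) /\
    (forall x, G x -> mul e x = x /\ mul x e = x) /\
    (forall x, G x -> mul (inv x) x = e /\ mul x (inv x) = e).

Definition graph_op n (G : n.-tuple M -> Prop) (mul : n.-tuple M -> n.-tuple M -> n.-tuple M)
  : (n + (n + n)).-tuple M -> Prop :=
  fun t => exists x y : n.-tuple M,
    G x /\ G y /\ t = cat_tuple x (cat_tuple y (mul x y)).

Definition definable_group n (G : n.-tuple M -> Prop)
  (mul : n.-tuple M -> n.-tuple M -> n.-tuple M) : Prop :=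
  definable G /\ definable (graph_op G mul) /\ is_group_on G mul.

Definition graph_map n m (G : n.-tuple M -> Prop) (f : n.-tuple M -> m.-tuple M)
  : (n + m).-tuple M -> Prop :=
  fun t => exists x : n.-tuple M, G x /\ t = cat_tuple x (f x).

Definition definable_iso n m (G : n.-tuple M -> Prop) mulG
  (H : m.-tuple M -> Prop) mulH (f : n.-tuple M -> m.-tuple M) : Prop :=
  (forall x, G x -> H (f x)) /\
  (forall x y, G x -> G y -> f x = f y -> x = y) /\
  (forall z, H z -> exists x, G x /\ f x = z) /\
  (forall x y, G x -> G y -> f (mulG x y) = mulH (f x) (f y)) /\
  definable (graph_map G f).

End Semantics.

Definition ordered_group (M : Type) (lt : M -> M -> Prop) (op : M -> M -> M)
  (e : M) (inv : M -> M) : Prop :=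
  (forall x y z, op (op x y) z = op x (op y z)) /\
  (forall x, op e x = x /\ op x e = x) /\
  (forall x, op (inv x) x = e /\ op x (inv x) = e) /\
  (forall x, ~ lt x x) /\
  (forall x y z, lt x y -> lt y z -> lt x z) /\
  (forall x y, lt x y \/ x = y \/ lt y x) /\
  (forall x y z, lt x y -> lt (op z x) (op z y) /\ lt (op x z) (op y z)).

(* pieces of a finite union of points and open intervals (None = ±∞) *)
Inductive piece (M : Type) : Type :=
| PPoint (a : M)
| PInt (a b : option M).

Definition in_piece (M : Type) (lt : M -> M -> Prop) (p : piece M) (y : M) : Prop :=
  match p with
  | PPoint a => y = a
  | PInt a b => (match a with Some a => lt a y | None => True end) /\
                (match b with Some b => lt y b | None => True end)
  end.

Definition o_minimal (M : Type) (I : Type) (ar : I -> nat)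
  (rel : forall i : I, (ar i).-tuple M -> Prop) (lt : M -> M -> Prop) : Prop :=
  forall X : 1.-tuple M -> Prop, definable rel X ->
    exists ps : seq (piece M),
      forall y : M, X [tuple y] <->
        exists2 k, k < size ps & in_piece lt (nth (PPoint y) ps k) y.

Definition dense_in (M : Type) (lt : M -> M -> Prop) (P : M -> Prop) : Prop :=
  forall a b, lt a b -> exists p, P p /\ lt a p /\ lt p b.

(* the expansion <M, P>: one new unary relation symbol (None) interpreted as P *)
Definition ar_P (I : Type) (ar : I -> nat) (o : option I) : nat :=
  match o with Some i => ar i | None => 1 end.

Definition rel_P (M : Type) (I : Type) (ar : I -> nat)
  (rel : forall i : I, (ar i).-tuple M -> Prop) (P : M -> Prop)
  : forall o : option I, (ar_P ar o).-tuple M -> Prop :=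
  fun o => match o return (ar_P ar o).-tuple M -> Prop with
           | Some i => rel i
           | None => fun t => P (thead t)
           end.

(* Main.v *)
From Stdlib Require List.
From HB Require Import structures.
Require Import Defs.
From mathcomp Require Import all_boot generic_quotient zify.
From mathcomp Require Import boolp classical_sets filter.
Set Implicit Arguments. Unset Strict Implicit. Unset Printing Implicit Defensive.

(** Only finitely many symbols matter, so a countably saturated ultrapower K of
    the structure <M, P> is available, and the conclusion is transferred back by
    Los's theorem. In K, the small closure cl (the union of the small P-free
    definable sets over a set) is a pregeometry in which P is independent; the
    support of a set B consists of the p in P that depend on B and the rest of P.
    A finite partial map that is elementary for P-free formulas, respects P and
    has domain and range containing their supports is elementary for <M, P> by
    back and forth.

    Let G be definable over A. For independent generic g and h (of maximal rank
    over A and P) the support of gh is the union of the supports of g and h up to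
    A; as the size of the support is bounded on generics, generic elements have
    no support outside A. Hence, by compactness, the group law agrees on generic
    pairs with a P-free definable relation F. Fix independent generic test points
    a_p and translations e_i. Since G is covered by finitely many translates of
    its generic part, an element g is coded by an index i and the tuple y = g e_i,
    and F y (e_i^-1 a_p) is the value of g a_p at almost all test points; this
    makes the set of codes and its multiplication P-free definable. *)

(** * First-order definability *)

Definition scons (T : Type) (a : T) (v : nat -> T) (k : nat) : T :=
  if k is j.+1 then v j else a.

Section Formulas.
Variables (I : Type) (ar : I -> nat).
Local Notation fm := (formula (ar_P ar)).

Record structure := Structure {
  carrier :> eqType;
  point : carrier;
  interp : forall o : option I, (ar_P ar o).-tuple carrier -> Prop }.

Definition holds (s : structure) (v : nat -> s) (f : fm) : Prop := sat (@interp s) v f.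

Fixpoint P_free (f : fm) : bool :=
  match f with
  | FRel o _ => isSome o
  | FEq _ _ => true
  | FNot g => P_free g
  | FAnd g h => P_free g && P_free h
  | FEx _ g => P_free g
  end.

Fixpoint fv (f : fm) : seq nat :=
  match f with
  | FRel _ vs => vs
  | FEq a b => [:: a; b]
  | FNot g => fv g
  | FAnd g h => fv g ++ fv h
  | FEx x g => [seq k <- fv g | k != x]
  end.

Definition fresh (l : seq nat) : nat := (\max_(k <- l) k).+1.

Lemma fresh_gt (l : seq nat) k : k \in l -> k < fresh l.
Proof. by move=> kl; rewrite ltnS; apply: leq_bigmax_seq. Qed.

Lemma eq_holds (s : structure) (f : fm) (v w : nat -> s) :
  {in fv f, v =1 w} -> holds v f <-> holds w f.
Proof.
rewrite /holds; elim: f v w => [o vs|a b|g IH|g IHg h IHh|x g IH] v w vw /=.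
- suff -> : map_tuple v vs = map_tuple w vs by [].
  by apply: val_inj => /=; apply/eq_in_map.
- by rewrite !vw ?inE ?eqxx ?orbT.
- by have := IH _ _ vw; tauto.
- have vwg : {in fv g, v =1 w} by move=> k kg; apply: vw; rewrite mem_cat kg.
  have vwh : {in fv h, v =1 w} by move=> k kh; apply: vw; rewrite mem_cat kh orbT.
  by have := IHg _ _ vwg; have := IHh _ _ vwh; tauto.
- have E a : sat (@interp s) (fun k => if k == x then a else v k) g <->
             sat (@interp s) (fun k => if k == x then a else w k) g.
    by apply: IH => k kg; case: eqVneq => // kx; apply: vw; rewrite mem_filter kx.
  by split=> -[a /E]; exists a.
Qed.

Fixpoint rename (r : nat -> nat) (f : fm) : fm :=
  match f with
  | FRel o vs => FRel (map_tuple r vs)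
  | FEq a b => FEq _ (r a) (r b)
  | FNot g => FNot (rename r g)
  | FAnd g h => FAnd (rename r g) (rename r h)
  | FEx x g => let z := fresh (map r (fv g)) in
               FEx z (rename (fun k => if k == x then z else r k) g)
  end.

Lemma P_free_rename r f : P_free (rename r f) = P_free f.
Proof. by elim: f r => [o vs|a b|g IH|g IHg h IHh|x g IH] r //=; rewrite ?IHg ?IHh ?IH. Qed.

Lemma fv_rename r f k : k \in fv (rename r f) -> exists2 j, j \in fv f & k = r j.
Proof.
elim: f r k => [o vs|a b|g IH|g IHg h IHh|x g IH] r k /=.
- by case/mapP => j jv ->; exists j.
- by rewrite !inE => /orP[]/eqP->; [exists a|exists b]; rewrite // !inE eqxx ?orbT.
- exact: IH.
- by rewrite mem_cat => /orP[/IHg|/IHh] [j jf ->]; exists j; rewrite // mem_cat jf ?orbT.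
- rewrite mem_filter => /andP[kz /IH[j jg kj]]; case: (eqVneq j x) => jx.
    by move: kz; rewrite kj jx !eqxx.
  by exists j; [rewrite mem_filter jx|rewrite kj (negbTE jx)].
Qed.

Lemma holds_rename (s : structure) r f (v : nat -> s) :
  holds v (rename r f) <-> holds (fun k => v (r k)) f.
Proof.
rewrite /holds; elim: f r v => [o vs|a b|g IH|g IHg h IHh|x g IH] r v //=.
- suff -> : map_tuple v (map_tuple r vs) = map_tuple (fun k => v (r k)) vs by [].
  by apply: val_inj => /=; rewrite -map_comp.
- by rewrite IH.
- by rewrite IHg IHh.
- set z := fresh _.
  have E a : sat (@interp s) (fun k => if k == z then a else v k)
                (rename (fun k => if k == x then z else r k) g) <->
             sat (@interp s) (fun k => if k == x then a else v (r k)) g.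
    rewrite IH; apply: eq_holds => k kg; case: (k == x); first by rewrite eqxx.
    by rewrite ltn_eqF //; apply: fresh_gt; apply: map_f.
  by split=> -[a /E]; exists a.
Qed.

End Formulas.

(* A context is a type [T] of points t, each living over a structure [s t]; it
   is read through a collection [E] of coordinates. The constant family [s] gives
   definability inside one structure, and [T] the type of all structures gives
   the uniform definability that passes to and from ultrapowers. *)
Section FirstOrder.
Variables (I : Type) (ar : I -> nat).
Local Notation structure := (structure ar).
Local Notation fm := (formula (ar_P ar)).

Definition coordinates (T : Type) (s : T -> structure) : Type := (forall t, s t) -> Prop.

Section Context.
Variables (T : Type) (s : T -> structure).
Implicit Types (b : bool) (E : coordinates s) (X Y : T -> Prop).

(* The flag [b] forbids the predicate P. *)
Definition first_order b E X : Prop :=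
  exists (f : fm) (e : nat -> forall t, s t), [/\ b ==> P_free f,
    forall k, k \in fv f -> E (e k) & forall t, X t <-> holds (fun k => e k t) f].

Lemma fo_iff b E X Y : (forall t, X t <-> Y t) -> first_order b E X -> first_order b E Y.
Proof. by move=> XY [f [e [bf Ef Xf]]]; exists f, e; split=> // t; rewrite -XY. Qed.

Lemma fo_sub b E E' X : (forall c, E c -> E' c) -> first_order b E X -> first_order b E' X.
Proof. by move=> EE' [f [e [bf Ef Xf]]]; exists f, e; split=> // k /Ef/EE'. Qed.

Lemma fo_weaken b E X : first_order b E X -> first_order false E X.
Proof. by move=> [f [e [_ Ef Xf]]]; exists f, e. Qed.

Lemma fo_flag b b' E X : b ==> b' -> first_order b' E X -> first_order b E X.
Proof. by case: b => [/= ->|_] //; apply: fo_weaken. Qed.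

Lemma fo_holds b E (f : fm) (v : nat -> forall t, s t) : b ==> P_free f ->
  (forall k, E (v k)) -> first_order b E (fun t => holds (fun k => v k t) f).
Proof. by move=> bf Ev; exists f, v. Qed.

Lemma fo_eq b E c d : E c -> E d -> first_order b E (fun t => c t = d t).
Proof.
move=> Ec Ed; exists (FEq _ 0 1), (fun k => if k is 0 then c else d).
by split=> //= [|[]]; rewrite ?implybT.
Qed.

Lemma fo_predicate E c : E c -> first_order false E (fun t => @interp _ _ (s t) None [tuple c t]).
Proof.
move=> Ec; exists (@FRel _ (ar_P ar) None [tuple 0]), (fun=> c); split=> // t; rewrite /holds /=.
by suff -> : map_tuple (fun=> c t) [tuple 0] = [tuple c t] by []; apply: val_inj.
Qed.

Lemma fo_not b E X : first_order b E X -> first_order b E (fun t => ~ X t).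
Proof. by move=> [f [e [bf Ef Xf]]]; exists (FNot f), e; split=> // t; rewrite Xf. Qed.

Lemma fo_and b E X Y : first_order b E X -> first_order b E Y ->
  first_order b E (fun t => X t /\ Y t).
Proof.
move=> [f [e [bf Ef Xf]]] [g [d [bg Eg Yg]]].
exists (FAnd (rename double f) (rename (fun k => k.*2.+1) g)).
exists (fun k => if odd k then d k./2 else e k./2); split=> [|k|t] /=.
- by rewrite !P_free_rename; case: b bf bg => //= -> ->.
- by rewrite mem_cat => /orP[/fv_rename[j jf ->]|/fv_rename[j jg ->]];
    rewrite /= ?odd_double ?uphalf_double ?doubleK; [apply: Ef|apply: Eg].
- rewrite Xf Yg /holds /= -!/(holds _ _) !holds_rename.
  have -> : (fun k => (if odd k.*2 then d k.*2./2 else e k.*2./2) t) = (fun k => e k t).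
    by apply/funext => k; rewrite odd_double doubleK.
  have -> // : (fun k => (if odd k.*2.+1 then d k.*2.+1./2 else e k.*2.+1./2) t) = (fun k => d k t).
  by apply/funext => k; rewrite /= odd_double uphalf_double.
Qed.

Lemma fo_imp b E X Y : first_order b E X -> first_order b E Y ->
  first_order b E (fun t => X t -> Y t).
Proof.
move=> FX FY; apply: fo_iff (fo_not (fo_and FX (fo_not FY))) => t.
split=> [H Xt|H [Xt]]; last by apply; apply: H.
by apply: contrapT => nY; apply: H.
Qed.

Lemma fo_or b E X Y : first_order b E X -> first_order b E Y ->
  first_order b E (fun t => X t \/ Y t).
Proof.
move=> FX FY; apply: fo_iff (fo_imp (fo_not FX) FY) => t.
by split=> [H|[]//]; case: (pselect (X t)) => [|/H]; [left|right].
Qed.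

Lemma fo_equiv b E X Y : first_order b E X -> first_order b E Y ->
  first_order b E (fun t => X t <-> Y t).
Proof. by move=> FX FY; apply: fo_and; apply: fo_imp. Qed.

Lemma fo_prop b E (p : Prop) : first_order b E (fun=> p).
Proof.
have FT : first_order b E (fun=> True).
  exists (FEx 0 (FEq _ 0 0)), (fun _ t => point (s t)); split=> [|k|t]; rewrite ?implybT //.
  by split=> // _; exists (point (s t)).
case: (pselect p) => H; first by apply: fo_iff FT.
by apply: fo_iff (fo_not FT) => t; split=> // /(_ Logic.I).
Qed.

Lemma fo_all_fin b E (F : finType) (X : F -> T -> Prop) :
  (forall i, first_order b E (X i)) -> first_order b E (fun t => forall i, X i t).
Proof.
move=> FX; suff FXl (l : seq F) : first_order b E (fun t => forall i, i \in l -> X i t).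
  by apply: fo_iff (FXl (enum F)) => t; split=> H i => [|_]; apply: H; rewrite ?mem_enum.
elim: l => [|j l IH]; first by apply: fo_iff (fo_prop b E True) => t; split.
apply: fo_iff (fo_and (FX j) IH) => t.
split=> [[Xj Xl] i|H]; first by rewrite inE => /predU1P[->|/Xl].
by split=> [|i il]; apply: H; rewrite inE ?eqxx ?il ?orbT.
Qed.

Lemma fo_ex_fin b E (F : finType) (X : F -> T -> Prop) :
  (forall i, first_order b E (X i)) -> first_order b E (fun t => exists i, X i t).
Proof.
move=> FX; apply: fo_iff (fo_not (fo_all_fin (fun i => fo_not (FX i)))) => t.
by split=> [/existsNP[i /contrapT]|[i Xi] /(_ i)]; first exists i.
Qed.

Lemma fo_all_mem b E (F : eqType) (l : seq F) (X : F -> T -> Prop) :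
  (forall i, i \in l -> first_order b E (X i)) ->
  first_order b E (fun t => forall i, i \in l -> X i t).
Proof.
move=> FX; apply: (@fo_iff _ _ (fun t => forall k : 'I_(size l), X (tnth (in_tuple l) k) t)).
  by move=> t; split=> [H i /(@tnthP _ _ (in_tuple l))[k ->]|H k] //; apply/H/(mem_tnth k (in_tuple l)).
by apply: fo_all_fin => k; apply/FX/(mem_tnth k (in_tuple l)).
Qed.

End Context.

Lemma fo_comp (T T' : Type) (s : T -> structure) (h : T' -> T) b (E : coordinates s)
    (E' : coordinates (fun t => s (h t))) (X : T -> Prop) : first_order b E X ->
  (forall c, E c -> E' (fun t => c (h t))) -> first_order b E' (fun t => X (h t)).
Proof.
move=> [f [e [bf Ef Xf]]] EE'; exists f, (fun k t => e k (h t)).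
by split=> // k kf; apply: EE'; apply: Ef.
Qed.

Section Extension.
Variables (T : Type) (s : T -> structure).

Inductive ext (D : T -> Type) (F : (forall t, D t -> s t) -> Prop) (E : coordinates s) :
    coordinates (fun u : {t : T & D t} => s (tag u)) :=
| ext_old c of E c : ext F E (fun u => c (tag u))
| ext_new c of F c : ext F E (fun u => c (tag u) (tagged u)).

Definition elt_coord (c : forall t, s t -> s t) : Prop := c = fun=> id.

Definition tuple_coord n (c : forall t, n.-tuple (s t) -> s t) : Prop :=
  exists i, c = fun t x => tnth x i.

Lemma fo_ex b (E : coordinates s) (X : forall t, s t -> Prop) :
  first_order b (ext elt_coord E) (fun u => X (tag u) (tagged u)) ->
  first_order b E (fun t => exists a, X t a).
Proof.
move=> [f [e [bf Ef Xf]]].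
have [c ec] : {c : nat -> option (forall t, s t) & forall k, k \in fv f ->
    match c k with Some d => E d /\ e k = (fun u => d (tag u)) | None => e k = @tagged _ _ end}.
  apply: (choice (P := fun k o => k \in fv f -> match o with
    | Some d => E d /\ e k = (fun u => d (tag u)) | None => e k = @tagged _ _ end)) => k.
  case: (boolP (k \in fv f)) => [/Ef|]; last by exists None.
  by case=> [d Ed|d ->]; [exists (Some d)|exists None].
pose x := fresh (fv f); pose r k := if c k is Some _ then k else x.
exists (FEx x (rename r f)), (fun k t => if c k is Some d then d t else point (s t)).
split=> [|k|t] /=; first by rewrite P_free_rename.
  rewrite mem_filter => /andP[kx /fv_rename[j jf kj]].
  move: (ec j jf) kx; rewrite kj /r; case cj: (c j) => [d|]; last by rewrite eqxx.
  by rewrite cj => -[].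
suff X_holds a : X t a <-> holds (fun k => if k == x then a else
    if c k is Some d then d t else point (s t)) (rename r f) by split=> -[a /X_holds]; exists a.
rewrite holds_rename -[X t a]/(X _ (tagged (Tagged (fun t => s t) a))) Xf.
apply: eq_holds => k kf; have := ec k kf; rewrite /r.
case ck: (c k) => [d|] => [[_ ->]|->]; last by rewrite eqxx.
by rewrite ck ltn_eqF // fresh_gt.
Qed.

Lemma fo_all b (E : coordinates s) (X : forall t, s t -> Prop) :
  first_order b (ext elt_coord E) (fun u => X (tag u) (tagged u)) ->
  first_order b E (fun t => forall a, X t a).
Proof.
move=> FX; apply: fo_iff (fo_not (@fo_ex b E (fun t a => ~ X t a) (fo_not FX))) => t.
split=> [nX a|H [a]]; last by apply.
by apply: contrapT => nXa; apply: nX; exists a.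
Qed.

End Extension.

Lemma fo_ex_tuple n (T : Type) (s : T -> structure) b (E : coordinates s)
    (X : forall t, n.-tuple (s t) -> Prop) :
  first_order b (ext (@tuple_coord _ s n) E) (fun u => X (tag u) (tagged u)) ->
  first_order b E (fun t => exists x, X t x).
Proof.
elim: n T s E X => [|n IH] T s E X FX.
  pose h t := Tagged (fun t => 0.-tuple (s t)) ([tuple] : 0.-tuple (s t)).
  suff FXh : first_order b E (fun t => X (tag (h t)) (tagged (h t))).
    by apply: fo_iff FXh => t; split=> [|[x]]; [exists [tuple]|rewrite [x]tuple0].
  apply: (@fo_comp _ _ _ h _ _ _ _ FX) => c.
  by case=> [d Ed|d [[]]].
apply: (@fo_iff _ _ _ _ (fun t => exists a (x : n.-tuple (s t)), X t [tuple of a :: x])).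
  move=> t; split=> [[a [x]]|[x]]; first by exists [tuple of a :: x].
  by rewrite {1}(tuple_eta x) => Xx; exists (thead x), (behead_tuple x).
apply: fo_ex; apply: IH.
pose h (u : {v : {t : T & s t} & n.-tuple (s (tag v))}) :=
  Tagged (fun t => n.+1.-tuple (s t)) [tuple of tagged (tag u) :: tagged u].
apply: (@fo_comp _ _ _ h _ _ _ _ FX) => c; case=> [d Ed|_ [i ->]] /=.
  by apply: (@ext_old _ _ _ _ _ (fun u => d (tag u))); apply: ext_old.
case: (unliftP ord0 i) => [j|] ->.
  have -> : (fun u : {v : {t : T & s t} & n.-tuple (s (tag v))} =>
      tnth [tuple of tagged (tag u) :: tagged u] (lift ord0 j)) = fun u => tnth (tagged u) j.
    by apply: functional_extensionality_dep => u; rewrite tnthS.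
  by apply: (@ext_new _ _ _ _ _ (fun u x => tnth x j)); exists j.
apply: (@ext_old _ _ _ _ _ (fun u => tagged u)).
by apply: (@ext_new _ _ _ _ _ (fun=> id)).
Qed.

Lemma fo_all_tuple n (T : Type) (s : T -> structure) b (E : coordinates s)
    (X : forall t, n.-tuple (s t) -> Prop) :
  first_order b (ext (@tuple_coord _ s n) E) (fun u => X (tag u) (tagged u)) ->
  first_order b E (fun t => forall x, X t x).
Proof.
move=> FX; apply: fo_iff (fo_not (@fo_ex_tuple n _ _ b E (fun t x => ~ X t x) (fo_not FX))) => t.
split=> [nX x|H [x]]; last by apply.
by apply: contrapT => nXx; apply: nX; exists x.
Qed.

Definition term (T : Type) (s : T -> structure) (E : coordinates s) n
  (x : forall t, n.-tuple (s t)) : Prop := forall i, E (fun t => tnth (x t) i).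

Lemma term_cat (T : Type) (s : T -> structure) (E : coordinates s) n m
    (x : forall t, n.-tuple (s t)) (y : forall t, m.-tuple (s t)) :
  term E x -> term E y -> term E (fun t => cat_tuple (x t) (y t)).
Proof.
move=> Ex Ey i; case: (split_ordP i) => j ->.
  have -> : (fun t => tnth (cat_tuple (x t) (y t)) (lshift m j)) = fun t => tnth (x t) j.
    by apply: functional_extensionality_dep => t; rewrite tnth_lshift.
  exact: Ex.
have -> : (fun t => tnth (cat_tuple (x t) (y t)) (rshift n j)) = fun t => tnth (y t) j.
  by apply: functional_extensionality_dep => t; rewrite tnth_rshift.
exact: Ey.
Qed.

Lemma term_tuple1 (T : Type) (s : T -> structure) (E : coordinates s) c :
  E c -> term E (fun t => [tuple c t]).
Proof. by move=> Ec i; rewrite (ord1 i). Qed.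

Lemma term_tuple2 (T : Type) (s : T -> structure) (E : coordinates s) c d :
  E c -> E d -> term E (fun t => [tuple c t; d t]).
Proof. by move=> Ec Ed i; case: (unliftP ord0 i) => [j|] -> //; rewrite (ord1 j). Qed.

Lemma fo_eq_tuple (T : Type) (s : T -> structure) b (E : coordinates s) n
    (x y : forall t, n.-tuple (s t)) :
  term E x -> term E y -> first_order b E (fun t => x t = y t).
Proof.
move=> Ex Ey; apply: fo_iff (fo_all_fin (fun i => fo_eq b (Ex i) (Ey i))) => t.
by split=> [/eq_from_tnth|-> //].
Qed.

End FirstOrder.

Section OrderedGroupLanguage.
Variables (I : Type) (ar : I -> nat).
Local Notation structure := (structure ar).

Record ordered_group_language := OrderedGroupLanguage {
  lt_formula : formula (ar_P ar);
  op_formula : formula (ar_P ar);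
  lt_P_free : P_free lt_formula;
  op_P_free : P_free op_formula }.

Definition in_P (s : structure) (x : s) : Prop := @interp _ _ s None [tuple x].

Variable L : ordered_group_language.

Definition lt_in (s : structure) (x y : s) : Prop :=
  holds (scons x (fun=> y)) (lt_formula L).

Definition op_in (s : structure) (x y z : s) : Prop :=
  holds (scons x (scons y (fun=> z))) (op_formula L).

(* For definable sets in o-minimal structures this means finite; unlike
   finiteness, it is a first-order condition. *)
Definition small (s : structure) (X : s -> Prop) : Prop :=
  ~ exists a b, lt_in a b /\ forall x, lt_in a x -> lt_in x b -> X x.

Variables (T : Type) (s : T -> structure).
Implicit Types (b : bool) (E : coordinates s).

Lemma fo_lt b E c d : E c -> E d -> first_order b E (fun t => lt_in (c t) (d t)).
Proof.
move=> Ec Ed.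
apply: (@fo_iff _ _ _ _ _ _ (fun t => holds (fun k => (scons c (fun=> d)) k t) (lt_formula L))).
  by move=> t; apply: eq_holds => -[].
by apply: fo_holds => [|[]]; rewrite ?lt_P_free ?implybT.
Qed.

Lemma fo_op b E c d f : E c -> E d -> E f -> first_order b E (fun t => op_in (c t) (d t) (f t)).
Proof.
move=> Ec Ed Ef.
apply: (@fo_iff _ _ _ _ _ _ (fun t => holds (fun k => (scons c (scons d (fun=> f))) k t) (op_formula L))).
  by move=> t; apply: eq_holds => -[|[]].
by apply: fo_holds => [|[|[]]]; rewrite ?op_P_free ?implybT.
Qed.

Lemma fo_in_P E c : E c -> first_order false E (fun t => in_P (c t)).
Proof. exact: fo_predicate. Qed.

Lemma fo_and3 b E (X Y Z : T -> Prop) : first_order b E X -> first_order b E Y ->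
  first_order b E Z -> first_order b E (fun t => [/\ X t, Y t & Z t]).
Proof. by move=> FX FY FZ; apply: fo_iff (fo_and FX (fo_and FY FZ)) => t; split=> [[? []]|[]]. Qed.

Lemma fo_and4 b E (X Y Z W : T -> Prop) : first_order b E X -> first_order b E Y ->
  first_order b E Z -> first_order b E W ->
  first_order b E (fun t => [/\ X t, Y t, Z t & W t]).
Proof.
move=> FX FY FZ FW; apply: fo_iff (fo_and FX (fo_and3 FY FZ FW)) => t.
by split=> [[? []]|[]].
Qed.

End OrderedGroupLanguage.

(* [fo] proves a condition first order along its logical structure. Atoms are
   handled by the hint database [fo] and by the hypotheses that state
   definability; [coord] finds their arguments among the coordinates. *)
Ltac coord_old :=
  lazymatch goal with |- ext _ _ ?B =>
    let F := constr:(fun __t => ltac:(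
      let t := eval cbv beta in (B __t) in
      let t' := eval pattern (tag __t) in t in
      lazymatch t' with ?f _ => exact f end)) in
    lazymatch F with (fun _ => ?f) => apply: (@ext_old _ _ _ _ _ _ _ f) end
  end.

Ltac coord_new := first
  [ exact: (@ext_new _ _ _ _ _ _ _ (fun=> id))
  | lazymatch goal with |- ext _ _ (fun u => tnth (tagged u) ?i) =>
      apply: (@ext_new _ _ _ _ _ _ _ (fun _ x => tnth x i)); by exists i end ].

Ltac coord_base := first
  [ assumption | by left | by left; left | by left; right
  | by right; eexists; [|reflexivity]; first [exact: Logic.I|auto] | by left; eexists; [|reflexivity]
  | by left; left; left; eexists; [|reflexivity] | by left; left; right; eexists; [|reflexivity]
  | by left; right; eexists; [|reflexivity] | by auto | by eexists; reflexivity ].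

Ltac coord := cbn beta; repeat first [assumption | coord_new | coord_old]; coord_base.

Ltac fo_atom := first
  [ assumption
  | solve [auto with fo nocore]
  | apply: fo_eq; coord | apply: fo_lt; coord | apply: fo_op; coord | apply: fo_in_P; coord
  | apply: fo_eq_tuple => ?; coord
  | by apply: fo_prop ].

Ltac fo_step := cbn beta; lazymatch goal with
  | |- first_order _ _ (fun t => ~ _) => apply: fo_not
  | |- first_order _ _ (fun t => _ <-> _) => apply: fo_equiv
  | |- first_order _ _ (fun t => _ /\ _) => apply: fo_and
  | |- first_order _ _ (fun t => [/\ _, _ & _]) => apply: fo_and3
  | |- first_order _ _ (fun t => [/\ _, _, _ & _]) => apply: fo_and4
  | |- first_order _ _ (fun t => _ \/ _) => apply: fo_or
  | |- first_order _ _ (fun t => exists a, _) =>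
      first [apply: fo_ex | apply: fo_ex_tuple | apply: fo_ex_fin => ?]
  | |- first_order _ _ (fun t => forall a, _) =>
      first [apply: fo_imp | apply: fo_all | apply: fo_all_tuple | apply: fo_all_fin => ?]
  | |- first_order _ _ _ => fo_atom
  end.

Ltac fo := repeat fo_step.

Lemma fo_small (I : Type) (ar : I -> nat) (L : ordered_group_language ar) (T : Type)
    (s : T -> structure ar) b (E : coordinates s) (X : forall t, s t -> Prop) :
  first_order b (ext (@elt_coord _ _ _ s) E) (fun u => X (tag u) (tagged u)) ->
  first_order b E (fun t => small L (X t)).
Proof.
move=> FX; rewrite /small; fo.
pose h (u : {v : {w : {t : T & s t} & s (tag w)} & s (tag (tag v))}) :=
  Tagged (fun t => s t) (tagged u).
apply: (@fo_comp _ _ _ _ (fun u => s (tag u)) h _ _ _ _ FX) => c; case=> [d Ed|_ ->]; rewrite /h /=; coord.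
Qed.

#[global] Hint Extern 1 (first_order _ _ (fun t => small _ _)) => apply: fo_small; fo : fo.

Definition lpart n m (T : Type) (t : (n + m).-tuple T) : n.-tuple T := [tuple tnth t (lshift m i) | i < n].

Definition rpart n m (T : Type) (t : (n + m).-tuple T) : m.-tuple T := [tuple tnth t (rshift n i) | i < m].

Lemma lpart_cat n m (T : Type) (x : n.-tuple T) (y : m.-tuple T) : lpart (cat_tuple x y) = x.
Proof. by apply: eq_from_tnth => i; rewrite tnth_mktuple tnth_lshift. Qed.

Lemma rpart_cat n m (T : Type) (x : n.-tuple T) (y : m.-tuple T) : rpart (cat_tuple x y) = y.
Proof. by apply: eq_from_tnth => i; rewrite tnth_mktuple tnth_rshift. Qed.

Lemma cat_lrpart n m (T : Type) (t : (n + m).-tuple T) : cat_tuple (lpart t) (rpart t) = t.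
Proof.
by apply: eq_from_tnth => i; case: (split_ordP i) => j ->;
  rewrite ?tnth_lshift ?tnth_rshift tnth_mktuple.
Qed.

Section DefinableSets.
Local Open Scope classical_set_scope.
Variables (I : Type) (ar : I -> nat).
Variable K : structure ar.
Implicit Types (b : bool) (A : set K).

Definition consts (T : Type) A : set (T -> K) := [set fun=> a | a in A].

Lemma sub_consts (T : Type) A A' : A `<=` A' -> @consts T A `<=` @consts T A'.
Proof. by move=> AA' _ [a /AA' ? <-]; exists a. Qed.

Lemma consts_ext (T : Type) (D : Type) (F : set (T -> D -> K)) (E : set (T -> K)) A :
  consts A `<=` E -> consts A `<=` @ext _ _ T (fun=> K) (fun=> D) F E.
Proof. by move=> AE _ [a Aa <-]; apply: (@ext_old _ _ _ _ _ _ _ (fun=> a)); apply: AE; exists a. Qed.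

Definition elt_context A : set (K -> K) := [set id] `|` consts A.

Definition pair_context A : set (K * K -> K) := [set fst; snd] `|` consts A.

Definition tuple_context n A : set (n.-tuple K -> K) :=
  [set fun x => tnth x i | i in [set: 'I_n]] `|` consts A.

Definition couple_context n m A : set (n.-tuple K * m.-tuple K -> K) :=
  [set fun x => tnth x.1 i | i in [set: 'I_n]] `|` [set fun x => tnth x.2 i | i in [set: 'I_m]]
  `|` consts A.

Definition triple_context n A : set (n.-tuple K * n.-tuple K * n.-tuple K -> K) :=
  [set fun x => tnth x.1.1 i | i in [set: 'I_n]] `|` [set fun x => tnth x.1.2 i | i in [set: 'I_n]]
  `|` [set fun x => tnth x.2 i | i in [set: 'I_n]] `|` consts A.

Definition definable_set b A (X : K -> Prop) : Prop :=
  first_order (s := fun=> K) b (elt_context A) X.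

Definition definable_rel b A (R : K -> K -> Prop) : Prop :=
  first_order (s := fun=> K) b (pair_context A) (fun p => R p.1 p.2).

Definition definable_tuples b A n (X : n.-tuple K -> Prop) : Prop :=
  first_order (s := fun=> K) b (@tuple_context n A) X.

Definition definable_binary b A n m (R : n.-tuple K -> m.-tuple K -> Prop) : Prop :=
  first_order (s := fun=> K) b (@couple_context n m A) (fun p => R p.1 p.2).

Definition definable_ternary b A n (R : n.-tuple K -> n.-tuple K -> n.-tuple K -> Prop) : Prop :=
  first_order (s := fun=> K) b (@triple_context n A) (fun p => R p.1.1 p.1.2 p.2).

Section Substitution.
Variables (T : Type) (E : set (T -> K)) (b b' : bool) (A : set K).
Hypotheses (bb' : b ==> b') (AE : consts A `<=` E).

Lemma fo_set X (c : T -> K) : definable_set b' A X -> E c ->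
  first_order (s := fun=> K) b E (fun t => X (c t)).
Proof.
move=> DX Ec; apply: (fo_flag bb'); apply: (fo_comp (h := c) DX) => d [->|[a Aa <-]] //.
by apply: AE; exists a.
Qed.

Lemma fo_rel R (c d : T -> K) : definable_rel b' A R -> E c -> E d ->
  first_order (s := fun=> K) b E (fun t => R (c t) (d t)).
Proof.
move=> DR Ec Ed; apply: (fo_flag bb'); apply: (fo_comp (h := fun t => (c t, d t)) DR) => f.
by case=> [[]->|[a Aa <-]] //; apply: AE; exists a.
Qed.

Lemma fo_tuples n X (x : T -> n.-tuple K) : definable_tuples b' A X -> term (s := fun=> K) E x ->
  first_order (s := fun=> K) b E (fun t => X (x t)).
Proof.
move=> DX Ex; apply: (fo_flag bb'); apply: (fo_comp (h := x) DX) => d.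
by case=> [[i _ <-]|[a Aa <-]]; [apply: Ex|apply: AE; exists a].
Qed.

Lemma fo_ternary n R (x y z : T -> n.-tuple K) : definable_ternary b' A R ->
  term (s := fun=> K) E x -> term (s := fun=> K) E y -> term (s := fun=> K) E z ->
  first_order (s := fun=> K) b E (fun t => R (x t) (y t) (z t)).
Proof.
move=> DR Ex Ey Ez; apply: (fo_flag bb'); apply: (fo_comp (h := fun t => (x t, y t, z t)) DR) => d.
by case=> [[[|]|]|] [i ? <-]; [apply: Ex|apply: Ey|apply: Ez|apply: AE; exists i].
Qed.

End Substitution.

Lemma fo_factor (T T' : Type) (h : T -> T') b (E : set (T -> K)) (E' : set (T' -> K)) X :
  (forall c, E c -> exists2 d, E' d & forall t, c t = d (h t)) ->
  first_order (s := fun=> K) b E X ->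
  exists2 Y, first_order (s := fun=> K) b E' Y & forall t, X t <-> Y (h t).
Proof.
move=> EE' [f [e [bf Ef Xf]]].
have [d Hd] : {d : nat -> T' -> K & forall k, k \in fv f -> E' (d k) /\ forall t, e k t = d k (h t)}.
  apply: (choice (P := fun k d => k \in fv f -> E' d /\ forall t, e k t = d (h t))) => k.
  case: (boolP (k \in fv f)) => [/Ef/EE'[d Ed ed]|]; first by exists d.
  by exists (fun=> point K).
exists (fun t' => holds (fun k => d k t') f) => [|t].
  by exists f, d; split=> // k /Hd[].
by rewrite Xf; apply: eq_holds => k /Hd[_ ->].
Qed.

Lemma definable_set_param b A a X : definable_set b (A `|` [set a]) X ->
  exists2 R, definable_rel b A R & forall x, X x <-> R a x.
Proof.
move=> DX; have [|Y DY XY] := @fo_factor _ _ (pair a) b _ (pair_context A) _ _ DX.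
  move=> c [->|[x [Ax|->] <-]].
  - by exists snd => //; left; right.
  - by exists (fun=> x) => //; right; exists x.
  - by exists fst => //; left; left.
by exists (fun x y => Y (x, y)) => //; apply: fo_iff DY => -[].
Qed.

Lemma fo_finite_params (T : Type) b A (F : set (T -> K)) X :
  first_order (s := fun=> K) b (F `|` consts A) X ->
  exists2 l : seq K, [set` l] `<=` A & first_order (s := fun=> K) b (F `|` consts [set` l]) X.
Proof.
move=> [f [e [bf Ef Xf]]].
suff [l lA El] : exists2 l : seq K, [set` l] `<=` A &
    forall k, k \in fv f -> (F `|` consts [set` l]) (e k).
  by exists l => //; exists f, e.
elim: (fv f) Ef => [|k ks IH] Ef; first by exists [::].
have [l lA El] : exists2 l : seq K, [set` l] `<=` A &
    forall j, j \in ks -> (F `|` consts [set` l]) (e j).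
  by apply: IH => j jks; apply: Ef; rewrite inE jks orbT.
have [Fk|[a Aa ea]] := Ef k (mem_head _ _).
  by exists l => // j; rewrite inE => /predU1P[->|/El//]; left.
exists (a :: l) => [x|j] /=; rewrite inE => /predU1P[->|]; first exact: Aa.
- exact: lA.
- by right; exists a => //=; rewrite mem_head.
- move=> /El[Fj|[x xl xj]]; [by left|right; exists x => //=].
  by rewrite inE; apply/orP; right.
Qed.

Lemma term_lpart (T : Type) (E : set (T -> K)) n m (x : T -> (n + m).-tuple K) :
  term (s := fun=> K) E x -> term (s := fun=> K) E (fun t => lpart (x t)).
Proof.
move=> Ex i; have -> : (fun t => tnth (lpart (x t)) i) = fun t => tnth (x t) (lshift m i); last exact: Ex.
by apply/funext => t; rewrite tnth_mktuple.
Qed.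

Lemma term_rpart (T : Type) (E : set (T -> K)) n m (x : T -> (n + m).-tuple K) :
  term (s := fun=> K) E x -> term (s := fun=> K) E (fun t => rpart (x t)).
Proof.
move=> Ex i; have -> : (fun t => tnth (rpart (x t)) i) = fun t => tnth (x t) (rshift n i); last exact: Ex.
by apply/funext => t; rewrite tnth_mktuple.
Qed.

Lemma term_tuple_context n A : term (s := fun=> K) (@tuple_context n A) id.
Proof. by move=> i; left; exists i. Qed.

Lemma definable_binary_cat b A n m (R : n.-tuple K -> m.-tuple K -> Prop) :
  definable_binary b A R <-> definable_tuples b A (fun t : (n + m).-tuple K => R (lpart t) (rpart t)).
Proof.
have idt := @term_tuple_context (n + m) A; split=> DR.
  apply: (fo_comp (h := fun t => (lpart t, rpart t)) DR) => c.
  case=> [[|] [i _ <-]|[a Aa <-]]; [exact: (term_lpart idt)|exact: (term_rpart idt)|by right; exists a].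
have R_cat p : R p.1 p.2 <-> R (lpart (cat_tuple p.1 p.2)) (rpart (cat_tuple p.1 p.2)).
  by rewrite lpart_cat rpart_cat.
apply: fo_iff (fun p => iff_sym (R_cat p)) _.
apply: (fo_tuples (x := fun p => cat_tuple p.1 p.2) _ _ DR); [exact: implybb|exact: subsetUr|].
by apply: term_cat => i; left; [left|right]; exists i.
Qed.

Lemma definable_ternary_cat b A n (R : n.-tuple K -> n.-tuple K -> n.-tuple K -> Prop) :
  definable_ternary b A R <-> definable_tuples b A (fun t : (n + (n + n)).-tuple K =>
    R (lpart t) (lpart (rpart t)) (rpart (rpart t))).
Proof.
have idt := @term_tuple_context (n + (n + n)) A; split=> DR.
  apply: (fo_ternary _ _ DR); [exact: implybb|exact: subsetUr|..].
  - exact: (term_lpart idt).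
  - exact: (term_lpart (term_rpart idt)).
  - exact: (term_rpart (term_rpart idt)).
pose cat3 (p : n.-tuple K * n.-tuple K * n.-tuple K) := cat_tuple p.1.1 (cat_tuple p.1.2 p.2).
have R_cat p : R p.1.1 p.1.2 p.2 <->
    R (lpart (cat3 p)) (lpart (rpart (cat3 p))) (rpart (rpart (cat3 p))).
  by rewrite /cat3 !(lpart_cat, rpart_cat).
apply: fo_iff (fun p => iff_sym (R_cat p)) _.
apply: (fo_tuples (x := cat3) _ _ DR); [exact: implybb|exact: subsetUr|].
apply: term_cat => [i|]; first by left; left; left; exists i.
by apply: term_cat => i; left; [left; right|right]; exists i.
Qed.

End DefinableSets.

Ltac consts_in := repeat apply: consts_ext; first
  [ assumption | exact: subsetUr
  | by move=> _ [? ? <-]; auto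
  | by apply: subset_trans (@subsetUr _ _ _); apply: sub_consts ].

Ltac fo_term := cbn beta; lazymatch goal with
  | |- term _ (fun t => cat_tuple _ _) => apply: term_cat; fo_term
  | |- _ => first [by move=> ?; coord | apply: term_tuple1; coord | apply: term_tuple2; coord]
  end.

Ltac fo_hyp := match goal with
  | D : definable_set _ _ ?X |- first_order _ _ (fun t => ?X _) =>
      apply: (fo_set _ _ D); [by rewrite ?implybb|consts_in|coord]
  | D : definable_rel _ _ ?R |- first_order _ _ (fun t => ?R _ _) =>
      apply: (fo_rel _ _ D); [by rewrite ?implybb|consts_in|coord|coord]
  | D : definable_tuples _ _ ?X |- first_order _ _ (fun t => ?X _) =>
      apply: (fo_tuples _ _ D); [by rewrite ?implybb|consts_in|fo_term]
  | D : definable_ternary _ _ ?R |- first_order _ _ (fun t => ?R _ _ _) =>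
      apply: (fo_ternary _ _ D);
        [by rewrite ?implybb|consts_in|fo_term|fo_term|fo_term]
  end.

#[global] Hint Extern 1 (first_order _ _ _) => fo_hyp : fo.

(** * Small sets in o-minimal structures *)

Section OMinimalGroup.
Local Open Scope classical_set_scope.
Variables (I : Type) (ar : I -> nat) (L : ordered_group_language ar).
Variable s : structure ar.
Local Notation lt := (@lt_in _ ar L s).
Local Notation le x y := (~ lt y x).
Local Notation small := (@small _ ar L s).
Local Notation definable_set := (@definable_set _ ar s true setT).
Local Notation definable_rel := (@definable_rel _ ar s true setT).

Fixpoint in_pieces (ps : seq (piece s)) (y : s) : Prop :=
  if ps is p :: ps' then in_piece lt p y \/ in_pieces ps' y else False.

Variables (op : s -> s -> s) (e : s) (inv : s -> s).

Record ominimal_group : Prop := OMinimalGroup {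
  og_op_in : forall x y z, op_in L x y z <-> op x y = z;
  og_opA : forall x y z, op (op x y) z = op x (op y z);
  og_op1l : forall x, op e x = x;
  og_op1r : forall x, op x e = x;
  og_opVl : forall x, op (inv x) x = e;
  og_opVr : forall x, op x (inv x) = e;
  og_irr : forall x, ~ lt x x;
  og_trans : forall x y z, lt x y -> lt y z -> lt x z;
  og_total : forall x y, lt x y \/ x = y \/ lt y x;
  og_ltl : forall x y z, lt x y -> lt (op z x) (op z y);
  og_ltr : forall x y z, lt x y -> lt (op x z) (op y z);
  og_dense : forall x y, lt x y -> exists z, lt x z /\ lt z y;
  og_nontrivial : exists x, lt e x;
  og_omin : forall X, definable_set X -> exists ps, forall y, X y <-> in_pieces ps y }.

Hypothesis og : ominimal_group.
Local Notation lt_irr := (og_irr og).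
Local Notation lt_trans := (og_trans og).
Local Notation lt_total := (og_total og).
Local Notation dense := (og_dense og).

Lemma op_lt_self x a : lt e a -> lt x (op x a).
Proof. by move=> /(og_ltl og x); rewrite (og_op1r og). Qed.

Lemma exists_gt x : exists y, lt x y.
Proof. by have [a /(op_lt_self x)] := og_nontrivial og; exists (op x a). Qed.

Lemma exists_lt x : exists y, lt y x.
Proof.
have [a ea] := og_nontrivial og; exists (op x (inv a)).
by have := op_lt_self (op x (inv a)) ea; rewrite (og_opA og) (og_opVl og) (og_op1r og).
Qed.

Lemma le_lt_trans x y z : le x y -> lt y z -> lt x z.
Proof. by move=> xy yz; case: (lt_total x y) => [/lt_trans|[->|/xy]] //; apply. Qed.

Lemma lt_le_trans x y z : lt x y -> le y z -> lt x z.
Proof. by move=> xy yz; case: (lt_total y z) => [|[<-|/yz]] //; apply: lt_trans. Qed.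

Lemma ltW x y : lt x y -> le x y.
Proof. by move=> xy /(lt_trans xy)/lt_irr. Qed.

Lemma le_total x y : le x y \/ le y x.
Proof. by case: (lt_total x y) => [/ltW|[->|/ltW]]; [left|left; apply: lt_irr|right]. Qed.

Lemma exists_gt_le2 u v w : lt u v -> lt u w -> exists z, [/\ lt u z, le z v & le z w].
Proof.
move=> uv uw; case: (le_total v w) => vw; [exists v|exists w]; split=> //; exact: lt_irr.
Qed.

Lemma gap_above (l : seq s) u : exists2 v, lt u v & forall x, x \in l -> lt u x -> le v x.
Proof.
elim: l => [|y l [v uv Hv]]; first by have [v uv] := exists_gt u; exists v.
case: (pselect (lt u y)) => uy.
  have [z [uz zv zy]] := exists_gt_le2 uv uy; exists z => // x.
  rewrite inE => /predU1P[->//|xl] ux /lt_le_trans-/(_ _ zv).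
  exact: Hv.
by exists v => // x; rewrite inE => /predU1P[->//|]; apply: Hv.
Qed.

Lemma finite_small (X : s -> Prop) (l : seq s) : (forall x, X x -> x \in l) -> small X.
Proof.
move=> Xl [a [b [ab Xab]]]; have [v av lv] := gap_above l a.
have [z [az zv zb]] := exists_gt_le2 av ab; have [y [ay yz]] := dense az.
by apply: (lv y (Xl _ (Xab _ ay (lt_le_trans yz zb))) ay); apply: lt_le_trans yz zv.
Qed.

Lemma subset_small (X Y : s -> Prop) : X `<=` Y -> small Y -> small X.
Proof. by move=> XY nY [a [b [ab Xab]]]; apply: nY; exists a, b; split=> // x ax /(Xab x ax)/XY. Qed.

Lemma small_finite (X : s -> Prop) : definable_set X -> small X ->
  exists l : seq s, forall x, X x -> x \in l.
Proof.
move=> /(og_omin og)[ps]; elim: ps X => [|p ps IH] X Xps sX; first by exists [::] => x /Xps.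
have [|l psl] := IH (in_pieces ps) (fun=> conj id id).
  by apply: subset_small sX => x xps; apply/Xps; right.
case: p Xps => [a|a b] Xps.
  by exists (a :: l) => x /Xps[/= ->|/psl]; rewrite inE ?eqxx // => ->; rewrite orbT.
exists l => x /Xps[[ax xb]|/psl//]; case: sX.
have [c xc cb] : exists2 c, lt x c & forall y, lt y c -> if b is Some b' then lt y b' else True.
  case: b xb {Xps} => [b|] xb; first by exists b.
  by have [c] := exists_gt x; exists c.
exists x, c; split=> // y xy yc; apply/Xps; left; split; last exact: cb.
by case: (a) ax => // a' ax; apply: lt_trans xy.
Qed.

Lemma finite_min (X : s -> Prop) (l : seq s) x0 : (forall x, X x -> x \in l) -> X x0 ->
  exists2 m, X m & forall x, X x -> le m x.
Proof.
elim: l X x0 => [|a l IH] X x0 Xl Xx0; first by have := Xl _ Xx0.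
case: (pselect (exists x, X x /\ lt x a)) => [[x [Xx xa]]|not_lt_a].
  have [|m [Xm ma] m_min] := IH (fun x => X x /\ lt x a) x _ (conj Xx xa).
    by move=> y [/Xl]; rewrite inE => /predU1P[->/lt_irr|].
  by exists m => // y Xy ym; apply: (m_min y _ ym); split=> //; apply: lt_trans ma.
case: (pselect (X a)) => Xa; first by exists a => // x Xx xa; apply: not_lt_a; exists x.
apply: (IH X x0) => // x Xx; have := Xl _ Xx; rewrite inE => /predU1P[xa|//].
by rewrite xa in Xx.
Qed.

Definition is_inf (X : s -> Prop) m : Prop :=
  (forall x, X x -> le m x) /\ forall y, lt m y -> exists2 x, X x & lt x y.

Lemma is_infU (X Y : s -> Prop) m m' : is_inf X m -> is_inf Y m' -> exists n, is_inf (X `|` Y) n.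
Proof.
have inf_left (X' Y' : s -> Prop) k k' : is_inf X' k -> is_inf Y' k' -> le k k' ->
    is_inf (X' `|` Y') k.
  move=> [X'k kX'] [Y'k _] kk'; split=> [x [/X'k//|Y'x xk]|y /kX'[x X'x xy]].
    by apply: (Y'k _ Y'x); apply: lt_le_trans kk'.
  by exists x => //; left.
move=> Xm Ym'; case: (le_total m m') => [mm'|m'm]; first by exists m; apply: inf_left mm'.
by exists m'; rewrite setUC; apply: inf_left m'm.
Qed.

Lemma piece_inf p t : (exists x, in_piece lt p x) -> (forall x, in_piece lt p x -> le t x) ->
  exists m, is_inf (in_piece lt p) m.
Proof.
case: p => [a _ _|[a|] b [z [az zb]] le_t].
- by exists a; split=> [y ->|y ay]; [apply: lt_irr|exists a].
- exists a; split=> [y [ay _]|y ay]; first exact: ltW.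
  have [w [aw wz wy]] := exists_gt_le2 az ay.
  have [v [av vw]] := dense aw; exists v; last exact: lt_le_trans vw wy.
  split=> //; case: (b) zb => // b' zb; apply: lt_trans zb.
  exact: lt_le_trans vw wz.
- have [m mt mz] : exists2 m, le m t & le m z.
    by case: (le_total t z) => tz; [exists t|exists z] => //; apply: lt_irr.
  have [u um] := exists_lt m; case: (le_t u); last exact: lt_le_trans mt.
  by split=> //; case: (b) zb => // b' zb; apply: lt_trans (lt_le_trans um mz) zb.
Qed.

Lemma pieces_inf ps t : (exists x, in_pieces ps x) -> (forall x, in_pieces ps x -> le t x) ->
  exists m, is_inf (in_pieces ps) m.
Proof.
elim: ps => [|p ps IH]; first by case.
move=> ne le_t.
have tp x : in_piece lt p x -> le t x by move=> px; apply: le_t; left.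
have tps x : in_pieces ps x -> le t x by move=> px; apply: le_t; right.
have drop (X Y : s -> Prop) m : ~ (exists x, Y x) -> is_inf X m -> is_inf (X `|` Y) m.
  move=> nY [Xm mX]; split=> [x [/Xm//|Yx]|y /mX[x Xx xy]]; first by case: nY; exists x.
  by exists x => //; left.
case: (pselect (exists x, in_piece lt p x)) => [exp|nexp]; last first.
  have [|m inf_m] := IH _ tps; first by case: ne => x [px|]; [case: nexp|]; exists x.
  exists m; rewrite (_ : in_pieces (p :: ps) = in_pieces ps `|` in_piece lt p); first exact: drop.
  by rewrite setUC.
have [m inf_m] := piece_inf exp tp.
case: (pselect (exists x, in_pieces ps x)) => [exps|nexps]; last by exists m; apply: drop.
by have [m' inf_m'] := IH exps tps; apply: is_infU inf_m inf_m'.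
Qed.

Lemma definable_inf (X : s -> Prop) t : definable_set X -> (exists x, X x) ->
  (forall x, X x -> le t x) -> exists m, is_inf X m.
Proof.
move=> /(og_omin og)[ps Xps]; have -> : X = in_pieces ps by apply/funext => x; apply/propext.
exact: pieces_inf.
Qed.

Lemma definable_fiber (R : s -> s -> Prop) x : definable_rel R -> definable_set (fun y => R x y).
Proof. by move=> DR; rewrite /definable_set; fo. Qed.

Lemma small_bigcup (Y : s -> Prop) (R : s -> s -> Prop) :
  definable_set Y -> definable_rel R -> small Y -> (forall c, Y c -> small (R c)) ->
  small (fun y => exists c, Y c /\ R c y).
Proof.
move=> DY DR /(small_finite DY)[l Yl] sR.
suff [l' Rl'] : exists l' : seq s, forall c y, c \in l -> Y c -> R c y -> y \in l'.
  by apply: (@finite_small _ l') => y [c [Yc Rcy]]; apply: (Rl' c) => //; apply: Yl.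
elim: l {Yl} => [|c l [l' Rl']]; first by exists [::].
case: (pselect (Y c)) => [Yc|nY].
  have [l1 Hl1] := small_finite (definable_fiber c DR) (sR c Yc).
  exists (l1 ++ l') => d y; rewrite mem_cat inE => /predU1P[-> _ /Hl1->//|dl Yd Rd].
  by rewrite (Rl' d) ?orbT.
exists l' => d y; rewrite inE => /predU1P[->/nY//|dl Yd Rd].
exact: (Rl' d).
Qed.

Section NestedFamily.
Variables (R : s -> s -> Prop) (u w : s).
Hypothesis definable_R : definable_rel R.
Hypothesis nested_R : forall t t', R t `<=` R t' \/ R t' `<=` R t.
Hypothesis uw : lt u w.
Hypothesis cover_R : forall x, lt u x -> lt x w -> exists t, R t x.

Definition late_entry x : Prop :=
  [/\ lt u x, lt x w & forall y, lt u y -> lt y x -> exists t, R t x /\ ~ R t y].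

Lemma late_entry_arbitrarily_near z : (forall t, small (R t)) -> lt u z ->
  exists2 x, late_entry x & lt x z.
Proof.
move=> sR uz; have [z' [uz' z'z z'w]] := exists_gt_le2 uz uw.
have [y [uy yz']] := dense uz'.
have yz := lt_le_trans yz' z'z; have yw := lt_le_trans yz' z'w.
have [t Rty] := cover_R uy yw; have [l Rtl] := small_finite (definable_fiber t definable_R) (sR t).
pose Q x := [/\ lt u x, lt x z', lt x w & forall t, R t y -> R t x].
have [||m [um mz mw Rm] mmin] := @finite_min Q l y.
- by move=> x [_ _ _ /(_ _ Rty)/Rtl].
- by split.
exists m; last exact: lt_le_trans mz z'z.
split=> // x ux xm; apply: contrapT => /forallNP nt.
apply: (mmin x _ xm); split=> //; [exact: lt_trans mz|exact: lt_trans mw|].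
by move=> t' /Rm Rtm; apply: contrapT => nR; apply: (nt t').
Qed.

(* Otherwise the late entries accumulate at u, hence fill an interval, and the
   family cannot stay finite there. *)
Lemma nested_family_not_small : exists t, ~ small (R t).
Proof.
apply: contrapT => /forallNP sR; have {}sR t : small (R t) by apply: contrapT; apply: sR.
have late_not_small : ~ small late_entry.
  have D : definable_set late_entry by rewrite /definable_set /late_entry; fo.
  move=> /(small_finite D)[l late_l]; have [z uz lz] := gap_above l u.
  have [x late_x xz] := late_entry_arbitrarily_near sR uz.
  by apply: (lz x) => //; [apply: late_l|case: late_x].
case: late_not_small => -[a [b [ab late_ab]]].
have [x0 [ax0 x0b]] := dense ab; have [ux0 x0w _] := late_ab _ ax0 x0b.
have [t Rt] := cover_R ux0 x0w; apply: (sR t); exists x0, b; split=> // x x0x xb.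
have [_ _ /(_ x0 ux0 x0x)[t' [Rt'x nRt'x0]]] := late_ab _ (lt_trans ax0 x0x) xb.
by case: (nested_R t t') => [/(_ _ Rt)|] //; apply.
Qed.

End NestedFamily.

Section SmallFibers.
Variable R : s -> s -> Prop.
Hypothesis definable_R : definable_rel R.
Hypothesis small_R : forall x, small (R x).

Definition cofiber_contains l u y : Prop := forall x, lt l x -> lt x u -> R x y.

Lemma fo_lt_op (T : Type) (E : set (T -> s)) (c d f : T -> s) : E c -> E d -> E f ->
  first_order (s := fun=> s) true E (fun t => lt (c t) (op (d t) (f t))).
Proof.
move=> Ec Ed Ef.
apply: (@fo_iff _ _ _ _ _ _ (fun t => exists z, op_in L (d t) (f t) z /\ lt (c t) z)); last by fo.
move=> t; split=> [[z [/(og_op_in og)<-]] //|cdf].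
by exists (op (d t) (f t)); split=> //; apply/(og_op_in og).
Qed.

Local Hint Extern 1 (first_order _ _ (fun t => lt_in _ _ (op _ _))) => apply: fo_lt_op; coord : fo.

Lemma uniform_left_bound c0 c1 : lt c0 c1 ->
  (forall y, lt c0 y -> lt y c1 -> ~ small (R^~ y)) ->
  exists t d0 d1, lt d0 d1 /\ forall y, lt d0 y -> lt y d1 ->
    exists l u, [/\ lt t l, lt l u & cofiber_contains l u y].
Proof.
move=> c01 fat_c.
pose S t y := exists l u, [/\ lt t l, lt l u & cofiber_contains l u y].
have DS : definable_rel S by rewrite /definable_rel /S /cofiber_contains; fo.
have [||t /contrapT[d0 [d1 [d01 R_d]]]] := @nested_family_not_small S c0 c1 DS _ c01.
- move=> t t'; have mono v v' : le v v' -> S v' `<=` S v.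
    by move=> vv' y [l [u [vl lu R_lu]]]; exists l, u; split=> //; apply: le_lt_trans vl.
  by case: (le_total t t') => /mono; [right|left].
- move=> y c0y yc1; have /contrapT[l [u [lu R_lu]]] := fat_c _ c0y yc1.
  by have [t tl] := exists_lt l; exists t, l, u.
by exists t, d0, d1.
Qed.

Lemma uniform_length t d0 d1 : lt d0 d1 ->
  (forall y, lt d0 y -> lt y d1 -> exists l u, [/\ lt t l, lt l u & cofiber_contains l u y]) ->
  exists a h0 h1, [/\ lt e a, lt h0 h1 & forall y, lt h0 y -> lt y h1 ->
    exists2 l, lt t l & cofiber_contains l (op l a) y].
Proof.
move=> d01 R_d.
pose S a y := lt e a /\ exists l, lt t l /\ forall x, lt l x -> lt x (op l a) -> R x y.
have DS : definable_rel S by rewrite /definable_rel /S; fo.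
have [||a /contrapT[h0 [h1 [h01 R_h]]]] := @nested_family_not_small S d0 d1 DS _ d01.
- have mono v v' : le v v' -> lt e v -> S v' `<=` S v.
    move=> vv' ev y [_ [l [tl R_l]]]; split=> //; exists l; split=> // x lx xl.
    apply: R_l => //; apply: lt_le_trans xl _ => /(og_ltl og (inv l)).
    by rewrite -!(og_opA og) (og_opVl og) !(og_op1l og).
  move=> v v'; case: (pselect (lt e v)) => [ev|nv]; last by left=> x [/nv].
  case: (pselect (lt e v')) => [ev'|nv']; last by right=> x [/nv'].
  by case: (le_total v v') => /mono; [right|left]; auto.
- move=> y d0y yd1; have [l [u [tl lu R_l]]] := R_d _ d0y yd1.
  exists (op (inv l) u); split; first by have := og_ltl og (inv l) lu; rewrite (og_opVl og).
  by exists l; split=> // x lx; rewrite -(og_opA og) (og_opVr og) (og_op1l og); apply: R_l.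
have ea : lt e a by have [y [h0y yh1]] := dense h01; have [] := R_h y h0y yh1.
by exists a, h0, h1; split=> // y h0y yh1; have [_ [l [tl R_l]]] := R_h y h0y yh1; exists l.
Qed.

Section LeftmostInterval.
Variables (t a h0 h1 : s).
Hypotheses (ea : lt e a) (h01 : lt h0 h1).
Hypothesis cofiber_interval : forall y, lt h0 y -> lt y h1 ->
  exists2 l, lt t l & cofiber_contains l (op l a) y.

Definition interval_start l y : Prop := le t l /\ cofiber_contains l (op l a) y.

Definition first_start l y : Prop :=
  interval_start l y /\ forall l', interval_start l' y -> le l l'.

Lemma definable_first_start : definable_rel first_start.
Proof. by rewrite /definable_rel /first_start /interval_start /cofiber_contains; fo. Qed.

Lemma first_start_exists y : lt h0 y -> lt y h1 -> exists l, first_start l y.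
Proof.
move=> h0y yh1; have [l0 tl0 Hl0] := cofiber_interval h0y yh1.
have [||| m [m_le m_inf]] := @definable_inf (interval_start^~ y) t.
- by rewrite /definable_set /interval_start /cofiber_contains; fo.
- by exists l0; split=> //; apply: ltW.
- by move=> x [].
exists m; split=> //; split; first by move=> /m_inf[x [tx _] /tx].
move=> x /m_inf[l Sl lx] xm; apply: Sl.2 => //; apply: lt_le_trans xm _.
move=> /(og_ltr og (inv a)); rewrite !(og_opA og) (og_opVr og) !(og_op1r og).
exact: m_le.
Qed.

Lemma small_first_start y : small (first_start^~ y).
Proof.
case: (pselect (exists l, first_start l y)) => [[l [Sl fl]]|nl].
  apply: (@finite_small _ [:: l]) => l' [Sl' fl']; rewrite inE; apply/eqP.
  by case: (lt_total l' l) => [/(fl _ Sl')|[|/(fl' _ Sl)]].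
by apply: (@finite_small _ [::]) => l fl; case: nl; exists l.
Qed.

Lemma start_interval_in_fiber x l y : lt l x -> lt x (op l a) -> first_start l y -> R x y.
Proof. by move=> lx xl [[_ H] _]; apply: H. Qed.

Lemma first_starts_not_small : ~ small (fun l => exists y, (lt h0 y /\ lt y h1) /\ first_start l y).
Proof.
have D := definable_first_start.
set Z := fun l => _; have DZ : definable_set Z by rewrite /definable_set /Z; fo.
move=> sZ; have := @small_bigcup Z first_start DZ D sZ.
case=> [l _|].
  have [x [lx xl]] := dense (op_lt_self l ea); apply: subset_small (@small_R x) => y.
  exact: start_interval_in_fiber lx xl.
exists h0, h1; split=> // y h0y yh1; have [l start_l] := first_start_exists h0y yh1.
by exists l; split=> //; exists y.
Qed.

End LeftmostInterval.

Lemma small_swap : small (fun y => ~ small (R^~ y)).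
Proof.
move=> [c0 [c1 [c01 fat_c]]]; have [t [d0 [d1 [d01 R_d]]]] := uniform_left_bound c01 fat_c.
have [a [h0 [h1 [ea h01 R_h]]]] := uniform_length d01 R_d.
have /contrapT[j0 [j1 [j01 starts_j]]] := first_starts_not_small ea h01 R_h.
have [x [j0x xj1 xj0a]] := exists_gt_le2 j01 (op_lt_self j0 ea).
have Dx : definable_set (fun y => R x y) := definable_fiber x definable_R.
have DF : definable_rel (fun y l => first_start t a l y).
  have D := definable_first_start t a; rewrite /definable_rel; fo.
case: (small_bigcup Dx DF (@small_R x) (fun y _ => @small_first_start t a y)).
exists j0, x; split=> // l j0l lx; have [y [_ start_y]] := starts_j l j0l (lt_le_trans lx xj1).
exists y; split=> //; apply: start_interval_in_fiber start_y => //.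
by apply: le_lt_trans xj0a _; apply: (og_ltr og).
Qed.

End SmallFibers.

End OMinimalGroup.

Section DefinablePoints.
Local Open Scope classical_set_scope.
Variables (I : Type) (ar : I -> nat) (L : ordered_group_language ar) (s : structure ar).
Variables (op : s -> s -> s) (e : s) (inv : s -> s).
Hypothesis og : ominimal_group L op e inv.

Lemma finite_definable_point A (X : s -> Prop) (l : seq s) p : definable_set true A X ->
  (forall x, X x -> x \in l) -> X p -> definable_set true A (eq^~ p).
Proof.
elim: {l}(size l) {-2}l (leqnn (size l)) X => [|k IH] l lk X DX Xl Xp.
  by have := Xl p Xp; case: (l) lk.
have [m Xm mmin] := finite_min og Xl Xp; case: (eqVneq p m) => [pm|pm].
  suff D : definable_set true A (fun y => X y /\ forall z, X z -> ~ lt_in L z y).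
    apply: fo_iff D => y; split=> [[Xy ymin]|->]; last by rewrite pm.
    by rewrite pm; case: (og_total og y m) => [/(mmin y Xy)|[|/(ymin m Xm)]].
  by rewrite /definable_set; fo.
apply: (IH [seq x <- l | x != m] _ (fun y => X y /\ exists z, X z /\ lt_in L z y)).
- rewrite -ltnS; apply: leq_trans lk; rewrite size_filter -(count_predC (pred1 m) l).
  by rewrite -{1}[count _ l]add0n ltn_add2r -has_count has_pred1; apply: Xl.
- by rewrite /definable_set; fo.
- move=> y [Xy [z [Xz zy]]]; rewrite mem_filter Xl // andbT; apply/eqP => /= ym.
  by apply: (mmin z Xz); rewrite -ym.
- split=> //; exists m; split=> //.
  by case: (og_total og p m) => [/(mmin p Xp)//|[/eqP|//]]; rewrite (negbTE pm).
Qed.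

End DefinablePoints.

(** * Ultrapowers *)

Section Environments.
Local Open Scope classical_set_scope.
Variables (I : Type) (ar : I -> nat).

Definition var_coord (V : Type) : coordinates (fun t : {s : structure ar & V -> s} => tag t) :=
  fun c => exists x, c = fun t => tagged t x.

Lemma definable_tuples_formula (K : structure ar) b (A : seq K) n (X : n.-tuple K -> Prop) :
  definable_tuples b [set` A] X -> exists2 f, b ==> P_free f &
    forall (x : n.-tuple K) w, X x <-> holds (extend (cat_tuple x (in_tuple A)) w) f.
Proof.
move=> [f [d [bf Ed Xf]]].
have [r Hr] : {r : nat -> nat & forall k, k \in fv f -> forall (x : n.-tuple K) w,
    d k x = extend (cat_tuple x (in_tuple A)) w (r k)}.
  apply: (choice (P := fun k j => k \in fv f -> forall (x : n.-tuple K) w,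
    d k x = extend (cat_tuple x (in_tuple A)) w j)) => k.
  case: (boolP (k \in fv f)) => [/Ed[[i _ <-]|[a /= aA <-]]|_]; last by exists 0.
    by exists i => _ x w; rewrite /extend nth_cat size_tuple ltn_ord (tnth_nth (w i)).
  exists (n + index a A) => _ x w.
  by rewrite /extend nth_cat size_tuple ltnNge leq_addr /= addKn nth_index.
exists (rename r f) => [|x w]; first by rewrite P_free_rename.
by rewrite Xf holds_rename; apply: eq_holds => k /Hr/(_ x w).
Qed.

Lemma definable_tuples_extend (K : structure ar) b n (X : n.-tuple K -> Prop) :
  definable_tuples b setT X <->
  exists f w, b ==> P_free f /\ forall x, X x <-> holds (extend x w) f.
Proof.
split=> [/fo_finite_params[l _ /definable_tuples_formula[f bf Xf]]|[f [w [bf Xf]]]].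
  exists f, (fun k => nth (point K) l (k - n)); split=> // x.
  rewrite (Xf x (fun=> point K)); apply: eq_holds => k _; rewrite /extend nth_cat size_tuple.
  by case: ltnP => kn; [apply: set_nth_default; rewrite size_tuple|rewrite [RHS]nth_default ?size_tuple].
apply: fo_iff (fun x => iff_sym (Xf x)) _; apply: fo_holds => // k; rewrite /extend.
case: (ltnP k n) => kn; [left|right]; last first.
  by exists (w k) => //; apply/funext => x; rewrite nth_default ?size_tuple.
by exists (Ordinal kn) => //; apply/funext => x; rewrite (tnth_nth (w k)).
Qed.

(* A condition on n-tuples that makes sense in every structure with named
   elements v x, x : V, definable over them by one and the same formula. *)
Definition uniform (V : Type) b n (X : forall s : structure ar, (V -> s) -> n.-tuple s -> Prop) : Prop :=
  first_order b (ext (@tuple_coord _ ar _ _ n) (@var_coord V))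
    (fun u => X (tag (tag u)) (tagged (tag u)) (tagged u)).

Lemma uniformize (K : structure ar) V (v : V -> K) b n (X : n.-tuple K -> Prop) :
  definable_tuples b (range v) X -> exists2 X_, uniform (V := V) b X_ & forall x, X x <-> X_ K v x.
Proof.
move=> [f [d [bf Ed Xf]]].
pose value (s : structure ar) (w : V -> s) (x : n.-tuple s) (o : option ('I_n + V)) : s :=
  match o with Some (inl i) => tnth x i | Some (inr y) => w y | None => point s end.
have [c Hc] : {c : nat -> option ('I_n + V) & forall k, k \in fv f ->
    c k <> None /\ forall x, d k x = value K v x (c k)}.
  apply: (choice (P := fun k o => k \in fv f -> o <> None /\ forall x, d k x = value K v x o)) => k.
  case: (boolP (k \in fv f)) => [/Ed[[i _ <-]|[_ [y _ <-] <-]]|_]; last by exists None.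
    by exists (Some (inl i)).
  by exists (Some (inr y)).
exists (fun s w x => holds (fun k => value s w x (c k)) f); last first.
  by move=> x; rewrite Xf; apply: eq_holds => k /Hc[].
exists f, (fun k u => value (tag (tag u)) (tagged (tag u)) (tagged u) (c k)).
split=> // k /Hc[]; case: (c k) => [[i|y]|] //= _ _; first by coord.
have Vy : @var_coord V (fun t => tagged t y) by exists y.
exact: ext_old Vy.
Qed.

Lemma uniform_definable V b n (X : forall s : structure ar, (V -> s) -> n.-tuple s -> Prop) s v :
  uniform b X -> definable_tuples b (range v) (X s v).
Proof.
move=> UX; pose h (x : n.-tuple s) := Tagged (fun t : {s : structure ar & V -> s} => n.-tuple (tag t))
  (x : n.-tuple (tag (Tagged (fun s : structure ar => V -> s) v))).
apply: (fo_comp (h := h) UX) => _ [_ [y ->]|_ [i ->]]; last by left; exists i.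
by right; exists (v y) => //; exists y.
Qed.

Lemma fo_uniform (T : Type) (s : T -> structure ar) (E : coordinates s) b b' V n
    (X : forall s : structure ar, (V -> s) -> n.-tuple s -> Prop)
    (v : forall t, V -> s t) (x : forall t, n.-tuple (s t)) : uniform b' X -> b ==> b' ->
  (forall y, E (fun t => v t y)) -> term E x -> first_order b E (fun t => X (s t) (v t) (x t)).
Proof.
move=> UX bb' Ev Ex; pose h t := Tagged (fun t : {s : structure ar & V -> s} => n.-tuple (tag t))
  (x t : n.-tuple (tag (Tagged (fun s : structure ar => V -> s) (v t)))).
apply: (fo_flag bb'); apply: (fo_comp (h := h) UX) => _ [_ [y ->]|_ [i ->]]; [exact: Ev|exact: Ex].
Qed.

End Environments.

Ltac fo_named := lazymatch goal with
  | U : uniform _ ?X |- first_order _ _ (fun t => ?X _ _ _) =>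
      apply: (fo_uniform U); [by rewrite ?implybb|move=> ?; coord|fo_term]
  end.

#[global] Hint Extern 1 (first_order _ _ _) => fo_named : fo.

Section FormulaCode.
Variables (I : countType) (ar : I -> nat).

Fixpoint formula_code (f : formula (ar_P ar)) : nat :=
  CodeSeq.code (match f with
  | FRel o vs => [:: 0, pickle o & vs]
  | FEq a b => [:: 1; a; b]
  | FNot g => [:: 2; formula_code g]
  | FAnd g h => [:: 3; formula_code g; formula_code h]
  | FEx x g => [:: 4; x; formula_code g]
  end).

Lemma formula_code_inj : injective formula_code.
Proof.
have code_inj := can_inj CodeSeq.codeK.
elim=> [o vs|a b|f IH|f IHf g IHg|x f IH] [o' vs'|a' b'|f'|f' g'|x' f'];
  rewrite /formula_code -/formula_code => /code_inj //.
- case=> /(pcan_inj pickleK) oo'; case: o' / oo' vs' => vs' E.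
  by congr FRel; apply: val_inj.
- by case=> -> ->.
- by case=> /IH->.
- by case=> /IHf-> /IHg->.
- by case=> -> /IH->.
Qed.

End FormulaCode.

Section Ultrapower.
Local Open Scope classical_set_scope.
Variables (I : Type) (ar : I -> nat).
Variables (M : structure ar) (U : set_system nat).
Context {UF : UltraFilter U}.

Definition ae_equal (f g : {classic nat -> M}) : bool := `[< U [set j | f j = g j] >].

Lemma ae_equal_refl : reflexive ae_equal.
Proof. by move=> f; apply/asboolP; apply: filterS filterT. Qed.

Lemma ae_equal_sym : symmetric ae_equal.
Proof. by move=> f g; apply/asboolP/asboolP; apply: filterS => j /= ->. Qed.

Lemma ae_equal_trans : transitive ae_equal.
Proof.
move=> g f h /asboolP fg /asboolP gh; apply/asboolP.
by apply: filterS (filterI fg gh) => j [/= -> ->].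
Qed.

Definition ae_equiv : equiv_rel {classic nat -> M} :=
  EquivRel ae_equal ae_equal_refl ae_equal_sym ae_equal_trans.

Definition ultra_carrier : Type := {eq_quot ae_equiv}%qT.
HB.instance Definition _ := Equality.on ultra_carrier.

Definition ultra_class (f : nat -> M) : ultra_carrier := (\pi_({eq_quot ae_equiv}) f)%qT.
Definition ultra_repr (a : ultra_carrier) : nat -> M := repr (a : {eq_quot ae_equiv}%qT).

Lemma ultra_reprK a : ultra_class (ultra_repr a) = a.
Proof. exact: reprK. Qed.

Lemma ultra_class_eq f g : ultra_class f = ultra_class g <-> U [set j | f j = g j].
Proof.
split=> [/eqquotP/asboolP//|fg]; apply/eqquotP; exact/asboolP.
Qed.

Lemma ultra_classK f : U [set j | ultra_repr (ultra_class f) j = f j].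
Proof. by apply/ultra_class_eq; rewrite ultra_reprK. Qed.

Definition ultrapower : structure ar :=
  @Structure _ ar ultra_carrier (ultra_class (fun=> point M))
    (fun o t => U [set j | interp (map_tuple (fun a : ultra_carrier => ultra_repr a j) t)]).

Lemma ultraC (A : set nat) : U (~` A) <-> ~ U A.
Proof.
split=> [nA UA|nA]; last by case: (in_ultra_setVsetC A UF).
by apply: (filter_not_empty U); rewrite -(setICr A); apply: filterI.
Qed.

Lemma Los_atom o (vs : (ar_P ar o).-tuple nat) (g : nat -> nat -> M) :
  @interp _ _ ultrapower o (map_tuple (fun k => ultra_class (g k)) vs) <->
  U [set j | interp (map_tuple (fun k => g k j) vs)].
Proof.
have repr_j : U [set j | forall k, k \in (vs : seq nat) -> ultra_repr (ultra_class (g k)) j = g k j].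
  elim: (vs : seq nat) => [|k l IH]; first by apply: filterS filterT.
  apply: filterS (filterI (ultra_classK (g k)) IH) => j [/= gj lj] k'.
  by rewrite inE => /predU1P[->|/lj].
have E j : (forall k, k \in (vs : seq nat) -> ultra_repr (ultra_class (g k)) j = g k j) ->
    map_tuple (fun a : ultra_carrier => ultra_repr a j) (map_tuple (fun k => ultra_class (g k)) vs) =
    map_tuple (fun k => g k j) vs.
  by move=> Ej; apply: val_inj; rewrite /= -map_comp; apply/eq_in_map => k /Ej.
by split=> /(filterI repr_j); apply: filterS => j [/= /E vs_j]; rewrite vs_j.
Qed.

Lemma Los_formula (f : formula (ar_P ar)) (g : nat -> nat -> M) :
  @holds _ _ ultrapower (fun k => ultra_class (g k)) f <-> U [set j | holds (fun k => g k j) f].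
Proof.
rewrite /holds; elim: f g => [o vs|a b|f IH|f IHf h IHh|x f IH] g /=.
- exact: Los_atom.
- exact: ultra_class_eq.
- have := IH g; have := ultraC [set j | sat (@interp _ _ M) (fun k => g k j) f].
  by rewrite /setC /=; tauto.
- split=> [[/IHf Uf /IHh Uh]|H]; first exact: filterS (filterI Uf Uh).
  by split; [apply/IHf|apply/IHh]; apply: filterS H => j [].
- have update_class (h : nat -> M) : (fun k => if k == x then ultra_class h else ultra_class (g k)) =
      (fun k => ultra_class (if k == x then h else g k)).
    by apply/funext => k; case: eqP.
  have update_at (h : nat -> M) j : (fun k => (if k == x then h else g k) j) =
      (fun k => if k == x then h j else g k j).
    by apply/funext => k; case: eqP.
  split=> [[a]|H].
    rewrite -(ultra_reprK a) update_class => /IH; apply: filterS => j /=.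
    by rewrite update_at; exists (ultra_repr a j).
  have /choice[h Hh] j : exists a,
      (exists a, sat (@interp _ _ M) (fun k => if k == x then a else g k j) f) ->
      sat (@interp _ _ M) (fun k => if k == x then a else g k j) f.
    by case: (pselect (exists a, sat (@interp _ _ M) (fun k => if k == x then a else g k j) f));
      [move=> [a Ha]; exists a|move=> nH; exists (point M)].
  exists (ultra_class h); rewrite update_class; apply/IH; apply: filterS H => j /= /Hh.
  by rewrite update_at.
Qed.

Theorem Los (V : Type) b (X : forall s : structure ar, (V -> s) -> Prop) (g : V -> nat -> M) :
  first_order b (@var_coord _ ar V) (fun t => X (tag t) (tagged t)) ->
  X ultrapower (fun x => ultra_class (g x)) <-> U [set j | X M (fun x => g x j)].
Proof.
move=> [f [e [_ Ef Xf]]].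
have [h Hh] : {h : nat -> nat -> M & forall k, k \in fv f -> exists2 x, h k = g x &
    e k = fun t => tagged t x}.
  apply: (choice (P := fun k h => k \in fv f -> exists2 x, h = g x & e k = fun t => tagged t x)) => k.
  by case: (boolP (k \in fv f)) => [/Ef[x ->]|]; [exists (g x); exists x|exists (fun=> point M)].
have XE (s : structure ar) (v : V -> s) :
    X s v <-> holds (fun k => e k (Tagged (fun s : structure ar => V -> s) v)) f.
  exact: (Xf (Tagged (fun s : structure ar => V -> s) v)).
have -> : [set j | X M (fun x => g x j)] = [set j | holds (fun k => h k j) f].
  apply/funext => j; apply/propext; rewrite /= XE; apply: eq_holds => k /Hh[x -> ->] //.
rewrite XE -Los_formula; apply: eq_holds => k /Hh[x -> ->] //.
Qed.

Lemma transfer (V : Type) b (X : forall s : structure ar, (V -> s) -> Prop) :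
  first_order b (@var_coord _ ar V) (fun t => X (tag t) (tagged t)) ->
  (forall v, X M v) -> forall v, X ultrapower v.
Proof.
move=> FX XM v; have -> : v = (fun x => ultra_class (ultra_repr (v x))).
  by apply/funext => x; rewrite ultra_reprK.
by apply/(Los _ FX); apply: filterS filterT => j _; apply: XM.
Qed.

Definition internal n (Y : nat -> n.-tuple M -> Prop) (x : n.-tuple ultrapower) : Prop :=
  U [set j | Y j (map_tuple (fun a : ultra_carrier => ultra_repr a j) x)].

Hypothesis cofinite_U : eventually `<=` U.

(* The point is chosen on the diagonal: at the index j it agrees with the last
   x_k, k <= j, that satisfies the first k + 1 conditions at j. *)
Lemma internal_finite_intersection n (Y : nat -> nat -> n.-tuple M -> Prop) :
  (forall k, exists x, forall i, i <= k -> internal (Y i) x) -> exists x, forall k, internal (Y k) x.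
Proof.
move=> /choice[x xY]; pose at_ j (y : n.-tuple ultrapower) : n.-tuple M :=
  map_tuple (fun a : ultra_carrier => ultra_repr a j) y.
pose good k j := forall i, i <= k -> Y i j (at_ j (x k)).
have U_good k : U [set j | good k j].
  have : U [set j | forall i : 'I_k.+1, Y i j (at_ j (x k))].
    by apply: filter_forall => i; apply: (xY k i); rewrite -ltnS ltn_ord.
  by apply: filterS => j Hj i; rewrite -ltnS => ik; apply: (Hj (Ordinal ik)).
have last_ex j : exists k, (k <= j) && ((k == 0) || `[< good k j >]) by exists 0.
have last_le j k : (k <= j) && ((k == 0) || `[< good k j >]) -> k <= j by case/andP.
pose last j := ex_maxn (last_ex j) (last_le j).
have last_good k j : k <= j -> good k j -> k <= last j /\ good (last j) j.
  move=> kj gk; rewrite /last; case: ex_maxnP => l /andP[_ /orP gl] lmax.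
  have kl : k <= l by apply: lmax; rewrite kj; apply/orP; right; apply/asboolP.
  by split=> //; case: gl => [/eqP l0|/asboolP//]; move: kl; rewrite l0 leqn0 => /eqP <-.
pose d := [tuple ultra_class (fun j => ultra_repr (tnth (x (last j)) i) j) | i < n].
exists d => k; rewrite /internal.
have Ud : U [set j | forall i : 'I_n, ultra_repr (tnth d i) j = ultra_repr (tnth (x (last j)) i) j].
  apply: filter_forall => i; rewrite tnth_mktuple.
  exact: (ultra_classK (fun j => ultra_repr (tnth (x (last j)) i) j)).
have Uk : U [set j | k <= j] by apply: cofinite_U; exists k.
apply: filterS (filterI Uk (filterI (U_good k) Ud)) => j [/= kj [gk dj]].
have [kl gl] := last_good k j kj gk.
have -> : map_tuple (fun a : ultra_carrier => ultra_repr a j) d = at_ j (x (last j)).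
  by apply: eq_from_tnth => i; rewrite [LHS]tnth_map [RHS]tnth_map dj.
exact: gl.
Qed.

End Ultrapower.

Arguments ultra_carrier {I ar} M U {UF}.
Arguments ultra_class {I ar M} U {UF}.
Arguments ultra_repr {I ar M U UF}.
Arguments ultrapower {I ar} M U {UF}.
Arguments internal {I ar M U UF n}.

Section Saturation.
Local Open Scope classical_set_scope.
Variables (I : Type) (ar : I -> nat).

Definition saturated (K : structure ar) : Prop :=
  forall n (A : seq K) (CC : set (set (n.-tuple K))), CC !=set0 ->
  (forall C, CC C -> definable_tuples false [set` A] C /\ C !=set0) ->
  (forall C C', CC C -> CC C' -> exists2 C'', CC C'' & C'' `<=` C `&` C') ->
  exists x, forall C, CC C -> C x.

Lemma saturated_avoid (K : structure ar) n (A : seq K) (CC D : set (set (n.-tuple K))) :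
  saturated K -> CC !=set0 -> (forall C, CC C -> definable_tuples false [set` A] C) ->
  (forall C C', CC C -> CC C' -> exists2 C'', CC C'' & C'' `<=` C `&` C') ->
  D !=set0 -> (forall Y, D Y -> definable_tuples false [set` A] Y) ->
  (forall Y Y', D Y -> D Y' -> D (Y `|` Y')) ->
  (forall C Y, CC C -> D Y -> C `\` Y !=set0) ->
  exists x, (forall C, CC C -> C x) /\ forall Y, D Y -> ~ Y x.
Proof.
move=> satK [C0 CC0] CD dirCC [Y0 DY0] DD DU diff.
have [|_ [C CCC [Y DY <-]]|_ _ [C CCC [Y DY <-]] [C' CCC' [Y' DY' <-]]|x xCY] :=
  satK n A [set C `\` Y | C in CC & Y in D].
- by exists (C0 `\` Y0), C0 => //; exists Y0.
- split; last exact: diff.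
  by apply: fo_and; [exact: CD|apply: fo_not; apply: DD].
- have [C'' CCC'' sub] := dirCC _ _ CCC CCC'; exists (C'' `\` (Y `|` Y')).
    by exists C'' => //; exists (Y `|` Y') => //; apply: DU.
  by move=> x [/sub[Cx C'x] nYY']; split; split=> // ?; apply: nYY'; [left|right].
have in_diff C Y : CC C -> D Y -> (C `\` Y) x by move=> CCC DY; apply: xCY; exists C => //; exists Y.
by exists x; split=> [C CCC|Y DY]; [case: (in_diff C Y0)|case: (in_diff C0 Y)].
Qed.

End Saturation.

Section UltrapowerSaturation.
Local Open Scope classical_set_scope.
Variables (I : countType) (ar : I -> nat) (M : structure ar) (U : set_system nat).
Context {UF : UltraFilter U}.
Hypothesis cofinite_U : eventually `<=` U.
Local Notation K := (ultrapower M U).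

Lemma definable_internal n (A : seq K) f (x : n.-tuple K) : holds (nth (point K) (x ++ A)) f <->
  internal (fun j (y : n.-tuple M) => holds (nth (ultra_repr (point K : ultra_carrier M U) j)
    (y ++ map (fun a : ultra_carrier M U => ultra_repr a j) A)) f) x.
Proof.
have -> : nth (point K) (x ++ A) =
    (fun k => ultra_class U (ultra_repr (nth (point K) (x ++ A) k : ultra_carrier M U))).
  by apply/funext => k; rewrite ultra_reprK.
rewrite Los_formula /internal; set S := [set j | _]; set S' := [set j | _].
suff -> : S = S' by [].
apply/funext => j; apply/propext; rewrite /S /S' /= -map_cat; apply: eq_holds => k _.
case: (ltnP k (size (x ++ A))) => kxA; first by rewrite (nth_map (point K)).
by rewrite !nth_default ?size_map.
Qed.

Lemma ultrapower_saturated : saturated K.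
Proof.
move=> n A CC [C0 CC0] CCD dirCC.
pose defines f (C : set (n.-tuple K)) := forall x, C x <-> holds (nth (point K) (x ++ A)) f.
have /choice[D DCC] k : exists D : set (n.-tuple K), CC D /\
    forall C f, CC C -> formula_code f = k -> defines f C -> C = D.
  case: (pselect (exists C f, [/\ CC C, formula_code f = k & defines f C])) => [[C [f [CCC fk fC]]]|nC].
    exists C; split=> // C' f' _ f'k f'C'; have ff' : f' = f by apply: formula_code_inj; rewrite fk.
    by apply/funext => x; apply/propext; rewrite fC f'C' ff'.
  by exists C0; split=> // C f CCC fk fC; case: nC; exists C, f.
have /choice[f fD] k : exists f, defines f (D k).
  have [/CCD[/definable_tuples_formula[f _ fD] _] _] := DCC k.
  by exists f => x; apply: (fD x (fun=> point K)).
have [k|x xD] := internal_finite_intersection cofinite_U (n := n)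
  (Y := fun k j y => holds (nth (ultra_repr (point K : ultra_carrier M U) j)
    (y ++ map (fun a : ultra_carrier M U => ultra_repr a j) A)) (f k)).
  suff [E [/CCD[_ [x Ex]] ED]] : exists E, CC E /\ forall i, i <= k -> E `<=` D i.
    by exists x => i ik; apply/definable_internal/fD; apply: (ED i ik).
  elim: k => [|k [E [CCE ED]]].
    by exists (D 0); split=> [|i]; [have [] := DCC 0|rewrite leqn0 => /eqP->].
  have [E' CCE' E'sub] := dirCC E (D k.+1) CCE (DCC k.+1).1.
  exists E'; split=> // i; rewrite leq_eqVlt => /predU1P[->|/ED ED_] y /E'sub[Ey Dy] //.
  exact: ED_.
exists x => C CCC; have [/definable_tuples_formula[g _ gC0] _] := CCD C CCC.
have gC : defines g C by move=> y; apply: (gC0 y (fun=> point K)).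
by rewrite ((DCC (formula_code g)).2 C g CCC erefl gC); apply/fD/definable_internal/xD.
Qed.

End UltrapowerSaturation.

(** * Pregeometries *)

Lemma set_mem_cat (T : eqType) (s t : seq T) :
  ([set` s ++ t] = [set` s] `|` [set` t])%classic.
Proof. by apply/seteqP; split=> x; rewrite /= mem_cat => /orP. Qed.

Lemma set_mem_cons (T : eqType) x (s : seq T) : ([set` x :: s] = [set x] `|` [set` s])%classic.
Proof. by rewrite -cat1s set_mem_cat; congr (_ `|` _)%classic; apply/seteqP; split=> y;
  rewrite /= inE => /eqP. Qed.

Lemma setU_mem_cons (T : eqType) (B : set T) x (s : seq T) :
  (B `|` [set` x :: s] = B `|` [set x] `|` [set` s])%classic.
Proof. by rewrite set_mem_cons setUA. Qed.

Section PregeometryTheory.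
Local Open Scope classical_set_scope.
Variable T : eqType.

Record pregeometry (cl : set T -> set T) : Prop := Pregeometry {
  pg_mono : forall A B, A `<=` B -> cl A `<=` cl B;
  pg_self : forall A, A `<=` cl A;
  pg_finitary : forall A x, cl A x ->
    exists l : seq T, (forall y, y \in l -> A y) /\ cl [set` l] x;
  pg_trans : forall A B, A `<=` cl B -> cl A `<=` cl B;
  pg_exchange : forall A a b,
    cl (A `|` [set a]) b -> ~ cl A b -> cl (A `|` [set b]) a }.

Variables (cl : set T -> set T) (pg : pregeometry cl).
Local Notation cl_mono := (pg_mono pg).
Local Notation cl_self := (pg_self pg).
Local Notation cl_finitary := (pg_finitary pg).
Local Notation cl_trans := (pg_trans pg).
Local Notation cl_exchange := (pg_exchange pg).

Fixpoint rk (B : set T) (s : seq T) : nat :=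
  if s is x :: s' then ~~ `[< cl B x >] + rk (B `|` [set x]) s' else 0.

Lemma cl_rk B x : cl B x <-> rk B [:: x] < 1.
Proof. by rewrite /= addn0; case: asboolP. Qed.

Lemma cl_finite_part B Q x : cl (B `|` Q) x ->
  exists t : seq T, (forall y, y \in t -> Q y) /\ cl (B `|` [set` t]) x.
Proof.
move=> /cl_finitary[l [lBQ clx]].
suff [t [tQ lBt]] : exists t : seq T, (forall y, y \in t -> Q y) /\
    forall y, y \in l -> B y \/ y \in t.
  by exists t; split=> //; apply: cl_mono clx => y /lBt.
elim: l lBQ {clx} => [|y l IH] lBQ; first by exists [::].
have [t [tQ lBt]] := IH (fun z zl => lBQ z (mem_behead (s := y :: l) zl)).
case: (lBQ y (mem_head _ _)) => [By|Qy].
  by exists t; split=> // z; rewrite inE => /orP[/eqP->|/lBt]; [left|].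
exists (y :: t); split=> [z|z]; rewrite inE => /orP[/eqP->//|].
- exact: tQ.
- by right; rewrite mem_head.
- by move=> /lBt[|zt]; [left|right; rewrite inE zt orbT].
Qed.

Lemma rk_le_cl B B' s : B `<=` cl B' -> rk B' s <= rk B s.
Proof.
elim: s B B' => //= x s IH B B' BB'; apply: leq_add.
  case: asboolP => // ncx; case: asboolP => //= cx; case: ncx.
  exact: cl_trans BB' _ cx.
apply: IH => y [/BB'|->]; first by apply: cl_mono => z; left.
by apply: cl_self; right.
Qed.

Lemma rk_subset B B' s : B `<=` B' -> rk B' s <= rk B s.
Proof. by move=> BB'; apply: rk_le_cl => x /BB'; apply: cl_self. Qed.

Lemma rk_cat B s t : rk B (s ++ t) = rk B s + rk (B `|` [set` s]) t.
Proof.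
elim: s B => [|x s IH] B /=.
  by rewrite add0n; congr rk; apply/seteqP; split=> y; [left|case].
rewrite IH addnA; congr (_ + rk _ _); apply/seteqP; split=> y /=; rewrite inE.
  by move=> [[]|]; [left|move=> ->; right; rewrite eqxx|move=> ->; right; rewrite orbT].
by move=> [|/orP[/eqP->|]]; [left; left|left; right|right].
Qed.

Lemma rk_swap B x y s : rk B (x :: y :: s) = rk B (y :: x :: s).
Proof.
have rk_swap_le x' y' : rk B (x' :: y' :: s) <= rk B (y' :: x' :: s).
  rewrite /= !addnA; apply: leq_add; last first.
    by apply: rk_subset => z [[]|]; [left; left|right|left; right].
  case: (asboolP (cl B x')) => cx; case: (asboolP (cl B y')) => cy;
  case: (asboolP (cl (B `|` [set x']) y')) => cxy; case: (asboolP (cl (B `|` [set y']) x')) => cyx //=.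
  - by case: cxy; apply: cl_mono cy => z; left.
  - by case: cx; apply: cl_trans cyx => z [|->//]; apply: cl_self.
  - by case: cxy; apply: cl_mono cy => z; left.
  - by case: cxy; apply: cl_mono cy => z; left.
  - by case: cxy; apply: cl_exchange cyx cx.
by apply/eqP; rewrite eqn_leq !rk_swap_le.
Qed.

Lemma rk_perm B s t : perm_eq s t -> rk B s = rk B t.
Proof.
have front x (s1 s2 : seq T) C : rk C (s1 ++ x :: s2) = rk C (x :: s1 ++ s2).
  elim: s1 C => //= y s1 IH C; rewrite IH; exact: (rk_swap C y x).
elim: s t B => [|x s IH] t B st; first by move: st; rewrite perm_sym => /perm_nilP->.
have xt : x \in t by rewrite -(perm_mem st) mem_head.
case/splitPr: xt st => t1 t2 st; rewrite front /=; congr (_ + _); apply: IH.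
by rewrite -(perm_cons x); apply: perm_trans st _; rewrite perm_catC /= perm_cons perm_catC.
Qed.

Lemma rk_eq0 B s : (forall x, x \in s -> cl B x) -> rk B s = 0.
Proof.
elim: s B => //= x s IH B sB; have cx := sB x (mem_head _ _).
rewrite asboolT // IH // => y ys; apply: (@cl_mono B) => [z|]; first by left.
by apply: sB; rewrite inE ys orbT.
Qed.

Lemma rk_le_span B s t : (forall x, x \in t -> cl (B `|` [set` s]) x) -> rk B t <= rk B s.
Proof.
move=> ts; have -> : rk B s = rk B (t ++ s).
  by rewrite (rk_perm B (permEl (perm_catC t s))) rk_cat (rk_eq0 ts) addn0.
by rewrite rk_cat leq_addr.
Qed.

Lemma rk_exchange B s t : rk B s + rk (B `|` [set` s]) t = rk B t + rk (B `|` [set` t]) s.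
Proof. by rewrite -!rk_cat; apply: rk_perm; rewrite (permEl (perm_catC s t)). Qed.

Lemma rk_le_size B s : rk B s <= size s.
Proof. by elim: s B => //= x s IH B; rewrite -add1n leq_add // leq_b1. Qed.

Lemma rk_finite_part B Q s d : rk (B `|` Q) s < d ->
  exists t : seq T, (forall y, y \in t -> Q y) /\ rk (B `|` [set` t]) s < d.
Proof.
have UAC (A C D : set T) : A `|` C `|` D = A `|` D `|` C.
  by rewrite -!setUA (setUC C).
elim: s B d => [|x s IH] B d /=; first by exists [::]; split.
case: asboolP => [cx|ncx] /=; rewrite ?add0n ?add1n UAC.
  move=> /IH[ts [tsQ rts]]; have [tx [txQ ctx]] := cl_finite_part cx.
  exists (tx ++ ts); split=> [y|].
    by rewrite mem_cat => /orP[/txQ|/tsQ].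
  rewrite asboolT /= ?add0n; last first.
    by apply: cl_mono ctx => y [|yt]; [left|right; rewrite /= mem_cat yt].
  apply: leq_ltn_trans rts; apply: rk_subset => y [[|->]|yt]; [by left; left|by right|].
  by left; right; rewrite /= mem_cat yt orbT.
case: d => // d; rewrite ltnS => /IH[t [tQ rt]]; exists t; split=> //.
rewrite UAC; apply: (@leq_ltn_trans (1 + rk (B `|` [set x] `|` [set` t]) s)).
  by rewrite leq_add // leq_b1.
by rewrite add1n ltnS.
Qed.

Variable P : set T.

Definition supp (B : set T) : set T := [set p | P p /\ cl (B `|` (P `\ p)) p].

Lemma supp_subset B B' : B `<=` B' -> supp B `<=` supp B'.
Proof. by move=> BB' p [Pp cp]; split=> //; apply: cl_mono cp => y [/BB'|]; [left|right]. Qed.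

Lemma supp_cl B C : C `<=` cl B -> supp C `<=` supp B.
Proof.
move=> CB p [Pp cp]; split=> //; apply: cl_trans cp => y [/CB|].
  by apply: cl_mono => z; left.
by move=> ?; apply: cl_self; right.
Qed.

Lemma supp_addP B t : t `<=` P -> supp (B `|` t) `<=` supp B `|` t.
Proof.
move=> tP p [Pp cp]; case: (pselect (t p)) => tp; [by right|left; split=> //].
apply: cl_mono cp => y [[|ty]|]; [by left| |by right].
by right; split; [apply: tP|move=> /= yp; rewrite yp in ty].
Qed.

Lemma supp_add_outside B x : ~ cl (B `|` P) x -> supp (B `|` [set x]) `<=` supp B.
Proof.
move=> nx p [Pp cp]; split=> //; apply: contrapT => ncp; apply: nx.
have cp' : cl (B `|` (P `\ p) `|` [set x]) p.
  by apply: cl_mono cp => y [[|]|]; [left; left|right|left; right].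
apply: cl_mono (cl_exchange cp' ncp) => y [[|[]]|->]; [by left|by right|by right].
Qed.

Lemma supp_idem B : supp (B `|` supp B) `<=` supp B.
Proof. by move=> p /supp_addP[q []|//|]. Qed.

Lemma cl_supp B z : cl (B `|` P) z -> cl (B `|` supp (B `|` [set z])) z.
Proof.
move=> /cl_finite_part[t [tP ct]].
elim: {t}(size t) {-2}t (leqnn (size t)) tP ct => [|k IH] t tk tP ct.
  by apply: cl_mono ct => y [|]; [left|case: t tk {tP} => //].
case: (pselect (exists2 p, p \in t & cl (B `|` [set` [seq u <- t | u != p]]) z)) => [[p pt cz]|np].
  apply: (IH ([seq u <- t | u != p])) => //; last by move=> y; rewrite mem_filter => /andP[_ /tP].
  rewrite -ltnS; apply: leq_trans tk; rewrite size_filter -(count_predC (pred1 p) t).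
  by rewrite -{1}[count _ t]add0n ltn_add2r -has_count has_pred1.
apply: (cl_mono _ ct) => y [|yt]; first by left.
right; split; first exact: tP.
have nz : ~ cl (B `|` [set` [seq u <- t | u != y]]) z by move=> cz; apply: np; exists y.
have cz : cl (B `|` [set` [seq u <- t | u != y]] `|` [set y]) z.
  apply: cl_mono ct => u [|ut]; first by left; left.
  case: (eqVneq u y) => [->|uy]; [by right|left; right].
  by rewrite /= mem_filter /= uy.
apply: cl_mono (cl_exchange cz nz) => u [[|]|->]; [by left; left| |by left; right].
by rewrite /= mem_filter => /andP[/= uy /tP Pu]; right; split=> //=; apply/eqP.
Qed.

Lemma supp_finite B (s : seq T) : exists2 t : seq T, (forall p, p \in t -> P p) &
  supp (B `|` [set` s]) `<=` supp B `|` [set` t].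
Proof.
elim: s B => [|x s IH] B; first by exists [::] => // p /(@supp_subset _ B)-[y []|Pp cp] //; left.
have [t tP supp_t] := IH (B `|` [set x]); rewrite setU_mem_cons.
case: (pselect (cl (B `|` P) x)) => [/cl_finite_part[t' [t'P ct']]|nx]; last first.
  by exists t => // p /supp_t[/(supp_add_outside nx)|]; [left|right].
exists (t' ++ t) => [p|p /supp_t[sp|]]; first by rewrite mem_cat => /orP[/t'P|/tP].
  have : supp (B `|` [set` t']) p.
    apply: supp_cl sp => y [By|->//]; apply: cl_self; by left.
  by case/(supp_addP t'P) => [|pt]; [left|right; rewrite /= mem_cat pt].
by right; rewrite /= mem_cat orbC (_ : p \in t).
Qed.

Lemma supp_sub_of_rk B s : rk B s <= rk (B `|` P) s -> supp (B `|` [set` s]) `<=` supp B.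
Proof.
elim: s B => [|x s IH] B.
  by move=> _; apply: supp_subset => y [].
rewrite setU_mem_cons /=; have -> : B `|` P `|` [set x] = B `|` [set x] `|` P by rewrite -!setUA (setUC P).
have rk_addP_le : rk (B `|` [set x] `|` P) s <= rk (B `|` [set x]) s by apply: rk_subset => y; left.
case: asboolP => [cx|ncx] /=; last first.
  case: asboolP => [cxP|ncxP] /=.
    by rewrite add0n add1n => /leq_trans-/(_ _ rk_addP_le); rewrite ltnn.
  rewrite !add1n ltnS => /IH/subset_trans; apply; exact: (supp_add_outside ncxP).
rewrite add0n asboolT /= ?add0n; last by apply: cl_mono cx => y; left.
move=> /IH/subset_trans; apply; apply: supp_cl => y [|->//]; exact: cl_self.
Qed.

Lemma rk_addP B s : supp (B `|` [set` s]) `<=` B -> rk (B `|` P) s = rk B s.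
Proof.
elim: s B => //= x s IH B suppB; rewrite setU_mem_cons in suppB.
have -> : B `|` P `|` [set x] = B `|` [set x] `|` P by rewrite -!setUA (setUC P).
rewrite IH; last by move=> p /suppB; left.
congr (~~ _ + _); apply: asbool_equiv_eq; split; last by apply: cl_mono => y; left.
move=> /cl_supp; apply: cl_mono => y [//|sy]; apply: suppB; apply: supp_subset sy.
by move=> z; left.
Qed.

Lemma supp_add_independent B X y : rk (B `|` P) y <= rk (B `|` X `|` P) y ->
  supp (B `|` X `|` [set` y]) `<=` supp (B `|` X) `|` supp (B `|` [set` y]).
Proof.
elim: y B => [|z y IH] B.
  by move=> _ p sp; left; apply: supp_subset sp => w [].
have BXz : B `|` X `|` [set z] = B `|` [set z] `|` X by rewrite -!setUA (setUC X).
rewrite /= !setU_mem_cons BXz.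
have -> : B `|` X `|` P `|` [set z] = B `|` [set z] `|` X `|` P.
  by rewrite -BXz -!setUA (setUC P).
have -> : B `|` P `|` [set z] = B `|` [set z] `|` P by rewrite -!setUA (setUC P).
move=> BX; have rkX_le : rk (B `|` [set z] `|` X `|` P) y <= rk (B `|` [set z] `|` P) y.
  by apply: rk_subset => w [|]; [left; left|right].
have clX_le : nat_of_bool (~~ `[< cl (B `|` X `|` P) z >]) <= nat_of_bool (~~ `[< cl (B `|` P) z >]).
  case: asboolP => [|ncz] //=; case: asboolP => //= cz; case: ncz; apply: cl_mono cz.
  by move=> w [|]; [left; left|right].
have y_indep : rk (B `|` [set z] `|` P) y <= rk (B `|` [set z] `|` X `|` P) y.
  rewrite -(leq_add2l (~~ `[< cl (B `|` P) z >])); apply: (leq_trans BX).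
  by rewrite leq_add2r.
move=> p /(IH _ y_indep)[sp|]; last by right.
rewrite -BXz in sp.
case: (pselect (cl (B `|` X `|` P) z)) => cz; last by left; apply: supp_add_outside cz _ sp.
have {}cz : cl (B `|` P) z.
  by move: BX; rewrite (asboolT cz); case: (asboolP (cl (B `|` P) z)) => //= _;
    rewrite add0n add1n => /leq_trans-/(_ _ rkX_le); rewrite ltnn.
have : supp (B `|` X `|` supp (B `|` [set z])) p.
  apply: supp_cl sp => w [wBX|->]; first by apply: cl_self; left.
  by apply: cl_mono (cl_supp cz) => u [|]; [left; left|right].
case/supp_addP => [q []//|sp'|sp']; [by left|right].
by apply: supp_subset sp' => u; left.
Qed.

End PregeometryTheory.

(** * Tame structures *)

Section Tame.
Local Open Scope classical_set_scope.
Variables (I : Type) (ar : I -> nat) (L : ordered_group_language ar) (K : structure ar).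
Local Notation lt := (@lt_in _ ar L K).
Local Notation small := (@small _ ar L K).
Local Notation in_P := (@in_P _ ar K).
Local Notation op_in := (@op_in _ ar L K).

Record pretame : Prop := Pretame {
  tame_irr : forall x, ~ lt x x;
  tame_trans : forall x y z, lt x y -> lt y z -> lt x z;
  tame_dense : forall x y, lt x y -> exists p, [/\ in_P p, lt x p & lt p y];
  tame_nontrivial : exists x y, lt x y;
  tame_translate : forall c x y, lt x y -> exists x' y', lt x' y' /\
    forall z, lt x' z -> lt z y' -> exists w, [/\ op_in c z w, lt x w & lt w y];
  tame_op_unique : forall x y z z', op_in x y z -> op_in x y z' -> z = z';
  tame_op_injr : forall x y y' z, op_in x y z -> op_in x y' z -> y = y';
  tame_op_injl : forall x x' y z, op_in x y z -> op_in x' y z -> x = x';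
  tame_bigcup : forall (Y : K -> Prop) (R : K -> K -> Prop),
    definable_set true setT Y -> definable_rel true setT R ->
    small Y -> (forall c, Y c -> small (R c)) -> small (fun y => exists c, Y c /\ R c y);
  tame_swap : forall R : K -> K -> Prop, definable_rel true setT R ->
    (forall x, small (R x)) -> small (fun y => ~ small (R^~ y));
  tame_indep : forall (A X : set K) p, A `<=` in_P -> in_P p -> ~ A p ->
    definable_set true A X -> small X -> ~ X p }.

Record tame : Prop := Tame {
  tame_pretame :> pretame;
  tame_sat : saturated K }.

End Tame.

Section Closure.
Local Open Scope classical_set_scope.
Variables (I : Type) (ar : I -> nat) (L : ordered_group_language ar) (K : structure ar).
Hypothesis tK : tame L K.
Local Notation lt := (@lt_in _ ar L K).
Local Notation small := (@small _ ar L K).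
Local Notation P := (@in_P _ ar K : set K).
Implicit Types (A B X Y : set K).

Definition cl B : set K := [set x | exists X : set K, [/\ definable_set true B X, small X & X x]].

Lemma definable_sub b A B X : A `<=` B -> definable_set b A X -> definable_set b B X.
Proof. by move=> AB; apply: fo_sub => c [->|Ac]; [left|right; apply: sub_consts Ac]. Qed.

Lemma definable_rel_sub b A B (R : K -> K -> Prop) : A `<=` B ->
  definable_rel b A R -> definable_rel b B R.
Proof. by move=> AB; apply: fo_sub => c [Ec|Ac]; [left|right; apply: sub_consts Ac]. Qed.

Lemma dense_P_avoid (F : seq K) x y : lt x y -> exists p, [/\ P p, lt x p, lt p y & p \notin F].
Proof.
elim: F x y => [|a F IH] x y xy.
  by have [p [Pp xp py]] := tame_dense tK xy; exists p.
have [p [Pp xp py pF]] := IH _ _ xy.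
case: (eqVneq p a) => [pa|npa]; last by exists p; split=> //; rewrite inE negb_or npa.
have [q [Pq xq qp qF]] := IH _ _ xp.
exists q; split=> //; first exact: (tame_trans tK) qp py.
rewrite inE negb_or qF andbT; apply/eqP => qa.
by apply: (tame_irr tK (x := p)); rewrite {1}pa -qa.
Qed.

Lemma small_set1 x : small (eq^~ x).
Proof.
move=> [a [b [ab Hab]]]; have [p [_ ap pb]] := dense_P_avoid [:: x] ab.
by rewrite inE => /eqP; apply; apply: Hab.
Qed.

Lemma small_subset X Y : X `<=` Y -> small Y -> small X.
Proof. by move=> XY nY [a [b [ab Xab]]]; apply: nY; exists a, b; split=> // x ax /(Xab x ax)/XY. Qed.

Lemma not_small_P X (F : seq K) : ~ small X -> exists p, [/\ P p, X p & p \notin F].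
Proof.
move=> /contrapT[a [b [ab Xab]]]; have [p [Pp ap pb pF]] := dense_P_avoid F ab.
by exists p; split=> //; apply: Xab.
Qed.

Lemma cl_mono A B : A `<=` B -> cl A `<=` cl B.
Proof. by move=> AB x [X [DX sX Xx]]; exists X; split=> //; apply: definable_sub DX. Qed.

Lemma cl_definable_point B X x : definable_set true B X -> X x -> (forall y, X y -> y = x) -> cl B x.
Proof. by move=> DX Xx uX; exists X; split=> //; apply: small_subset (@small_set1 x). Qed.

Lemma cl_self B : B `<=` cl B.
Proof. by move=> x Bx; apply: (@cl_definable_point B (eq^~ x)) => //; rewrite /definable_set; fo. Qed.

Lemma cl_finitary A x : cl A x -> exists l : seq K, (forall y, y \in l -> A y) /\ cl [set` l] x.
Proof.
move=> [X [/fo_finite_params[l lA DX] sX Xx]]; exists l; split; first exact: lA.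
by exists X.
Qed.

Lemma cl_drop_params B (l : seq K) x : [set` l] `<=` cl B -> cl (B `|` [set` l]) x -> cl B x.
Proof.
elim: l => [|c l IH] lB; first by rewrite [X in _ `|` X](_ : _ = set0) ?setU0 //; apply/seteqP; split.
have [Y [DY sY Yc]] := lB c (mem_head _ _).
rewrite set_mem_cons [[set c] `|` _]setUC setUA => -[X [/definable_set_param[R DR XR] sX Xx]].
apply: IH => [y yl|]; first by apply: lB; rewrite /= inE yl orbT.
have DY' : definable_set true (B `|` [set` l]) Y by apply: definable_sub DY => ?; left.
have DYT : definable_set true setT Y := definable_sub (@subsetT _ _) DY.
have DRT : definable_rel true setT R := definable_rel_sub (@subsetT _ _) DR.
exists (fun y => exists c', (Y c' /\ small (R c')) /\ R c' y); split.
- by rewrite /definable_set; fo.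
- apply: (tame_bigcup tK _ DRT) => [||c' []//]; first by rewrite /definable_set; fo.
  by apply: small_subset sY => y [].
- by exists c; split; [split=> //; apply: small_subset sX => y /XR|apply/XR].
Qed.

Lemma cl_trans A B : A `<=` cl B -> cl A `<=` cl B.
Proof.
move=> AB x /cl_finitary[l [lA clx]]; apply: (@cl_drop_params B l) => [y /lA/AB//|].
by apply: cl_mono clx => y; right.
Qed.

Lemma cl_exchange A a b : cl (A `|` [set a]) b -> ~ cl A b -> cl (A `|` [set b]) a.
Proof.
move=> [X [/definable_set_param[R DR XR] sX Xb]] nb.
pose R' c y := R c y /\ small (R c).
have DR' : definable_rel true A R' by rewrite /definable_rel /R'; fo.
have R'a : R' a b by split; [apply/XR|apply: small_subset sX => y /XR].
case: (pselect (small (R'^~ b))) => sb.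
  exists (R'^~ b); split=> //; have {}DR' : definable_rel true (A `|` [set b]) R'.
    by apply: definable_rel_sub DR' => ?; left.
  rewrite /definable_set; apply: (fo_rel (c := id) (d := fun=> b) _ _ DR') => //.
  - exact: subsetUr.
  - by left.
  - by right; exists b => //; right.
case: nb; exists (fun y => ~ small (R'^~ y)); split=> //; first by rewrite /definable_set; fo.
apply: (tame_swap tK) => [|x]; first exact: definable_rel_sub DR'.
case: (pselect (small (R x))) => sx; first by apply: small_subset sx => y [].
by apply: (@small_subset _ (eq^~ x)); [move=> y [_ /sx]|exact: small_set1].
Qed.

Lemma cl_pregeometry : pregeometry cl.
Proof. by split; [exact: cl_mono|exact: cl_self|exact: cl_finitary|exact: cl_trans|exact: cl_exchange]. Qed.

End Closure.

Section TameClosure.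
Local Open Scope classical_set_scope.
Variables (I : Type) (ar : I -> nat) (L : ordered_group_language ar) (K : structure ar).
Hypothesis tK : tame L K.
Local Notation lt := (@lt_in _ ar L K).
Local Notation op_in := (@op_in _ ar L K).
Local Notation small := (@small _ ar L K).
Local Notation P := (@in_P _ ar K : set K).
Local Notation cl := (@cl _ ar L K).
Local Notation supp := (supp cl P).
Local Notation pg := (cl_pregeometry tK).

Lemma supp0 : supp set0 = set0.
Proof.
apply/seteqP; split=> // p [Pp [X [DX sX Xp]]].
by case: (@tame_indep _ _ _ _ tK (set0 `|` P `\ p) X p) => // [q [//|[]//]|[//|[_ /=]]].
Qed.

Lemma supp_seq (D : seq K) : exists t : seq K, [set` t] = supp [set` D].
Proof.
have [t _ supp_t] := supp_finite pg P set0 D; rewrite set0U supp0 set0U in supp_t.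
exists [seq p <- t | `[< supp [set` D] p >]]; apply/seteqP; split=> p /=.
  by rewrite mem_filter => /andP[/asboolP].
by move=> sp; rewrite mem_filter; apply/andP; split; [apply/asboolP|apply: supp_t].
Qed.

Lemma cl_op (x y z : K) : op_in x y z ->
  [/\ cl [set x; y] z, cl [set x; z] y & cl [set y; z] x].
Proof.
move=> xyz.
have point B X w : definable_set true B X -> X w -> (forall v, X v -> v = w) -> cl B w.
  exact: cl_definable_point.
have fst_in (a b : K) : [set a; b] a by left.
have snd_in (a b : K) : [set a; b] b by right.
split.
- apply: (point _ (fun w => op_in x y w)) => // [|w /(tame_op_unique tK xyz)//].
  by rewrite /definable_set; fo.
- apply: (point _ (fun w => op_in x w z)) => // [|w /(tame_op_injr tK xyz)//].
  by rewrite /definable_set; fo.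
- apply: (point _ (fun w => op_in w y z)) => // [|w /(tame_op_injl tK xyz)//].
  by rewrite /definable_set; fo.
Qed.

Fixpoint is_product (ps : seq K) (x : K) : Prop :=
  match ps with
  | [::] => False
  | [:: p] => x = p
  | p :: ps' => exists2 y, is_product ps' y & op_in p y x
  end.

Lemma P_products_dense k (F : seq K) a b : lt a b -> exists ps x,
  [/\ size ps = k.+1, uniq ps, forall p, p \in ps -> P p /\ p \notin F,
      is_product ps x & lt a x /\ lt x b].
Proof.
elim: k F a b => [|k IH] F a b ab; have [p [Pp ap pb pF]] := dense_P_avoid tK F ab.
  by exists [:: p], p; split=> // q; rewrite inE => /eqP->.
have [a' [b' [ab' xwy]]] := tame_translate tK p ab.
have [ps [y [sz ups psP ps_y [ay yb]]]] := IH (p :: F) _ _ ab'.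
have [x [pyx ax xb]] := xwy _ ay yb.
exists (p :: ps), x; split=> //=; first by rewrite sz.
- by rewrite ups andbT; apply/negP => /psP[_]; rewrite mem_head.
- move=> q; rewrite inE => /predU1P[->//|/psP[Pq]].
  by rewrite inE negb_or => /andP[].
- by case: ps sz ps_y {ups psP} => // p' ps _ ps_y; exists y.
Qed.

Lemma cl_product ps x : is_product ps x -> cl [set` ps] x.
Proof.
elim: ps x => // p [|p' ps] IH x; first by move=> ->; apply: (pg_self pg); rewrite /= mem_head.
case=> y /IH cy /cl_op[cx _ _]; apply: (pg_trans pg) cx => z [->|->].
  by apply: (pg_self pg); rewrite /= mem_head.
by apply: (pg_mono pg) cy => u /= ups; rewrite inE ups orbT.
Qed.

Lemma cl_product_factor ps x p : uniq ps -> is_product ps x -> p \in ps ->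
  cl ([set q | q \in ps /\ q <> p] `|` [set x]) p.
Proof.
elim: ps x => // p1 [|p2 ps] IH x ups.
  by move=> ->; rewrite inE => /eqP->; apply: (pg_self pg); right.
have p1ps q : q \in p2 :: ps -> q <> p1.
  by move=> qps qp1; move: ups; rewrite -qp1 cons_uniq qps.
case=> y ps_y /cl_op[_ cy c1]; rewrite inE => /predU1P[->|pps].
  apply: (pg_trans pg) c1 => z [->|->]; last by apply: (pg_self pg); right.
  apply: (pg_mono pg) (@cl_product (p2 :: ps) y ps_y) => q qps; left.
  by split; [rewrite inE qps orbT|apply: p1ps].
have := IH y (andP ups).2 ps_y pps.
apply: (pg_trans pg) => z [[zps zp]|->].
  by apply: (pg_self pg); left; split=> //; rewrite inE zps orbT.
apply: (pg_mono pg) cy => q [->|->]; last by right.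
by left; split; [exact: mem_head|move/esym; apply: p1ps].
Qed.

(* A product of k+1 elements of P off the support of D has these elements in
   its own support over D, so it is not generated by k elements of P. *)
Lemma codense (D : seq K) k (X : set K) : ~ small X ->
  exists2 y, X y & forall q : seq K, size q <= k -> [set` q] `<=` P ->
    ~ cl ([set` D] `|` [set` q]) y.
Proof.
move=> /contrapT[a [b [ab Xab]]]; have [t supp_t] := supp_seq D.
have [ps [x [sz ups psP ps_x [ax xb]]]] := P_products_dense k t ab.
exists x => [|q qk qP cx]; first exact: Xab.
have [p pps pq] : exists2 p, p \in ps & p \notin q.
  apply: contrapT => /forall2NP ps_q; suff : size ps <= size q by rewrite sz leqNgt ltnS qk.
  by apply: uniq_leq_size => // p pps; case: (ps_q p) => // /negP; rewrite negbK.
have [Pp] := psP _ pps; apply/negP; rewrite negbK.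
suff : supp [set` D] p by rewrite -supp_t.
split=> //; apply: (pg_trans pg) (cl_product_factor ups ps_x pps) => z [[zps zp]|->].
  by apply: (pg_self pg); right; split=> //; case: (psP _ zps).
apply: (pg_mono pg) cx => y [|yq]; [by left|right; split; first exact: qP].
by move=> /= yp; rewrite -yp yq in pq.
Qed.

End TameClosure.

(** * Open conditions *)

Definition ext_point (T D : Type) (t : T) (x : D) : {_ : T & D} := existT (fun=> D) t x.

Section OpenConditions.
Local Open Scope classical_set_scope.
Variables (I : Type) (ar : I -> nat) (K : structure ar).
Local Notation first_order := (@first_order _ ar _ (fun=> K)).

Definition fo_open (T : Type) b (E : set (T -> K)) (X : set T) : Prop :=
  forall t, X t -> exists Y : set T, [/\ first_order b E Y, Y t & Y `<=` X].

Section Context.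
Variables (T : Type) (E : set (T -> K)).
Implicit Types X Y : set T.

Lemma open_fo b X : first_order b E X -> fo_open b E X.
Proof. by move=> FX t Xt; exists X; split. Qed.

Lemma openI b X Y : fo_open b E X -> fo_open b E Y -> fo_open b E (X `&` Y).
Proof.
move=> OX OY t [/OX[X' [FX X't X'X]] /OY[Y' [FY Y't Y'Y]]].
by exists (X' `&` Y'); split; [exact: fo_and FX FY|by []|exact: setISS].
Qed.

Lemma openU b X Y : fo_open b E X -> fo_open b E Y -> fo_open b E (X `|` Y).
Proof.
by move=> OX OY t [/OX|/OY] [Z [FZ Zt ZX]]; exists Z; split=> //;
  apply: subset_trans ZX _; [exact: subsetUl|exact: subsetUr].
Qed.

Definition values (C : set (T -> K)) t : set K := [set c t | c in C].

Lemma valuesU C D t : values (C `|` D) t = values C t `|` values D t.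
Proof. exact: image_setU. Qed.

Lemma values_set1 c t : values [set c] t = [set c t].
Proof. exact: image_set1. Qed.

Lemma values_consts A t : values (consts A) t = A.
Proof. by apply/seteqP; split=> [_ [_ [a Aa <-] <-]//|a Aa]; exists (fun=> a) => //; exists a. Qed.

End Context.

Definition ext_tuple k (T : Type) (E : set (T -> K)) : set ({_ : T & k.-tuple K} -> K) :=
  @ext _ _ _ (fun=> K) _ (@tuple_coord _ _ _ (fun=> K) k) E.
Arguments ext_tuple k {T} E.

Lemma ext_tuple_sub k (T : Type) (E E' : set (T -> K)) : E `<=` E' -> ext_tuple k E `<=` ext_tuple k E'.
Proof. by move=> EE' c [d /EE' Ed|d Fd]; [apply: ext_old|apply: ext_new]. Qed.

Lemma values_ext_tuple k (T : Type) (C : set (T -> K)) (u : {_ : T & k.-tuple K}) :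
  values (ext_tuple k C) u = values C (tag u) `|` [set` tval (tagged u)].
Proof.
apply/seteqP; split=> y.
- by move=> [_ [c Cc|_ [i ->]] <-]; [left; exists c|right; apply: mem_tnth].
- move=> [[c Cc <-]|/(@tnthP _ _ (tagged u))[i ->]].
    by exists (fun u => c (tag u)) => //; apply: ext_old.
  by exists (fun u : {_ : T & k.-tuple K} => tnth (tagged u) i) => //; rewrite /ext_tuple; coord.
Qed.

Lemma open_ex_P_tuple k (T : Type) (E : set (T -> K)) b (X : T -> set (k.-tuple K)) :
  fo_open b (ext_tuple k E) [set u | X (tag u) (tagged u)] ->
  fo_open false E [set t | exists q : k.-tuple K, (forall i, in_P (tnth q i)) /\ X t q].
Proof.
move=> OX t [q [qP /(OX (ext_point t q))[Y [FY Yq YX]]]].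
exists (fun t => exists q : k.-tuple K, (forall i, in_P (tnth q i)) /\ Y (ext_point t q)).
split; [|by exists q|by move=> t' [q' [q'P /YX]]; exists q'].
have {}FY := fo_weaken FY.
apply: fo_ex_tuple; apply: fo_and; first by fo.
by apply: fo_iff FY => -[].
Qed.

End OpenConditions.

Arguments ext_tuple {I ar K} k {T} E.

Section OpenRank.
Local Open Scope classical_set_scope.
Variables (I : Type) (ar : I -> nat) (L : ordered_group_language ar) (K : structure ar).
Hypothesis tK : tame L K.
Local Notation P := (@in_P _ ar K : set K).
Local Notation cl := (@cl _ ar L K).
Local Notation rk := (rk cl).
Local Notation supp := (supp cl P).
Local Notation pg := (cl_pregeometry tK).

Lemma P_nonempty : P !=set0.
Proof. by have [x [y /(tame_dense tK)[p [Pp _ _]]]] := tame_nontrivial tK; exists p. Qed.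

Lemma open_cl (T : Type) (E C : set (T -> K)) c : C `<=` E -> E c ->
  fo_open true E [set t | cl (values C t) (c t)].
Proof.
move=> CE Ec t [X [DX sX Xc]].
have [|Y FY XY] := @fo_factor _ _ _ _ _ (ext_point t) _ _
  (@ext _ _ _ (fun=> K) _ (@elt_coord _ _ _ (fun=> K)) C) X _ DX.
  move=> d [->|[_ [b Cb <-] <-]]; first by exists (fun u => tagged u) => //; coord.
  by exists (fun u => b (tag u)) => //; coord.
have XE : X = (fun x => Y (ext_point t x)).
  by apply/funext => x; apply/propext.
exists (fun t => small L (fun x => Y (ext_point t x)) /\
  Y (ext_point t (c t))); split; last 1 first.
- move=> t' [sY Yc]; exists (fun x => Y (ext_point t' x)); split=> //.
  apply: (fo_comp (h := ext_point t') FY) => d.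
  by case=> [b Cb|_ ->]; [right; exists (b t') => //; exists b|left].
- apply: fo_and; last first.
    apply: (fo_comp (h := fun t => ext_point t (c t)) FY) => d.
    by case=> [b /CE//|_ ->].
  apply: fo_small; apply: fo_iff (fo_sub _ FY) => [[]//|d].
  by case=> [b /CE Eb|b ->]; coord.
- by rewrite -XE; split=> //; apply/XY.
Qed.

Lemma open_rk (T : Type) (E C : set (T -> K)) (cs : seq (T -> K)) d : C `<=` E ->
  (forall c, List.In c cs -> E c) -> fo_open true E [set t | rk (values C t) [seq c t | c <- cs] < d].
Proof.
elim: cs C d => [|c cs IH] C d CE Ecs /=.
  by case: d => [|d] t //= _; exists setT; split=> //; apply: fo_prop.
have Ec : E c by apply: Ecs; left.
have CcE : C `|` [set c] `<=` E by move=> x [/CE|->].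
have {}Ecs b : List.In b cs -> E b by move=> bcs; apply: Ecs; right.
suff -> : [set t | ~~ `[< cl (values C t) (c t) >] +
      rk (values C t `|` [set c t]) [seq c t | c <- cs] < d] =
    [set t | cl (values C t) (c t)] `&` [set t | rk (values (C `|` [set c]) t) [seq c t | c <- cs] < d]
    `|` [set t | rk (values (C `|` [set c]) t) [seq c t | c <- cs] < d.-1].
  by apply: openU; [apply: openI|]; [exact: open_cl|exact: IH|exact: IH].
apply/seteqP; split=> t; rewrite /setU /setI /= valuesU values_set1; case: asboolP => clc /=.
- by rewrite add0n; left.
- by rewrite add1n -ltn_predRL; right.
- by rewrite add0n => -[[]//|/leq_trans]; apply; apply: leq_pred.
- by rewrite add1n -ltn_predRL => -[[]|].
Qed.

Definition P_rank_below k (W : set K) (s : seq K) d : Prop :=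
  exists q : k.-tuple K, [set` tval q] `<=` P /\ rk (W `|` [set` tval q]) s < d.

Lemma P_rank_below_finite W s d : rk (W `|` P) s < d -> exists k, P_rank_below k W s d.
Proof. by move=> /(rk_finite_part pg)[q [qP rq]]; exists (size q), (in_tuple q). Qed.

Lemma P_rank_below_widen W s d k k' : k <= k' -> P_rank_below k W s d -> P_rank_below k' W s d.
Proof.
move=> kk' [q [qP rq]]; have [p Pp] := P_nonempty.
have sz : size (q ++ nseq (k' - k) p) == k' by rewrite size_cat size_nseq size_tuple subnKC.
exists (Tuple sz); rewrite /= set_mem_cat; split=> [x [/qP//|/=]|].
  by rewrite mem_nseq => /andP[_ /eqP->].
by apply: leq_ltn_trans rq; apply: (rk_subset pg) => y [|]; [left|right; left].
Qed.

Lemma P_rank_below_rk W s d k : P_rank_below k W s d -> rk (W `|` P) s < d.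
Proof. by move=> [q [qP]]; apply: leq_ltn_trans; apply: (rk_subset pg) => z [|/qP]; [left|right]. Qed.

Lemma open_P_rank_below k (T : Type) (E C : set (T -> K)) (cs : seq (T -> K)) d : C `<=` E ->
  (forall c, List.In c cs -> E c) ->
  fo_open false E [set t | P_rank_below k (values C t) [seq c t | c <- cs] d].
Proof.
move=> CE Ecs.
have EEk c : List.In c [seq (fun u : {_ : T & k.-tuple K} => c (tag u)) | c <- cs] -> ext_tuple k E c.
  by move=> /List.in_map_iff[b [<- /Ecs Eb]]; apply: ext_old.
have rk_q : fo_open true (ext_tuple k E) [set u |
    rk (values C (tag u) `|` [set` tval (tagged u)]) [seq c (tag u) | c <- cs] < d].
  suff -> : [set u : {_ : T & k.-tuple K} | rk (values C (tag u) `|` [set` tval (tagged u)])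
      [seq c (tag u) | c <- cs] < d] =
      [set u | rk (values (ext_tuple k C) u) [seq c u | c <- [seq (fun u => c (tag u)) | c <- cs]] < d].
    by apply: open_rk EEk; apply: ext_tuple_sub.
  by apply/funext => u; rewrite /mkset -map_comp values_ext_tuple.
move=> t [q [qP rq]]; have [|Y [FY Yt Yr]] := open_ex_P_tuple (t := t)
    (X := fun t q => rk (values C t `|` [set` tval q]) [seq c t | c <- cs] < d) rk_q.
  by exists q; split=> // i; apply/qP/mem_tnth.
exists Y; split=> // t' /Yr[q' [q'P rq']]; exists q'; split=> //.
by move=> _ /(@tnthP _ _ q')[i ->].
Qed.

Lemma open_supp (T : Type) (E C : set (T -> K)) c : C `<=` E -> E c ->
  fo_open false E [set t | supp (values C t) (c t)].
Proof.
move=> CE Ec t [Pc /(cl_finite_part pg)[q [qP cq]]]; pose k := size q.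
pose X t (q : k.-tuple K) := cl (values C t `|` [set` tval q]) (c t) /\ forall i, tnth q i <> c t.
have OX : fo_open true (ext_tuple k E) [set u | X (tag u) (tagged u)].
  have -> : [set u : {_ : T & k.-tuple K} | X (tag u) (tagged u)] =
      [set u | cl (values (ext_tuple k C) u) (c (tag u))] `&`
      [set u | forall i, tnth (tagged u) i <> c (tag u)].
    by apply/funext => u; rewrite /setI /mkset values_ext_tuple.
  apply: openI; last by apply: open_fo; rewrite /ext_tuple /mkset; fo.
  by apply: open_cl; [apply: ext_tuple_sub|apply: ext_old].
have [|Y [FY Yt YX]] := open_ex_P_tuple OX (t := t).
  exists (in_tuple q); split=> [i|]; first by case: (qP _ (mem_tnth i (in_tuple q))).
  by split=> // i; case: (qP _ (mem_tnth i (in_tuple q))).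
exists (fun t => P (c t) /\ Y t); split=> //; first by apply: fo_and => //; fo.
move=> t' [Pc' /YX[q' [q'P [cq' nq']]]]; split=> //; apply: (pg_mono pg) cq' => y [|]; first by left.
by move=> /(@tnthP _ _ q')[i ->]; right; split; [apply: q'P|apply: nq'].
Qed.

End OpenRank.

(** * Elementary maps *)

Section ElementaryMaps.
Local Open Scope classical_set_scope.
Variables (I : Type) (ar : I -> nat) (L : ordered_group_language ar) (K : structure ar).
Hypothesis tK : tame L K.
Local Notation first_order := (@first_order _ ar _ (fun=> K)).
Local Notation P := (@in_P _ ar K : set K).
Local Notation small := (@small _ ar L K).
Local Notation cl := (@cl _ ar L K).
Local Notation rk := (rk cl).
Local Notation supp := (supp cl P).
Local Notation pg := (cl_pregeometry tK).
Implicit Types (E : seq (K * K)) (D F W : seq K).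

Lemma saturated_elt (A : seq K) (CC : set (set K)) : CC !=set0 ->
  (forall C, CC C -> definable_set false [set` A] C /\ C !=set0) ->
  (forall C C', CC C -> CC C' -> exists2 C'', CC C'' & C'' `<=` C `&` C') ->
  exists x, forall C, CC C -> C x.
Proof.
move=> [C0 CC0] CCD dirCC; pose lift (C : set K) : set (1.-tuple K) := [set x | C (thead x)].
have [||_ _ [C CCC <-] [C' CCC' <-]|x xCC] := @tame_sat _ _ _ _ tK 1 A [set lift C | C in CC].
- by exists (lift C0), C0.
- move=> _ [C /CCD[DC [y Cy]] <-]; split; last by exists [tuple y].
  rewrite /definable_tuples; apply: (fo_set (c := fun x : 1.-tuple K => thead x) _ _ DC) => //.
    exact: subsetUr.
  by left; exists ord0.
- have [C'' CC'' sub] := dirCC _ _ CCC CCC'; exists (lift C''); first by exists C''.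
  by move=> x /sub.
by exists (thead x) => C CCC; apply: (xCC (lift C)); exists C.
Qed.

Definition dom E : set K := [set` unzip1 E].
Definition ran E : set K := [set` unzip2 E].
Definition swap E : seq (K * K) := [seq (e.2, e.1) | e <- E].

Lemma mem_swap E x y : ((x, y) \in swap E) = ((y, x) \in E).
Proof.
have inj : injective (fun e : K * K => (e.2, e.1)) by move=> [a b] [c d] [-> ->].
exact: (mem_map inj E (y, x)).
Qed.

Lemma dom_swap E : dom (swap E) = ran E.
Proof. by rewrite /dom /ran /unzip1 /swap -map_comp. Qed.

Lemma ran_swap E : ran (swap E) = dom E.
Proof. by rewrite /dom /ran /unzip2 /swap -map_comp. Qed.

Lemma mem_dom E x y : (x, y) \in E -> dom E x.
Proof. by move=> xyE; apply/mapP; exists (x, y). Qed.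

Lemma mem_ran E x y : (x, y) \in E -> ran E y.
Proof. by move=> xyE; apply/mapP; exists (x, y). Qed.

Lemma dom_image E x : dom E x -> exists y, (x, y) \in E.
Proof. by case/mapP => -[x' y] xyE ->; exists y. Qed.

Lemma ran_preimage E y : ran E y -> exists x, (x, y) \in E.
Proof. by case/mapP => -[x y'] xyE ->; exists x. Qed.

Lemma dom_cons E x y : dom ((x, y) :: E) = dom E `|` [set x].
Proof. by rewrite /dom set_mem_cons setUC. Qed.

Lemma ran_cons E x y : ran ((x, y) :: E) = ran E `|` [set y].
Proof. by rewrite /ran set_mem_cons setUC. Qed.

Definition id_map D : seq (K * K) := [seq (x, x) | x <- D].

Lemma dom_id_map D : dom (id_map D) = [set` D].
Proof. by rewrite /dom /unzip1 -map_comp map_id. Qed.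

Lemma ran_id_map D : ran (id_map D) = [set` D].
Proof. by rewrite /ran /unzip2 -map_comp map_id. Qed.

Definition sides E : set (bool -> K) := [set fun b => if b then e.2 else e.1 | e in [set` E]].

(* A property of the points of a two-point context, read through the pairs of
   E, is a pair of conjugate properties of the domain and of the range. *)
Definition elementary b E : Prop :=
  forall X : bool -> Prop, first_order b (sides E) X -> X false <-> X true.

Lemma elementary_fo (T : Type) b E (F : set (T -> K)) (X : set T) t t' :
  elementary b E -> (forall c, F c -> (c t, c t') \in E) -> first_order b F X -> X t <-> X t'.
Proof.
move=> EE FE FX; apply: (EE (fun b => X (if b then t' else t))).
apply: (fo_comp (h := fun b : bool => if b then t' else t) FX) => c /FE cE.
by exists (c t, c t') => //; apply/funext => -[].
Qed.

Lemma elementary_open (T : Type) b E (F : set (T -> K)) (X : set T) t t' :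
  elementary b E -> (forall c, F c -> (c t, c t') \in E) -> fo_open b F X -> X t -> X t'.
Proof. by move=> EE FE OX /OX[Y [FY Yt YX]]; apply: YX; apply/(elementary_fo EE FE FY). Qed.

Lemma elementary_swap b E : elementary b E -> elementary b (swap E).
Proof.
move=> EE X FX; suff: X (~~ true) <-> X (~~ false) by [].
symmetry; apply: (EE (fun b => X (~~ b))).
apply: (fo_comp (h := negb) FX) => c [e /mapP[e' e'E ->] <-].
by exists e' => //; apply/funext => -[].
Qed.

Lemma elementary_unique b E x y y' : elementary b E -> (x, y) \in E -> (x, y') \in E -> y = y'.
Proof.
move=> EE xy xy'; pose c b := if b then y else x; pose c' b := if b then y' else x.
suff FX : first_order b (sides E) (fun i => c i = c' i) by have [/(_ erefl)] := EE _ FX.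
by apply: fo_eq; [exists (x, y)|exists (x, y')].
Qed.

Lemma elementary_injective b E x x' y : elementary b E -> (x, y) \in E -> (x', y) \in E -> x = x'.
Proof. by move=> EE; rewrite -!(mem_swap E); apply: elementary_unique (elementary_swap EE). Qed.

Lemma elementary_formulaP b E : elementary b E <->
  forall (f : formula (ar_P ar)) (v : nat -> K * K), b ==> P_free f ->
    (forall k, k \in fv f -> v k \in E) ->
    holds (fun k => (v k).1) f <-> holds (fun k => (v k).2) f.
Proof.
split=> [EE f v bf vE|EEf X [f [e [bf Ef Xf]]]].
  apply: (EE (fun i => holds (fun k => if i then (v k).2 else (v k).1) f)).
  by exists f, (fun k i => if i then (v k).2 else (v k).1); split=> // k /vE ?; exists (v k).
have /choice[v Hv] k : exists p : K * K, k \in fv f -> p \in E /\ e k = fun i => if i then p.2 else p.1.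
  by case: (boolP (k \in fv f)) => [/Ef[p pE <-]|]; [exists p|exists (point K, point K)].
rewrite !Xf; have := EEf f v bf (fun k kf => (Hv k kf).1).
by rewrite !(@eq_holds _ _ K f (fun k => e k _) _ (fun k kf => congr1 (@^~ _) (Hv k kf).2)).
Qed.

Definition elt_sides E : set (K * bool -> K) :=
  [set fst] `|` [set fun p => if p.2 then e.2 else e.1 | e in [set` E]].

Lemma elementary_cons E z z' :
  (forall X : set (K * bool), first_order true (elt_sides E) X -> X (z, false) -> X (z', true)) ->
  elementary true ((z, z') :: E).
Proof.
move=> zz X FX; pose h (i : bool) := (if i then z' else z, i).
have [|Y FY XY] := @fo_factor _ _ _ _ _ h _ _ (elt_sides E) X _ FX.
  move=> c [e /=]; rewrite inE => /predU1P[->|eE] <-; first by exists fst => //; left.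
  by exists (fun p => if p.2 then e.2 else e.1) => //; right; exists e.
rewrite !XY /h; split; first exact: zz.
by move=> Yz'; apply: contrapT => /(zz _ (fo_not FY)).
Qed.

Lemma definable_side b E (X : set (K * bool)) i : first_order b (elt_sides E) X ->
  definable_set b (if i then ran E else dom E) (fun y => X (y, i)).
Proof.
move=> FX; apply: (fo_comp (h := fun y => (y, i)) FX) => c [->|[e /= eE <-]]; first by left.
by right; exists (if i then e.2 else e.1) => //; case: (i); apply: map_f.
Qed.

Lemma elementary_small E (X : set (K * bool)) : elementary true E -> first_order true (elt_sides E) X ->
  small (fun y => X (y, false)) <-> small (fun y => X (y, true)).
Proof.
move=> EE FX; apply: (EE (fun i => small (fun y => X (y, i)))); apply: fo_small.
apply: (fo_comp (h := fun u : {_ : bool & K} => (tagged u, tag u)) FX) => c.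
case=> [->|[e eE <-]]; first by coord.
by apply: (@ext_old _ _ _ _ _ _ _ (fun i : bool => if i then e.2 else e.1)); exists e.
Qed.

Lemma realize E z W (CC : set (set K)) : CC !=set0 ->
  (forall C, CC C -> definable_set false [set` W] C) ->
  (forall C C', CC C -> CC C' -> exists2 C'', CC C'' & C'' `<=` C `&` C') ->
  (forall X C, first_order true (elt_sides E) X -> CC C -> X (z, false) -> exists2 y, C y & X (y, true)) ->
  exists2 z', elementary true ((z, z') :: E) & forall C, CC C -> C z'.
Proof.
move=> [C0 CC0] CD dirCC satCC; pose A := unzip2 E ++ W.
pose CE : set (set K) := [set Y | exists C X, [/\ CC C, first_order true (elt_sides E) X, X (z, false) &
  Y = C `&` (fun y => X (y, true))]].
have [|_ [C [X [CCC FX Xz ->]]]||z' z'CE] := @saturated_elt A CE.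
- by exists (C0 `&` (fun=> True)), C0, setT; split=> //; apply: fo_prop.
- split; last by have [y Cy Xy] := satCC X C FX CCC Xz; exists y.
  apply: fo_and; first by apply: definable_sub (CD _ CCC); rewrite /A set_mem_cat; apply: subsetUr.
  apply: (@definable_sub _ _ _ _ (ran E)); first by rewrite /A set_mem_cat; apply: subsetUl.
  exact: fo_weaken (definable_side true FX).
- move=> _ _ [C [X [CCC FX Xz ->]]] [C' [X' [CCC' FX' X'z ->]]].
  have [C'' CCC'' sub] := dirCC _ _ CCC CCC'; exists (C'' `&` (fun y => X (y, true) /\ X' (y, true))).
    by exists C'', (X `&` X'); split=> //; apply: fo_and.
  by move=> y [/sub[Cy C'y] [Xy X'y]].
exists z' => [|C CCC].
  apply: elementary_cons => X FX Xz; suff: (C0 `&` (fun y => X (y, true))) z' by case.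
  by apply: z'CE; exists C0, X.
suff: (C `&` (fun=> True)) z' by case.
by apply: z'CE; exists C, setT; split=> //; apply: fo_prop.
Qed.

Definition admissible E : Prop :=
  [/\ elementary true E, forall x y, (x, y) \in E -> (P x <-> P y),
      supp (dom E) `<=` dom E & supp (ran E) `<=` ran E].

Lemma admissible_swap E : admissible E -> admissible (swap E).
Proof.
move=> [EE EP Ed Er]; split; first exact: elementary_swap.
- by move=> x y; rewrite mem_swap => /EP ->.
- by rewrite dom_swap.
- by rewrite ran_swap.
Qed.

Lemma admissible_id D : supp [set` D] `<=` [set` D] -> admissible (id_map D).
Proof.
move=> sD; split; rewrite ?dom_id_map ?ran_id_map //; last by move=> x y /mapP[a _ [-> ->]].
apply/elementary_formulaP => f v _ vD.
by apply: eq_holds => k /vD/mapP[x _ ->].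
Qed.

(* A set of the domain side that contains a point outside cl (dom E) is not
   small, hence neither is its conjugate on the range side. *)
Lemma conjugate_not_small E (X : set (K * bool)) z : elementary true E -> ~ cl (dom E) z ->
  first_order true (elt_sides E) X -> X (z, false) -> ~ small (fun y => X (y, true)).
Proof.
move=> EE nz FX Xz /(elementary_small EE FX) sX; apply: nz.
by exists (fun y => X (y, false)); split=> //; apply: (definable_side false FX).
Qed.

Lemma admissible_extend_P E p F : admissible E -> P p -> ~ dom E p ->
  exists2 p', admissible ((p, p') :: E) & p' \notin F.
Proof.
move=> [EE EP Ed Er] Pp npE; pose C : set K := [set y | P y /\ y \notin F].
have DC : definable_set false [set` F] C.
  apply: fo_and; first by fo.
  apply: (@fo_iff _ _ _ _ _ _ (fun y => forall a, a \in F -> y <> a)).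
    by move=> y; split=> [yF|yF a aF ya]; [apply/negP => /yF|move: yF; rewrite ya aF].
  by apply: fo_all_mem => a aF; apply: fo_not; apply: fo_eq; [left|right; exists a].
have [|_ ->|_ _ -> ->|X _ FX -> Xp|p' Ep' /(_ C erefl)[Pp' p'F]] := @realize E p F [set C].
- by exists C.
- by [].
- by exists C.
- suff /(@not_small_P _ _ _ _ tK _ F)[y [Py Xy yF]] : ~ small (fun y => X (y, true)) by exists y.
  apply: (@conjugate_not_small E X p) => // clp; apply: npE; apply: Ed; split=> //.
  by apply: (pg_mono pg) clp => y; left.
exists p' => //; split=> //.
- by move=> x y; rewrite inE => /predU1P[[-> ->]|/EP].
- rewrite dom_cons => q /(supp_addP pg)[y ->//|/Ed|]; [by left|by right].
- rewrite ran_cons => q /(supp_addP pg)[y ->//|/Er|]; [by left|by right].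
Qed.

(* By codensity, no k bounds the number of elements of P needed to generate the
   points of a set that is not small; saturation makes k infinite. *)
Lemma realize_outside E z W : elementary true E -> ~ cl (dom E) z ->
  exists2 z', elementary true ((z, z') :: E) & ~ cl ([set` W] `|` P) z'.
Proof.
move=> EE nz.
pose near k y := P_rank_below L k [set` W] [:: y] 1.
pose CC : set (set K) := [set C | exists k Y, [/\ definable_set false [set` W] Y,
  Y `<=` near k & C = ~` Y]].
have [|C [k [Y [DY _ ->]]]|||z' Ez' z'CC] := @realize E z W CC.
- by exists (~` set0), 0, set0; split=> //; apply: fo_prop.
- exact: fo_not.
- move=> _ _ [k [Y [DY Yk ->]]] [k' [Y' [DY' Y'k ->]]].
  exists (~` (Y `|` Y')); last by rewrite setCU.
  exists (maxn k k'), (Y `|` Y'); split=> //; first exact: fo_or.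
  by move=> y [/Yk|/Y'k]; apply: (P_rank_below_widen tK); rewrite ?leq_maxl ?leq_maxr.
- move=> X _ FX [k [Y [DY Yk ->]]] Xz.
  have [y Xy ncy] := codense tK W k (conjugate_not_small EE nz FX Xz); exists y => //.
  by move=> /Yk[q [qP]]; rewrite -cl_rk; apply: ncy => //; rewrite size_tuple.
exists z' => //; rewrite cl_rk => /(P_rank_below_finite tK)[k z'k].
have CE : consts [set` W] `<=` elt_context [set` W] by exact: subsetUr.
have Eid c : List.In c [:: id] -> elt_context [set` W] c by case=> // <-; left.
have [|Y [DY Yz' Yk]] := @open_P_rank_below _ _ L K k _ _ _ [:: id] 1 CE Eid z'.
  by rewrite /mkset values_consts.
apply: (z'CC (~` Y)) Yz'; exists k, Y; split=> // y /Yk.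
by rewrite /mkset values_consts.
Qed.

Lemma admissible_extend_outside E z F : admissible E -> ~ cl (dom E `|` P) z ->
  exists2 z', admissible ((z, z') :: E) & ~ cl (ran E `|` [set` F] `|` P) z'.
Proof.
move=> [EE EP Ed Er] nz.
have [|z' Ez' nz'] := @realize_outside E z (unzip2 E ++ F) EE.
  by move=> clz; apply: nz; apply: (pg_mono pg) clz => y; left.
rewrite set_mem_cat in nz'; exists z' => //; split=> //.
- have nPz : ~ P z by move=> Pz; apply: nz; apply: (pg_self pg); right.
  have nPz' : ~ P z' by move=> Pz; apply: nz'; apply: (pg_self pg); right.
  by move=> x y; rewrite inE => /predU1P[[-> ->]|/EP].
- by rewrite dom_cons => q /(supp_add_outside pg nz)/Ed; left.
- rewrite ran_cons => q sq; left; apply: Er; apply: (supp_add_outside pg) sq => clz.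
  by apply: nz'; apply: (pg_mono pg) clz => y [|]; [left; left|right].
Qed.

Lemma realize_cl E z : elementary true E -> cl (dom E) z ->
  exists2 z', elementary true ((z, z') :: E) & cl (ran E) z'.
Proof.
move=> EE cz.
have [||_ _ -> ->|X _ FX -> Xz|z' Ez' _] := @realize E z [::] [set setT].
- by exists setT.
- by move=> _ ->; apply: fo_prop.
- by exists setT.
- have FX' : first_order true (sides E) (fun i => exists y, X (y, i)).
    apply: fo_ex; apply: (fo_comp (h := fun u : {_ : bool & K} => (tagged u, tag u)) FX) => c.
    case=> [->|[e eE <-]]; first by coord.
    by apply: (@ext_old _ _ _ _ _ _ _ (fun i : bool => if i then e.2 else e.1)); exists e.
  by have [] := (EE _ FX').1; [exists z|move=> y Xy; exists y].
exists z' => //; pose c (i : bool) := if i then z' else z.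
have values_sides i : values (sides E) i = if i then ran E else dom E.
  apply/seteqP; split=> x; first by move=> [_ [e eE <-] <-]; case: i; apply: map_f.
  by case: i => /mapP[e eE ->]; exists (fun i : bool => if i then e.2 else e.1) => //; exists e.
have OX := @open_cl _ _ L K bool (sides ((z, z') :: E)) (sides E) c.
have := elementary_open (t := false) (t' := true) Ez' _ (OX _ _).
rewrite /mkset !values_sides; apply=> //.
- by move=> _ [e eE <-]; rewrite -surjective_pairing.
- by move=> _ [e eE <-]; exists e => //; rewrite /= inE eE orbT.
- by exists (z, z') => //=; rewrite mem_head.
Qed.

Lemma admissible_extend_cl E z : admissible E -> cl (dom E) z ->
  exists2 z', admissible ((z, z') :: E) & cl (ran E) z'.
Proof.
move=> [EE EP Ed Er] cz; have [z' Ez' cz'] := realize_cl EE cz; exists z' => //; split=> //.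
- have z_z' : (z, z') \in (z, z') :: E by exact: mem_head.
  have sub e : e \in E -> e \in (z, z') :: E by move=> eE; rewrite inE eE orbT.
  move=> x y; rewrite inE => /predU1P[[-> ->]|/EP//]; split=> Pz.
    have [|y' yE] := @dom_image E z.
      by apply: Ed; split=> //; apply: (pg_mono pg) cz => w; left.
    by rewrite (elementary_unique Ez' z_z' (sub _ yE)); apply/(EP _ _ yE).
  have [|x' xE] := @ran_preimage E z'.
    by apply: Er; split=> //; apply: (pg_mono pg) cz' => w; left.
  by rewrite (elementary_injective Ez' z_z' (sub _ xE)); apply/(EP _ _ xE).
- rewrite dom_cons => q sq; left; apply: Ed; apply: (supp_cl pg) sq => y [|->//].
  exact: (pg_self pg).
- rewrite ran_cons => q sq; left; apply: Er; apply: (supp_cl pg) sq => y [|->//].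
  exact: (pg_self pg).
Qed.

Definition extends_avoiding F E E' : Prop :=
  [/\ admissible E', {subset E <= E'} & forall y, ran E' y -> P y -> y \in F -> ran E y].

Lemma extends_avoiding_refl F E : admissible E -> extends_avoiding F E E.
Proof. by move=> aE; split. Qed.

Lemma extends_avoiding_trans F E E' E'' : extends_avoiding F E E' -> extends_avoiding F E' E'' ->
  extends_avoiding F E E''.
Proof.
move=> [aE' EE' E'F] [aE'' EE'' E''F]; split=> // [e /EE'/EE''//|y y'' Py yF].
by apply: E'F => //; apply: E''F.
Qed.

Lemma extends_avoiding_cons F E x x' : admissible ((x, x') :: E) -> (P x' -> x' \in F -> ran E x') ->
  extends_avoiding F E ((x, x') :: E).
Proof.
move=> aE x'F; split=> // [e eE|y]; first by rewrite inE eE orbT.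
by rewrite ran_cons => -[//|->]; apply: x'F.
Qed.

Lemma dom_subset E E' : {subset E <= E'} -> dom E `<=` dom E'.
Proof. by move=> EE' x /dom_image[y /EE'/mem_dom]. Qed.

Lemma ran_subset E E' : {subset E <= E'} -> ran E `<=` ran E'.
Proof. by move=> EE' y /ran_preimage[x /EE'/mem_ran]. Qed.

Lemma admissible_extend_P_seq E (t : seq K) F : admissible E -> [set` t] `<=` P ->
  exists E', [/\ extends_avoiding F E E', [set` t] `<=` dom E' & dom E' `<=` dom E `|` P].
Proof.
elim: t => [|p t IH] aE tP.
  by exists E; split; [exact: extends_avoiding_refl| |exact: subsetUl].
have [|E' [EE' tE' dE']] := IH aE; first by move=> q /= qt; apply: tP; rewrite /= inE qt orbT.
case: (pselect (dom E' p)) => pE'.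
  by exists E'; split=> // q /=; rewrite inE => /predU1P[->|/tE'].
have Pp : P p by apply: tP; rewrite /= mem_head.
have [aE' _ _] := EE'; have [p' aE'' p'F] := admissible_extend_P F aE' Pp pE'.
exists ((p, p') :: E'); split.
- apply: extends_avoiding_trans EE' _; apply: extends_avoiding_cons => // _.
  by rewrite (negbTE p'F).
- by move=> q /=; rewrite dom_cons inE => /predU1P[->|/tE']; [right|left].
- by rewrite dom_cons => y [/dE'//|->]; right.
Qed.

Lemma admissible_extend E z F : admissible E -> exists E' z',
  [/\ extends_avoiding F E E', (z, z') \in E', dom E' `<=` cl (dom E `|` P `|` [set z]) &
      ~ cl (dom E `|` P) z -> ~ cl (ran E `|` [set` F] `|` P) z'].
Proof.
move=> aE; case: (pselect (cl (dom E `|` P) z)) => cz; last first.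
  have [z' aE' nz'] := admissible_extend_outside F aE cz.
  exists ((z, z') :: E), z'; split=> //; last 2 first.
  - by rewrite mem_head.
  - by rewrite dom_cons => y [yE|->]; apply: (pg_self pg); [left; left|right].
  apply: extends_avoiding_cons => // Pz'; case: nz'.
  by apply: (pg_self pg); right.
have [t [tP ct]] := cl_finite_part pg cz.
have [E' [EE' tE' dE']] := admissible_extend_P_seq F aE tP; have [aE' sE' _] := EE'.
have cz1 : cl (dom E') z.
  by apply: (pg_mono pg) ct => y [|/tE'//]; apply: dom_subset.
have [z' aE'' cz'] := admissible_extend_cl aE' cz1.
exists ((z, z') :: E'), z'; split=> //.
- apply: extends_avoiding_trans EE' _; apply: extends_avoiding_cons => // Pz' _.
  by have [_ _ _ Er] := aE'; apply: Er; split=> //; apply: (pg_mono pg) cz' => w; left.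
- by rewrite mem_head.
- by rewrite dom_cons => y [/dE' yE|->]; apply: (pg_self pg); [left|right].
Qed.

Lemma admissible_holds (f : formula (ar_P ar)) E (v : nat -> K * K) : admissible E ->
  (forall k, k \in fv f -> v k \in E) -> holds (fun k => (v k).1) f -> holds (fun k => (v k).2) f.
Proof.
elim: f E v => [[i|] vs|a b|f IH|f IHf g IHg|x f IH] E v aE vE.
- by have [/elementary_formulaP EE _ _ _] := aE; move/(EE (FRel vs) v isT vE).
- have [_ EP _ _] := aE; rewrite /holds /=.
  have in_P_head (w : nat -> K) : interp (map_tuple w vs) <-> P (w (thead vs)).
    by rewrite /in_P (_ : [tuple _] = map_tuple w vs) //; apply: val_inj => /=; case: vs {vE} => -[|a []].
  rewrite !in_P_head => Pv; apply/(EP (v (thead vs)).1) => //.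
  by rewrite -surjective_pairing; apply: vE; apply: mem_tnth.
- by have [/elementary_formulaP EE _ _ _] := aE; move/(EE (FEq _ a b) v isT vE).
- move=> nf hf; apply: nf; apply: (IH (swap E) (fun k => ((v k).2, (v k).1))) => //.
    exact: admissible_swap.
  by move=> k /vE; rewrite mem_swap -surjective_pairing.
- move=> [hf hg]; split; [apply: (IHf E)|apply: (IHg E)] => // k kf; apply: vE;
    by rewrite mem_cat kf ?orbT.
- move=> [a ha]; have [E' [a' [[aE' EE' _] aa' _ _]]] := admissible_extend a [::] aE.
  exists a'; pose w k := if k == x then (a, a') else v k.
  have := IH E' w aE'; rewrite /w.
  have -> : (fun k => (if k == x then (a, a') else v k).1) = (fun k => if k == x then a else (v k).1).
    by apply/funext => k; case: eqP.
  have -> : (fun k => (if k == x then (a, a') else v k).2) = (fun k => if k == x then a' else (v k).2).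
    by apply/funext => k; case: eqP.
  apply=> // k kf; case: eqVneq => // kx; apply/EE'/vE.
  by rewrite mem_filter kx.
Qed.

Lemma admissible_elementary E : admissible E -> elementary false E.
Proof.
move=> aE; apply/elementary_formulaP => f v _ vE; split; first exact: admissible_holds aE vE.
apply: (admissible_holds (admissible_swap aE) (v := fun k => ((v k).2, (v k).1))) => k /vE.
by rewrite mem_swap -surjective_pairing.
Qed.

Lemma admissible_extend_tuple n E (g : n.-tuple K) F : admissible E -> exists E' (h : n.-tuple K),
  [/\ extends_avoiding F E E', forall i, (tnth g i, tnth h i) \in E' &
      rk (dom E `|` P) g <= rk (ran E `|` [set` F] `|` P) h].
Proof.
elim: n E g => [|n IH] E g aE.
  by exists E, [tuple]; rewrite (tuple0 g); split=> [|[]|//]; first exact: extends_avoiding_refl.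
have [z [{}g ->]] : exists z (g' : n.-tuple K), g = [tuple of z :: g'].
  by exists (thead g), (behead_tuple g); apply: tuple_eta.
have [E' [z' [EE' zE' dE' nz]]] := admissible_extend z F aE; have [aE' sE' _] := EE'.
have [E'' [h [EE'' gh rk_h]]] := IH E' g aE'; have [_ sE'' _] := EE''.
exists E'', [tuple of z' :: h]; split; first exact: extends_avoiding_trans EE''.
  by move=> i; case: (unliftP ord0 i) => [j|] ->; rewrite ?tnthS ?tnth0 //; apply: sE''.
apply: leq_add; first by case: asboolP => //= /nz nz'; case: asboolP.
apply: (@leq_trans (rk (dom E' `|` P) g)).
  by apply: (rk_le_cl pg) => y [/dE'//|Py]; apply: (pg_self pg); left; right.
apply: (leq_trans rk_h); apply: (rk_subset pg) => y [[[/(ran_subset sE')|]|]|->].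
- by left; left.
- by left; right.
- by right.
- by left; left; apply: mem_ran zE'.
Qed.

Lemma definable_point_fixed D D' (X : set K) E z y : definable_set false [set` D] X -> X z ->
  (forall x, X x -> x = z) -> admissible E -> {subset id_map D' <= E} -> {subset D <= D'} ->
  (z, y) \in E -> y = z.
Proof.
move=> DX Xz uX aE DE DD' zyE; apply: uX; move: Xz.
rewrite (elementary_fo (t := z) (t' := y) (admissible_elementary aE) _ DX) // => c.
by case=> [->|[d /= dD <-]] //; apply/DE/map_f/DD'.
Qed.

Section DefinablePoint.
Variables (D : seq K) (X : set K) (z : K).
Hypothesis DX : definable_set false [set` D] X.
Hypothesis Xz : X z.
Hypothesis uX : forall x, X x -> x = z.

Lemma definable_point_cl_P D' : supp [set` D'] `<=` [set` D'] -> {subset D <= D'} ->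
  cl ([set` D'] `|` P) z.
Proof.
move=> sD' DD'; apply: contrapT; rewrite -dom_id_map => nz.
have [z' aE nz'] := admissible_extend_outside [:: z] (admissible_id sD') nz.
have z'z : z' = z.
  apply: (definable_point_fixed DX Xz uX aE) DD' (mem_head _ _) => e eD.
  by rewrite inE eD orbT.
by apply: nz'; apply: (pg_self pg); left; right; rewrite z'z /= mem_head.
Qed.

(* A point of cl (D' + p) outside cl D' moves with p. *)
Lemma definable_point_exchange D' p : supp [set` D'] `<=` [set` D'] -> {subset D <= D'} ->
  P p -> cl ([set` D'] `|` [set p]) z -> cl [set` D'] z.
Proof.
move=> sD' DD' Pp cp; apply: contrapT => nz.
have npD : ~ dom (id_map D') p.
  by rewrite dom_id_map => pD; apply: nz; apply: (pg_mono pg) cp => y [//|->].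
have [p' aE p'F] := admissible_extend_P (p :: D') (admissible_id sD') Pp npD.
have cz : cl (dom ((p, p') :: id_map D')) z by rewrite dom_cons dom_id_map.
have [z' aE' cz'] := admissible_extend_cl aE cz.
have z'z : z' = z.
  apply: (definable_point_fixed DX Xz uX aE') DD' (mem_head _ _) => e eD.
  by rewrite !inE eD !orbT.
rewrite z'z ran_cons ran_id_map in cz'; have cp' := pg_exchange pg cz' nz.
have [_ EP _ _] := aE; have Pp' : P p' by apply/(EP p p'); rewrite ?mem_head.
move: p'F; rewrite inE negb_or => /andP[/eqP p'p /negP]; apply; apply: sD'; split=> //.
apply: (pg_trans pg) cp' => y [yD|->]; first by apply: (pg_self pg); left.
by apply: (pg_mono pg) cp => x [|->]; [left|right; split=> // /esym].
Qed.

Lemma definable_point_cl : cl ([set` D] `|` supp [set` D]) z.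
Proof.
have [t supp_t] := supp_seq tK D; pose D' := D ++ t.
have D'E : [set` D] `|` supp [set` D] = [set` D'] by rewrite -supp_t set_mem_cat.
have sD' : supp [set` D'] `<=` [set` D'] by rewrite -D'E => p /(supp_idem pg); right.
have DD' : {subset D <= D'} by move=> x xD; rewrite mem_cat xD.
rewrite D'E; have [q [qP]] := cl_finite_part pg (definable_point_cl_P sD' DD').
elim: q qP => [|p q IH] qP cz; first by apply: (pg_mono pg) cz => x [].
have {}IH := IH (fun y yq => qP y (mem_behead (s := p :: q) yq)).
apply: IH; rewrite -set_mem_cat; apply: (@definable_point_exchange (D' ++ q) p).
- rewrite set_mem_cat => y /(supp_addP pg)[x xq|/sD'|]; [|by left|by right].
  by apply: qP; rewrite inE; apply/orP; right.
- by move=> x /DD' xD; rewrite mem_cat xD.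
- by apply: qP; rewrite mem_head.
- by rewrite set_mem_cat -setUA [X in _ `|` X]setUC -set_mem_cons.
Qed.

End DefinablePoint.

End ElementaryMaps.

(** * Generic definability *)

Section GenericDefinability.
Local Open Scope classical_set_scope.
Variables (I : Type) (ar : I -> nat) (L : ordered_group_language ar) (K : structure ar).
Hypothesis tK : tame L K.
Local Notation P := (@in_P _ ar K : set K).
Local Notation cl := (@cl _ ar L K).
Local Notation rk := (rk cl).
Local Notation supp := (supp cl P).
Local Notation pg := (cl_pregeometry tK).

Variable A : seq K.
Local Notation AP := ([set` A] `|` P).

Section Tuples.
Variable n : nat.
Local Notation tuples := (n.-tuple K).
Implicit Types (x y : tuples) (X Y Q : set tuples).

Definition tuple_proj : seq (tuples -> K) := [seq (fun x => tnth x i) | i <- enum 'I_n].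

Lemma tuple_proj_context c : List.In c tuple_proj -> tuple_context [set` A] c.
Proof. by move=> /List.in_map_iff[i [<- _]]; left; exists i. Qed.

Lemma map_tuple_proj x : [seq c x | c <- tuple_proj] = x.
Proof. by rewrite /tuple_proj -map_comp -[RHS](map_tnth_enum x). Qed.

Lemma P_rank_below_nbhd k d x : P_rank_below L k [set` A] x d -> exists Y,
  [/\ definable_tuples false [set` A] Y, Y x & Y `<=` [set y : tuples | P_rank_below L k [set` A] y d]].
Proof.
have CE : consts [set` A] `<=` tuple_context (n := n) [set` A] by exact: subsetUr.
have := @open_P_rank_below _ _ L K k _ _ _ _ d CE tuple_proj_context.
move=> /(_ x); rewrite /mkset values_consts map_tuple_proj => open_x /open_x[Y [DY Yx sub]].
by exists Y; split=> // y /sub; rewrite /mkset values_consts map_tuple_proj.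
Qed.

Definition below_rank d Y : Prop :=
  definable_tuples false [set` A] Y /\ forall x, Y x -> rk AP x < d.

Lemma below_rank_nbhd d x : rk AP x < d -> exists2 Y, below_rank d Y & Y x.
Proof.
move=> /(P_rank_below_finite tK)[k /P_rank_below_nbhd[Y [DY Yx sub]]].
by exists Y => //; split=> // y /sub; apply: (P_rank_below_rk tK).
Qed.

Lemma below_rankU d Y Y' : below_rank d Y -> below_rank d Y' -> below_rank d (Y `|` Y').
Proof. by move=> [DY Yd] [DY' Y'd]; split; [apply: fo_or|move=> x [/Yd|/Y'd]]. Qed.

Lemma P_rank_below_bounded X d : definable_tuples false [set` A] X ->
  (forall x, X x -> rk AP x < d) -> exists k, forall x, X x -> P_rank_below L k [set` A] x d.
Proof.
move=> DX Xd; apply: contrapT => /forallNP nk.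
have [||||||C Y -> [_ [k Yk]]|x [/(_ X erefl) Xx nx]] := @saturated_avoid _ _ K n A [set X]
  [set Y | definable_tuples false [set` A] Y /\ exists k, forall x, Y x -> P_rank_below L k [set` A] x d]
  (tame_sat tK).
- by exists X.
- by move=> _ ->.
- by move=> _ _ -> ->; exists X.
- by exists set0; split; [exact: fo_prop|exists 0].
- by move=> Y [].
- move=> Y Y' [DY [k Yk]] [DY' [k' Y'k']]; split; first exact: fo_or.
  exists (maxn k k') => x [/Yk|/Y'k']; apply: (P_rank_below_widen tK); rewrite ?leq_maxl ?leq_maxr //.
- have /existsNP[x /not_implyP[Xx nx]] := nk k; exists x; split=> // /Yk.
  exact: nx.
have [k /P_rank_below_nbhd[Y [DY Yx sub]]] := P_rank_below_finite tK (Xd x Xx).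
by apply: (nx Y) Yx; split=> //; exists k.
Qed.

(* Saturation finds a common point that moreover has rank at least d, because
   the points of smaller rank form a directed union of definable sets. *)
Lemma generic_realization d (CC D : set (set tuples)) :
  CC !=set0 -> (forall C, CC C -> definable_tuples false [set` A] C) ->
  (forall C C', CC C -> CC C' -> exists2 C'', CC C'' & C'' `<=` C `&` C') ->
  D !=set0 -> (forall Y, D Y -> definable_tuples false [set` A] Y) ->
  (forall Y Y', D Y -> D Y' -> D (Y `|` Y')) ->
  (forall C Y, CC C -> D Y -> exists2 x, (C `\` Y) x & d <= rk AP x) ->
  exists x, [/\ forall C, CC C -> C x, forall Y, D Y -> ~ Y x & d <= rk AP x].
Proof.
move=> CC0 CD dirCC [Y0 DY0] DD DU genCC.
have no_pts : below_rank d set0 by split=> //; apply: fo_prop.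
have [|_ [Y DY [Z [DZ _] <-]]|_ _ [Y DY [Z bZ <-]] [Y' DY' [Z' bZ' <-]]|C _ CCC [Y DY [Z [_ Zd] <-]]|
    x [CCx nx]] :=
  @saturated_avoid _ _ K n A CC [set Y `|` Z | Y in D & Z in below_rank d] (tame_sat tK) CC0 CD dirCC.
- by exists (Y0 `|` set0), Y0 => //; exists set0.
- by apply: fo_or => //; apply: DD.
- exists (Y `|` Y'); first exact: DU.
  by exists (Z `|` Z'); [apply: below_rankU|rewrite setUACA].
- have [x [Cx nYx] rx] := genCC C Y CCC DY; exists x; split=> // -[//|/Zd].
  by rewrite ltnNge rx.
have avoid Y Z : D Y -> below_rank d Z -> ~ (Y `|` Z) x.
  by move=> DY bZ; apply: nx; exists Y => //; exists Z.
exists x; split=> // [Y DY Yx|]; first by apply: (avoid Y set0) => //; left.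
by rewrite leqNgt; apply/negP => /below_rank_nbhd[Z bZ Zx]; apply: (avoid Y0 Z) => //; right.
Qed.

Definition tuple_map x y : seq (K * K) := id_map A ++ zip x y.

Lemma id_map_tuple_map x y a : a \in A -> (a, a) \in tuple_map x y.
Proof. by move=> aA; rewrite mem_cat map_f. Qed.

Lemma zip_tnth x y i : (tnth x i, tnth y i) \in zip x y.
Proof.
apply/(nthP (tnth x i, tnth y i)); exists i; first by rewrite size_zip !size_tuple minnn.
by rewrite nth_zip ?size_tuple // -!tnth_nth.
Qed.

Lemma zip_mem x y e : e \in zip x y -> exists i, e = (tnth x i, tnth y i).
Proof.
move=> /(nthP e)[i]; rewrite size_zip !size_tuple minnn => i_n <-; exists (Ordinal i_n).
set o := Ordinal i_n; rewrite (set_nth_default (tnth x o, tnth y o)) ?size_zip ?size_tuple ?minnn //.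
by rewrite nth_zip ?size_tuple //; congr (_, _); apply/esym/tnth_nth.
Qed.

Lemma tnth_tuple_map x y i : (tnth x i, tnth y i) \in tuple_map x y.
Proof. by rewrite mem_cat zip_tnth orbT. Qed.

Lemma dom_tuple_map x y : dom (tuple_map x y) = [set` A] `|` [set` tval x].
Proof.
rewrite /dom /tuple_map {1}/unzip1 map_cat -!/(unzip1 _) unzip1_zip ?size_tuple // set_mem_cat.
by congr (_ `|` _); apply: dom_id_map.
Qed.

Lemma ran_tuple_map x y : ran (tuple_map x y) = [set` A] `|` [set` tval y].
Proof.
rewrite /ran /tuple_map {1}/unzip2 map_cat -!/(unzip2 _) unzip2_zip ?size_tuple // set_mem_cat.
by congr (_ `|` _); apply: ran_id_map.
Qed.

Lemma elementary_tuples b E x y Q : elementary b E -> {subset id_map A <= E} ->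
  (forall i, (tnth x i, tnth y i) \in E) -> definable_tuples b [set` A] Q -> Q x <-> Q y.
Proof.
move=> EE AE xyE DQ; apply: (elementary_fo EE _ DQ) => c [[i _ <-]|[a /= aA <-]]; first exact: xyE.
exact/AE/map_f.
Qed.

Definition same_type x y : Prop :=
  forall phi, definable_tuples true [set` A] phi -> phi x -> phi y.

Lemma elementary_tuple_map x y : same_type x y -> elementary true (tuple_map x y).
Proof.
move=> xy X FX; pose h (i : bool) := if i then y else x.
have [|Y FY XY] := @fo_factor _ _ _ _ _ h _ _ (tuple_context [set` A]) X _ FX.
  move=> c [e eE <-]; move: eE; rewrite /= mem_cat => /orP[/mapP[a aA ->]|].
    by exists (fun=> a) => [|[]//]; right; exists a.
  case/zip_mem => i ->; exists (fun z => tnth z i); first by left; exists i.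
  by case.
rewrite !XY; split; first exact: (xy _ FY).
by move=> Yy; apply: contrapT => nYx; apply: (xy _ (fo_not FY) nYx).
Qed.

Hypothesis supp_A : supp [set` A] `<=` [set` A].

Lemma admissible_tuple_map d x y : same_type x y -> rk [set` A] x <= d ->
  d <= rk AP x -> d <= rk AP y -> admissible L (tuple_map x y).
Proof.
move=> xy rx rPx rPy; have EE := elementary_tuple_map xy.
have ry : rk [set` A] y <= d.
  have CE : consts [set` A] `<=` tuple_context (n := n) [set` A] by exact: subsetUr.
  have := elementary_open EE _ (@open_rk _ _ L K _ _ _ _ d.+1 CE tuple_proj_context).
  move=> /(_ x y); rewrite /mkset !values_consts !map_tuple_proj !ltnS; apply=> //.
  move=> c [[i _ <-]|[a /= aA <-]]; [exact: tnth_tuple_map|exact: id_map_tuple_map].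
have sx : supp (dom (tuple_map x y)) `<=` [set` A].
  by rewrite dom_tuple_map => p /(supp_sub_of_rk pg (leq_trans rx rPx))/supp_A.
have sy : supp (ran (tuple_map x y)) `<=` [set` A].
  by rewrite ran_tuple_map => p /(supp_sub_of_rk pg (leq_trans ry rPy))/supp_A.
split=> //; last 2 first.
- by move=> p /sx pA; rewrite dom_tuple_map; left.
- by move=> p /sy pA; rewrite ran_tuple_map; left.
move=> z z' zz'; split=> Pz.
  have zA : z \in A by apply: sx; split=> //; apply: (pg_self pg); left; apply: mem_dom zz'.
  by rewrite -(elementary_unique EE (id_map_tuple_map x y zA) zz').
have zA : z' \in A by apply: sy; split=> //; apply: (pg_self pg); left; apply: mem_ran zz'.
by rewrite (elementary_injective EE zz' (id_map_tuple_map x y zA)).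
Qed.

Section GenericSet.
Variables (d : nat) (Q : set tuples).
Hypothesis DQ : definable_tuples false [set` A] Q.
Hypothesis rk_Q : forall x, d <= rk AP x -> Q x -> rk [set` A] x <= d.

Lemma same_type_generic x y : same_type x y -> d <= rk AP x -> d <= rk AP y -> Q x -> Q y.
Proof.
move=> xy rx ry Qx; have aE := admissible_tuple_map xy (rk_Q rx Qx) rx ry.
have AE : {subset id_map A <= tuple_map x y} by move=> e eA; rewrite mem_cat eA.
exact/(elementary_tuples (admissible_elementary tK aE) AE (@tnth_tuple_map x y) DQ).
Qed.

Definition inside_generically (phi : set tuples) : Prop :=
  definable_tuples true [set` A] phi /\ forall x, d <= rk AP x -> phi x -> Q x.

Lemma generic_local_definition x : d <= rk AP x -> Q x -> exists2 phi, inside_generically phi & phi x.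
Proof.
move=> rx Qx; apply: contrapT => /forall2NP nphi.
have [|_ [/fo_weaken//]|phi psi [Dphi phix] [Dpsi psix]|||_ _ -> ->|phi _ [Dphi phix] ->|y [xy nQy ry]] :=
  @generic_realization d [set phi | definable_tuples true [set` A] phi /\ phi x] [set Q].
- by exists setT; split=> //; apply: fo_prop.
- by exists (phi `&` psi) => //; split=> //; apply: fo_and.
- by exists Q.
- by move=> _ ->.
- by rewrite setUid.
- apply: contrapT => /forall2NP ny; case: (nphi phi) => // ni; apply: ni; split=> // y ry phiy.
  by apply: contrapT => nQ; case: (ny y) => [[]|].
by apply: (nQy Q) => //; apply: same_type_generic Qx => // phi Dphi phix; apply: xy.
Qed.

(* For the points of Q of rank at least d over A and P, the P-free type over A
   determines the type. *)
Lemma generic_P_free_definition :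
  exists2 phi, definable_tuples true [set` A] phi & forall x, d <= rk AP x -> (Q x <-> phi x).
Proof.
apply: contrapT => /forall2NP nphi.
have [||||phi [/fo_weaken//]|phi psi [Dphi phiQ] [Dpsi psiQ]|_ phi -> [Dphi phiQ]|x [Qx nx rx]] :=
  @generic_realization d [set Q] inside_generically.
- by exists Q.
- by move=> _ ->.
- by move=> _ _ -> ->; exists Q.
- by exists set0; split=> //; apply: fo_prop.
- by split; [apply: fo_or|move=> x rx [/phiQ|/psiQ]; apply].
- apply: contrapT => /forall2NP nx; case: (nphi phi) => // np; apply: np => x rx; split; last exact: phiQ.
  by move=> Qx; apply: contrapT => nphix; case: (nx x) => [[]|].
have [phi iphi phix] := generic_local_definition rx (Qx Q erefl).
exact: (nx phi).
Qed.

End GenericSet.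

End Tuples.

End GenericDefinability.

(** * Group graphs *)

Section GroupGraphs.
Local Open Scope classical_set_scope.
Local Open Scope group_scope.

Definition group_graph (T : Type) (G : T -> Prop) (M : T -> T -> T -> Prop) : Prop :=
  [/\ forall x y z, M x y z -> [/\ G x, G y & G z],
      forall x y, G x -> G y -> exists z, M x y z,
      forall x y z z', M x y z -> M x y z' -> z = z' &
      forall x y z u v w, M x y u -> M u z w -> M y z v -> M x v w] /\
  exists e, G e /\ forall x, G x -> [/\ M e x x, M x e x & exists y, M y x e /\ M x y e].

Definition group_iso_graph (T T' : Type) (G : T -> Prop) (M : T -> T -> T -> Prop)
    (H : T' -> Prop) (N : T' -> T' -> T' -> Prop) (f : T -> T' -> Prop) : Prop :=
  [/\ forall x t, f x t -> G x /\ H t, forall x, G x -> exists t, f x t,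
      forall x t t', f x t -> f x t' -> t = t' & forall x x' t, f x t -> f x' t -> x = x'] /\
  [/\ forall t, H t -> exists x, f x t, forall t t' t'', N t t' t'' -> [/\ H t, H t' & H t''] &
      forall x y z t t' t'', M x y z -> f x t -> f y t' -> (N t t' t'' <-> f z t'')].

Definition op_graph (T : Type) (G : T -> Prop) (mul : T -> T -> T) x y z : Prop :=
  [/\ G x, G y & mul x y = z].

Lemma group_graph_op (T : Type) (G : T -> Prop) mul : is_group_on G mul -> group_graph G (op_graph G mul).
Proof.
move=> [e [inv [Ge [Gmul [Ginv [mulA [mul1 mulV]]]]]]]; split; last first.
  exists e; split=> // x Gx; have [ex xe] := mul1 x Gx; have [Vx xV] := mulV x Gx.
  by split=> //; exists (inv x); do !split=> //; apply: Ginv.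
split.
- by move=> x y _ [Gx Gy <-]; split=> //; apply: Gmul.
- by move=> x y Gx Gy; exists (mul x y).
- by move=> x y z z' [_ _ <-] [_ _ <-].
- by move=> x y z u v w [Gx Gy <-] [_ Gz <-] [_ _ <-]; split; [|apply: Gmul|rewrite mulA].
Qed.

Definition mul_graph (gT : groupType) (T : Type) (pt : gT -> T) (x y z : T) : Prop :=
  exists g h, [/\ x = pt g, y = pt h & z = pt (g * h)].

Lemma mul_graphE (gT : groupType) (T : Type) (pt : gT -> T) (pt_inj : injective pt) g h z :
  mul_graph pt (pt g) (pt h) z <-> z = pt (g * h).
Proof. by split=> [[g' [h' [/pt_inj<- /pt_inj<- ->]]] //|->]; exists g, h. Qed.

Lemma group_graph_groupType (T : Type) (G : T -> Prop) M : group_graph G M ->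
  exists (gT : groupType) (pt : gT -> T), [/\ injective pt, G = range pt & M = mul_graph pt].
Proof.
move=> [[dom total unique assoc] [e [Ge He]]]; pose T0 := {classic {x | G x}}.
have /choice[m0 Hm] (p : T0 * T0) : exists z : T0, M (sval p.1) (sval p.2) (sval z).
  by case: p => -[x Gx] [y Gy]; have [z xyz] := total x y Gx Gy; have [_ _ Gz] := dom _ _ _ xyz;
    exists (exist _ z Gz).
pose m (x y : T0) : T0 := m0 (x, y).
have mE (x y z : T0) : M (sval x) (sval y) (sval z) -> m x y = z.
  by move=> /(unique _ _ _ _ (Hm (x, y))) /eq_sig_hprop; apply=> ? ? ?; apply: Prop_irrelevance.
have /choice[v Hv] (x : T0) : exists y : T0, M (sval y) (sval x) e /\ M (sval x) (sval y) e.
  have [_ _ [y [yx xy]]] := He _ (svalP x); have [Gy _ _] := dom _ _ _ yx.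
  by exists (exist _ y Gy).
pose e0 : T0 := exist _ e Ge.
have mA : associative m.
  move=> x y z; apply: mE.
  exact: assoc (Hm (x, y)) (Hm (m x y, z)) (Hm (y, z)).
have m1 : left_id e0 m by move=> x; apply: mE; have [] := He _ (svalP x).
have m1' : right_id e0 m by move=> x; apply: mE; have [] := He _ (svalP x).
have mV : left_inverse e0 v m by move=> x; apply: mE; have [] := Hv x.
have mV' : right_inverse e0 v m by move=> x; apply: mE; have [] := Hv x.
pose gT : groupType := HB.pack T0 (@isGroup.Build T0 e0 v m mA m1 m1' mV mV').
exists gT, (fun g : gT => sval g); split.
- by move=> x y /eq_sig_hprop; apply=> ? ? ?; apply: Prop_irrelevance.
- by apply/funext => x; apply/propext; split=> [Gx|[g _ <-]]; [exists (exist _ x Gx)|apply: svalP].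
- apply/funext => x; apply/funext => y; apply/funext => z; apply/propext.
  split=> [xyz|[g [h [-> -> ->]]]]; last exact: (Hm (g, h)).
  have [Gx Gy Gz] := dom _ _ _ xyz; exists (exist _ x Gx), (exist _ y Gy); split=> //.
  exact: esym (congr1 sval (mE (exist _ x Gx) (exist _ y Gy) (exist _ z Gz) xyz)).
Qed.

Lemma group_iso_graph_transport (gT : groupType) (T T' : Type) (pt : gT -> T) (H : T' -> Prop) N f :
  injective pt -> group_iso_graph (range pt) (mul_graph pt) H N f ->
  exists pt' : gT -> T', [/\ injective pt', H = range pt', N = mul_graph pt' &
    f = fun x t => exists g, x = pt g /\ t = pt' g].
Proof.
move=> pt_inj [[dom total unique inj] [surj domN prod]].
have /choice[pt' Hpt'] g : exists t, f (pt g) t by apply: total; exists g.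
have surj' t : H t -> exists g, t = pt' g.
  by move=> /surj[x xt]; have [[g _ gx] _] := dom _ _ xt; exists g; apply: unique xt _; rewrite -gx.
have prodE g h t : N (pt' g) (pt' h) t <-> t = pt' (g * h).
  rewrite (prod (pt g) (pt h) (pt (g * h))) //; last by exists g, h.
  by split=> [/unique|->]; [apply|].
exists pt'; split.
- by move=> g h gh; apply: pt_inj; apply: (inj _ _ (pt' g)) => //; rewrite gh.
- apply/funext => t; apply/propext; split=> [/surj'[g ->]|[g _ <-]]; first by exists g.
  by have [] := dom _ _ (Hpt' g).
- apply/funext => t; apply/funext => t'; apply/funext => t''; apply/propext.
  split=> [tN|[g [h [-> -> ->]]]]; last exact/prodE.
  have [/surj'[g Eg] /surj'[h Eh] _] := domN _ _ _ tN; rewrite {}Eg {}Eh in tN *.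
  by exists g, h; split=> //; apply/prodE.
- apply/funext => x; apply/funext => t; apply/propext; split=> [xt|[g [-> ->]]] //.
  have [[g _ gx] _] := dom _ _ xt; rewrite -{}gx in xt *; exists g; split=> //.
  exact: unique xt (Hpt' g).
Qed.

Lemma is_group_on_range (gT : groupType) (T : Type) (pt : gT -> T) : injective pt ->
  exists mul, is_group_on (range pt) mul /\ forall g h, mul (pt g) (pt h) = pt (g * h).
Proof.
move=> pt_inj; have /choice[log Hlog] x : exists g, range pt x -> pt g = x.
  by case: (pselect (range pt x)) => [[g _ <-]|nx]; [exists g|exists 1].
have logK g : log (pt g) = g by apply: pt_inj; apply: Hlog; exists g.
exists (fun x y => pt (log x * log y)); split=> [|g h]; last by rewrite !logK.
exists (pt 1), (fun x => pt (log x)^-1); split; first by exists 1.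
split; first by move=> _ _ [g _ <-] [h _ <-]; exists (g * h); rewrite ?logK.
split; first by move=> _ [g _ <-]; exists g^-1; rewrite ?logK.
split; first by move=> _ _ _ [g _ <-] [h _ <-] [k _ <-]; rewrite !logK mulgA.
by split=> _ [g _ <-]; rewrite !logK ?mul1g ?mulg1 ?mulVg ?mulgV.
Qed.

End GroupGraphs.
(** * Generic elements of a definable group *)

Section DefinableGroup.
Local Open Scope classical_set_scope.
Variables (I : Type) (ar : I -> nat) (L : ordered_group_language ar) (K : structure ar).
Hypothesis tK : tame L K.
Local Notation P := (@in_P _ ar K : set K).
Local Notation cl := (@cl _ ar L K).
Local Notation rk := (rk cl).
Local Notation supp := (supp cl P).
Local Notation pg := (cl_pregeometry tK).

Variable A : seq K.
Hypothesis supp_A : supp [set` A] `<=` [set` A].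
Local Notation AP := ([set` A] `|` P).

Lemma unique_solution_cl n (R : n.-tuple K -> n.-tuple K -> n.-tuple K -> Prop) x y z :
  definable_ternary false [set` A] R -> R x y z -> (forall w, R x y w -> w = z) ->
  let X := [set` A] `|` [set` tval x] `|` [set` tval y] in [set` tval z] `<=` cl (X `|` supp X).
Proof.
move=> DR Rz uz X _ /(@tnthP _ _ z)[i ->]; pose D := (A ++ x) ++ y.
have -> : X = [set` D] by rewrite /D !set_mem_cat.
apply: (@definable_point_cl _ _ _ _ tK D (fun u => exists w, R x y w /\ tnth w i = u)).
- have AD : consts [set` A] `<=` elt_context [set` D].
    by apply: subset_trans (@subsetUr _ _ _); apply: sub_consts; rewrite /D !set_mem_cat => a; left; left.
  have xD j : elt_context [set` D] (fun=> tnth x j).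
    by right; exists (tnth x j) => //=; rewrite !mem_cat mem_tnth orbT.
  have yD j : elt_context [set` D] (fun=> tnth y j).
    by right; exists (tnth y j) => //=; rewrite !mem_cat mem_tnth !orbT.
  rewrite /definable_set; apply: fo_ex_tuple; apply: fo_and; last by fo.
  by apply: (fo_ternary _ _ DR) => // [|j|j|j]; [exact: consts_ext|coord|coord|coord].
- by exists z.
- by move=> u [w [/uz -> <-]].
Qed.

Variables (gT : groupType) (n : nat) (pt : gT -> n.-tuple K).
Hypothesis pt_inj : injective pt.
Local Notation pts g := [set` tval (pt g)].
Local Open Scope group_scope.

Local Notation mul_graph := (mul_graph pt).
Local Notation mul_graphE := (mul_graphE pt_inj).

Hypothesis definable_range : definable_tuples false [set` A] (range pt).
Hypothesis definable_mul : definable_ternary false [set` A] mul_graph.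

Lemma mul_supp_cl g h : let X := [set` A] `|` pts g `|` pts h in pts (g * h) `<=` cl (X `|` supp X).
Proof. by apply: (unique_solution_cl definable_mul) => [|z /mul_graphE//]; apply/mul_graphE. Qed.

Lemma divl_supp_cl g h : let X := [set` A] `|` pts g `|` pts (g * h) in pts h `<=` cl (X `|` supp X).
Proof.
apply: (@unique_solution_cl _ (fun x z y => mul_graph x y z)) => [||y].
- by rewrite /definable_ternary; fo.
- exact/mul_graphE.
- by move=> [g' [h' [/pt_inj<- -> /pt_inj/mulgI->]]].
Qed.

Lemma divr_supp_cl g h : let X := [set` A] `|` pts h `|` pts (g * h) in pts g `<=` cl (X `|` supp X).
Proof.
apply: (@unique_solution_cl _ (fun y z x => mul_graph x y z)) => [||x].
- by rewrite /definable_ternary; fo.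
- exact/mul_graphE.
- by move=> [g' [h' [-> /pt_inj<- /pt_inj/mulIg->]]].
Qed.

Definition spanned (B : set K) (x : n.-tuple K) : Prop := [set` tval x] `<=` cl (AP `|` B).

Lemma spanned_subset B B' x : B `<=` B' -> spanned B x -> spanned B' x.
Proof. by move=> BB' sx z /sx; apply: (pg_mono pg); apply: setUS. Qed.

Lemma spanned_self B x : [set` tval x] `<=` B -> spanned B x.
Proof. by move=> xB z zx; apply: (pg_self pg); right; apply: xB. Qed.

Lemma spanned_supp_cl B x y z : spanned B x -> spanned B y ->
  (let X := [set` A] `|` [set` tval x] `|` [set` tval y] in [set` tval z] `<=` cl (X `|` supp X)) ->
  spanned B z.
Proof.
move=> sx sy sz u /sz; apply: (pg_trans pg) => v [[[vA|/sx//]|/sy//]|[Pv _]].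
  by apply: (pg_self pg); left; left.
by apply: (pg_self pg); left; right.
Qed.

Lemma spanned_mul B g h : spanned B (pt g) -> spanned B (pt h) -> spanned B (pt (g * h)).
Proof. by move=> sg sh; apply: spanned_supp_cl sg sh (@mul_supp_cl g h). Qed.

Lemma spanned_divl B g h : spanned B (pt g) -> spanned B (pt (g * h)) -> spanned B (pt h).
Proof. by move=> sg sgh; apply: spanned_supp_cl sg sgh (@divl_supp_cl g h). Qed.

Lemma spanned_divr B g h : spanned B (pt h) -> spanned B (pt (g * h)) -> spanned B (pt g).
Proof. by move=> sh sgh; apply: spanned_supp_cl sh sgh (@divr_supp_cl g h). Qed.

Lemma spanned_inv B g : spanned B (pt g) -> spanned B (pt g^-1).
Proof.
move=> sg; apply: (spanned_divl sg); rewrite mulgV.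
by apply: (spanned_divl sg); rewrite mulg1.
Qed.

Variable r : nat.
Hypothesis rk_max : forall g, rk AP (pt g) <= r.
Hypothesis rk_attained : exists g, r <= rk AP (pt g).

Definition generic (B : set K) (g : gT) : Prop := r <= rk (AP `|` B) (pt g).

Lemma generic_cl B B' g : B `<=` cl (AP `|` B') -> generic B' g -> generic B g.
Proof.
move=> BB' /leq_trans; apply; apply: (rk_le_cl pg) => y [yA|/BB'//].
by apply: (pg_self pg); left.
Qed.

Lemma generic_subset B B' g : B `<=` B' -> generic B' g -> generic B g.
Proof. by move=> BB'; apply: generic_cl => y /BB' ?; apply: (pg_self pg); right. Qed.

Lemma generic0 B g : generic B g -> generic set0 g.
Proof. exact: generic_subset. Qed.

Lemma generic_translate B g h : generic B h -> spanned (B `|` pts g) (pt h) -> generic B g.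
Proof.
move=> /leq_trans gh sh; apply: gh; apply: (rk_le_span pg) => z /sh.
by rewrite setUA.
Qed.

Lemma generic_mull B g h : generic B h -> spanned B (pt g) -> generic B (g * h).
Proof.
move=> gh sg; apply: generic_translate gh _; apply: (@spanned_divl _ g).
  exact: spanned_subset sg.
by apply: spanned_self; apply: subsetUr.
Qed.

Lemma generic_mulr B g h : generic B g -> spanned B (pt h) -> generic B (g * h).
Proof.
move=> gg sh; apply: generic_translate gg _; apply: (@spanned_divr _ _ h).
  exact: spanned_subset sh.
by apply: spanned_self; apply: subsetUr.
Qed.

Lemma generic_sym g h : generic set0 g -> generic (pts g) h -> generic (pts h) g.
Proof.
rewrite /generic setU0 => rg rh; have := rk_exchange pg AP (pt g) (pt h).
have := rk_max h; have := rk_max g; lia.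
Qed.

Lemma generic_copy g (F : seq K) : exists E h,
  [/\ admissible L E, {subset id_map A <= E}, forall i, (tnth (pt g) i, tnth (pt h) i) \in E,
      forall y, ran E y -> P y -> y \in F -> y \in A &
      rk AP (pt g) <= rk ([set` A] `|` [set` F] `|` P) (pt h)].
Proof.
have [E [y [[aE AE F_A] gy]]] := admissible_extend_tuple tK (pt g) F (admissible_id supp_A).
rewrite dom_id_map ran_id_map => rk_y.
have [h _ yh] : range pt y.
  by apply/(elementary_tuples (admissible_elementary tK aE) AE gy definable_range); exists g.
exists E, h; split=> //; rewrite ?yh //.
by move=> u uE Pu uF; have := F_A u uE Pu uF; rewrite ran_id_map.
Qed.

Lemma generic_ex (D : seq K) : exists g, generic [set` D] g.
Proof.
have [g rg] := rk_attained; have [E [h [_ _ _ _ rk_h]]] := generic_copy g D.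
exists h; rewrite /generic; apply: (leq_trans rg); apply: (leq_trans rk_h).
by rewrite -!setUA (setUC P).
Qed.

Lemma supp_mul g h : generic set0 g -> generic (pts g) h ->
  supp ([set` A] `|` pts g) `|` supp ([set` A] `|` pts h) `<=`
  supp ([set` A] `|` pts (g * h)) `|` (supp ([set` A] `|` pts g) `&` supp ([set` A] `|` pts h)).
Proof.
move=> gg gh; have hg := generic_sym gg gh.
have mg : generic (pts g) (g * h) by apply: generic_mull => //; apply: spanned_self.
have mh : generic (pts h) (g * h) by apply: generic_mulr => //; apply: spanned_self.
have supp_pair k : generic (pts k) (g * h) ->
    supp ([set` A] `|` pts k `|` pts (g * h)) `<=`
    supp ([set` A] `|` pts k) `|` supp ([set` A] `|` pts (g * h)).
  move=> rm; apply: (supp_add_independent pg); apply: (leq_trans (rk_max _)); apply: (leq_trans rm).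
  by rewrite -!setUA (setUC P).
have supp_factor k l : (let X := [set` A] `|` pts k `|` pts (g * h) in pts l `<=` cl (X `|` supp X)) ->
    generic (pts k) (g * h) ->
    supp ([set` A] `|` pts l) `<=` supp ([set` A] `|` pts k) `|` supp ([set` A] `|` pts (g * h)).
  move=> lk km p sp; apply: supp_pair => //; apply: (supp_idem pg); apply: (supp_cl pg) sp => z.
  by case=> [zA|/lk//]; apply: (pg_self pg); left; left; left.
move=> p [pg'|ph].
  by case: (supp_factor h g (@divr_supp_cl g h) mh _ pg') => [ph|pm]; [right|left].
by case: (supp_factor g h (@divl_supp_cl g h) mg _ ph) => [pg'|pm]; [right|left].
Qed.

Definition new_supp g : set K := supp ([set` A] `|` pts g) `\` [set` A].

Lemma new_supp_bounded : exists k, forall g t, generic set0 g -> uniq t -> [set` t] `<=` new_supp g ->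
  size t <= k.
Proof.
have [_ [g _ <-]|k bounded_k] := @P_rank_below_bounded _ _ _ _ tK A n (range pt) r.+1 definable_range.
  by rewrite ltnS.
exists k => g t gg ut tg; have [|q [qP rq]] := bounded_k (pt g); first by exists g.
rewrite -(size_tuple q); apply: uniq_leq_size => // p /tg[sp pA].
have gq : supp ([set` A] `|` [set` tval q] `|` pts g) `<=` supp ([set` A] `|` [set` tval q]).
  apply: (supp_sub_of_rk pg); rewrite ltnS in rq; apply: (leq_trans rq); apply: (leq_trans gg).
  by rewrite setU0; apply: (rk_subset pg) => y [[|/qP]|]; [left|right|right].
have : supp ([set` A] `|` [set` tval q]) p.
  by apply: gq; apply: (supp_subset pg) sp => y [|]; [left; left|right].
by case/(supp_addP pg) => [y /qP//|/supp_A/pA|].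
Qed.

Lemma elementary_new_supp E g h p : admissible L E -> {subset id_map A <= E} ->
  (forall i, (tnth (pt g) i, tnth (pt h) i) \in E) -> new_supp g p ->
  exists2 p', (p, p') \in E & new_supp h p'.
Proof.
move=> aE AE gh [sp pA]; have [EE EP Ed Er] := aE.
have [p' pp'] : exists p', (p, p') \in E.
  apply: dom_image; apply: Ed; apply: (supp_subset pg) sp => y [yA|/(@tnthP _ _ (pt g))[i ->]].
    by apply: (mem_dom (y := y)); apply/AE/map_f.
  exact: mem_dom (gh i).
exists p' => //; split; last first.
  by move=> p'A; apply: pA; rewrite /= (elementary_injective EE pp' (AE _ (map_f _ p'A))).
pose C : set (K * n.-tuple K -> K) := consts [set` A] `|` [set fun t => tnth t.2 i | i in [set: 'I_n]].
have valuesC t : values C t = [set` A] `|` [set` tval t.2].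
  rewrite valuesU values_consts; congr (_ `|` _); apply/seteqP; split=> y.
    by move=> [_ [i _ <-] <-]; apply: mem_tnth.
  by move=> /(@tnthP _ _ t.2)[i ->]; exists (fun t => tnth t.2 i) => //; exists i.
have := elementary_open (admissible_elementary tK aE) _
  (open_supp tK (C := C) (c := fst) (@subsetUr _ [set fst] C) _) (t := (p, pt g)) (t' := (p', pt h)).
rewrite /mkset !valuesC /=; apply=> //; last by left.
by move=> c [->//|[[a aA <-]|[i _ <-]]] //; apply/AE/map_f.
Qed.

Lemma copy_new_supp_seq E g h (t : seq K) : admissible L E -> {subset id_map A <= E} ->
  (forall i, (tnth (pt g) i, tnth (pt h) i) \in E) -> uniq t -> [set` t] `<=` new_supp g ->
  exists t', [/\ uniq t', size t' = size t & [set` t'] `<=` new_supp h].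
Proof.
move=> aE AE gh ut tg.
suff [t' [ut' st' new_t']] : exists t', [/\ uniq t', size t' = size t &
    forall y, y \in t' -> new_supp h y /\ exists2 p, p \in t & (p, y) \in E].
  by exists t'; split=> // y /new_t'[].
elim: t ut tg => [|p t IH] /= ut tg; first by exists [::].
have /andP[p_notin_t uniq_t] := ut.
have [|t' [ut' st' new_t']] := IH uniq_t; first by move=> q /= qt; apply: tg; rewrite /= inE qt orbT.
have [p' pp' p'h] := elementary_new_supp aE AE gh (tg p (mem_head _ _)).
exists (p' :: t'); split=> /=; last 2 first.
- by rewrite st'.
- move=> y; rewrite inE => /predU1P[->|/new_t'[yh [q qt qy]]].
    by split=> //; exists p; rewrite ?mem_head.
  by split=> //; exists q; rewrite // inE qt orbT.
rewrite ut' andbT; apply/negP => /new_t'[_ [q qt qp']].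
have [EE _ _ _] := aE; by move: p_notin_t; rewrite (elementary_injective EE pp' qp') qt.
Qed.

(* The support of a generic element doubles under multiplication with an
   independent copy, while it has bounded size. *)
Lemma supp_generic g : generic set0 g -> supp ([set` A] `|` pts g) `<=` [set` A].
Proof.
pose has_supp k := exists g t, [/\ generic set0 g, uniq t, size t = k & [set` t] `<=` new_supp g].
have [k0 le_k0] := new_supp_bounded.
have bounded k : `[< has_supp k >] -> k <= k0.
  by move=> /asboolP[g' [t [gg ut <- new_t]]]; apply: le_k0 new_t.
have inhabited : exists k, `[< has_supp k >].
  have [g' rg'] := rk_attained; exists 0; apply/asboolP; exists g', [::]; split=> //.
  by rewrite /generic setU0.
have [k /asboolP[h [t [gh ut st new_t]]] kmax] := ex_maxnP inhabited bounded.
suff k_eq0 : k = 0.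
  move=> gg p sp; apply: contrapT => pA; have : 1 <= k; last by rewrite k_eq0.
  apply: kmax; apply/asboolP; exists g, [:: p]; split=> // q.
  by rewrite /= inE => /eqP->.
have [s supp_s] := supp_seq tK (A ++ pt h); rewrite set_mem_cat in supp_s.
have [E [h' [aE AE hh' F_A rk_h']]] := generic_copy h (s ++ pt h).
have gh' : generic (pts h) h'.
  have gh_ : r <= rk AP (pt h) by move: gh; rewrite /generic setU0.
  rewrite /generic; apply: (leq_trans gh_); apply: (leq_trans rk_h'); apply: (rk_subset pg) => y.
  by rewrite set_mem_cat => -[[|]|yh]; [left; left|right|left; right; right].
have disjoint_supp p : supp ([set` A] `|` pts h) p -> supp ([set` A] `|` pts h') p -> p \in A.
  move=> ph ph'; have [_ _ _ Er] := aE; apply: F_A; last 2 first.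
  - by case: ph.
  - by rewrite mem_cat; apply/orP; left; move: ph; rewrite -supp_s.
  apply: Er; apply: (supp_subset pg) ph' => y [yA|/(@tnthP _ _ (pt h'))[i ->]].
    by apply: (mem_ran (x := y)); apply/AE/map_f.
  exact: mem_ran (hh' i).
have [t' [ut' st' new_t']] := copy_new_supp_seq aE AE hh' ut new_t.
have : size (t ++ t') <= k.
  apply: kmax; apply/asboolP; exists (h * h'), (t ++ t'); split=> //.
  - by apply: (@generic0 (pts h)); apply: generic_mull => //; apply: spanned_self.
  - rewrite cat_uniq ut ut' /= andbT; apply/hasPn => y /new_t'[sy yA].
    by apply/negP => /new_t[sy' _]; apply: yA; apply: disjoint_supp.
  - rewrite set_mem_cat => p ptt'; have [sp pA] :
        (supp ([set` A] `|` pts h) `|` supp ([set` A] `|` pts h')) p /\ ~ [set` A] p.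
      by case: ptt' => [/new_t|/new_t'] [? ?]; split=> //; [left|right].
    by split=> //; case: (supp_mul gh gh' sp) => [//|[sph sph']]; case: pA; apply: disjoint_supp.
by rewrite size_cat st' st -[X in _ <= X]addn0 leq_add2l leqn0 => /eqP.
Qed.

(** * The generic group law *)

Lemma rk_generic g : generic set0 g -> rk [set` A] (pt g) <= r.
Proof. by move=> gg; rewrite -(rk_addP pg (supp_generic gg)); apply: rk_max. Qed.

Definition generic_pair (B : set K) (x y : n.-tuple K) : Prop := r + r <= rk (AP `|` B) (x ++ y).

Lemma generic_pairP g h : generic_pair set0 (pt g) (pt h) -> generic set0 g /\ generic (pts g) h.
Proof.
rewrite /generic_pair /generic !setU0 rk_cat => ggh.
have : rk (AP `|` pts g) (pt h) <= rk AP (pt h) by apply: (rk_subset pg); apply: subsetUl.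
have := rk_max g; have := rk_max h; lia.
Qed.

Lemma rk_mul_graph x y z : mul_graph x y z -> rk AP (x ++ y ++ z) = rk AP (x ++ y).
Proof.
move=> [g [h [-> -> ->]]]; rewrite catA rk_cat (rk_eq0 pg (s := pt (g * h))) ?addn0 //.
by apply: spanned_mul; apply: spanned_self; rewrite set_mem_cat; [apply: subsetUl|apply: subsetUr].
Qed.

Lemma supp_generic_pair g h : generic set0 g -> generic (pts g) h ->
  supp ([set` A] `|` pts g `|` pts h) `<=` [set` A].
Proof.
move=> gg gh p sp.
suff [/(supp_generic gg)|/(supp_generic (generic0 gh))] :
  (supp ([set` A] `|` pts g) `|` supp ([set` A] `|` pts h)) p by [].
apply: (supp_add_independent pg) sp; apply: (leq_trans (rk_max _)); apply: (leq_trans gh).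
by rewrite -!setUA (setUC P).
Qed.

Lemma rk_mul_graph_P_free (x y z : n.-tuple K) : r + r <= rk AP (x ++ y ++ z) ->
  mul_graph x y z -> rk [set` A] (x ++ y ++ z) <= r + r.
Proof.
move=> rxyz xyz; rewrite (rk_mul_graph xyz) in rxyz; case: xyz rxyz => g [h [-> -> ->]] rgh.
have [|gg gh] := @generic_pairP g h; first by rewrite /generic_pair setU0.
rewrite rk_cat; apply: leq_add; first exact: rk_generic.
rewrite rk_cat (rk_eq0 pg (s := pt (g * h))) ?addn0.
  by apply: leq_trans (rk_generic (generic0 gh)); apply: (rk_subset pg) => u; left.
move=> w /mul_supp_cl; apply: (pg_mono pg) => v [//|sv].
by left; left; apply: supp_generic_pair sv.
Qed.

Record generic_law (F : n.-tuple K -> n.-tuple K -> n.-tuple K -> Prop) : Prop := GenericLaw {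
  law_definable : definable_ternary true [set` A] F;
  law_unique : forall x y z z', F x y z -> F x y z' -> z = z';
  law_injr : forall x y y' z, F x y z -> F x y' z -> y = y';
  law_injl : forall x x' y z, F x y z -> F x' y z -> x = x';
  law_generic : forall x y z : n.-tuple K, r + r <= rk AP (x ++ y ++ z) ->
    (F x y z <-> mul_graph x y z) }.

Lemma generic_law_up_to_uniqueness : exists2 F, definable_ternary true [set` A] F &
  forall x y z : n.-tuple K, r + r <= rk AP (x ++ y ++ z) -> (F x y z <-> mul_graph x y z).
Proof.
pose Q := [set t : (n + (n + n)).-tuple K | mul_graph (lpart t) (lpart (rpart t)) (rpart (rpart t))].
have DQ : definable_tuples false [set` A] Q by apply/definable_ternary_cat.
pose cat3 (x y z : n.-tuple K) := cat_tuple x (cat_tuple y z).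
have QE x y z : Q (cat3 x y z) <-> mul_graph x y z.
  by rewrite /Q /cat3 /mkset !(lpart_cat, rpart_cat).
have [t rt Qt|phi Dphi Hphi] := @generic_P_free_definition _ _ _ _ tK _ _ supp_A (r + r) Q DQ.
  move: rt Qt; rewrite -(cat_lrpart t) -(cat_lrpart (rpart t)) => rt /QE.
  exact: rk_mul_graph_P_free.
exists (fun x y z => phi (cat3 x y z)) => [|x y z rxyz]; last by rewrite -QE; symmetry; apply: Hphi.
apply/definable_ternary_cat; apply: fo_iff Dphi => t.
by rewrite /cat3 !cat_lrpart.
Qed.

Definition unique_in_each_variable (F : n.-tuple K -> n.-tuple K -> n.-tuple K -> Prop) x y z : Prop :=
  F x y z /\ [/\ forall z', F x y z' -> z' = z, forall y', F x y' z -> y' = y &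
    forall x', F x' y z -> x' = x].

Lemma generic_law_exists : exists F, generic_law F.
Proof.
have [F DF FE] := generic_law_up_to_uniqueness; exists (unique_in_each_variable F); split.
- by rewrite /definable_ternary /unique_in_each_variable; fo.
- by move=> x y z z' [Fz _] [_ [uniq _ _]]; apply: uniq.
- by move=> x y y' z [Fy _] [_ [_ uniq _]]; apply: uniq.
- by move=> x x' y z [Fx _] [_ [_ _ uniq]]; apply: uniq.
move=> x y z rxyz; split=> [[/(FE _ _ _ rxyz)]//|xyz]; split; first exact/FE.
have rxy : r + r <= rk AP (x ++ y) by rewrite -(rk_mul_graph xyz).
have {FE}F_mul x' y' z' : F x' y' z' -> (forall u, (u \in tval x) || (u \in tval y) ->
    cl (AP `|` [set` tval x' ++ tval y' ++ tval z']) u) -> mul_graph x' y' z'.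
  move=> Fx' sxy; apply/FE => //; apply: (leq_trans rxy); apply: (rk_le_span pg) => u.
  by rewrite mem_cat; apply: sxy.
have self (B : set K) (w : n.-tuple K) : [set` tval w] `<=` B -> [set` tval w] `<=` cl (AP `|` B).
  exact: spanned_self.
case: xyz F_mul => g [h [Ex Ey Ez]] F_mul; split=> w Fw.
- suff : mul_graph x y w by rewrite Ex Ey Ez => /mul_graphE.
  apply: F_mul Fw _ => u /orP[ux|uy]; apply: (pg_self pg); right;
    by rewrite /= !mem_cat ?ux ?uy ?orbT.
- suff [g' [h' [Ex' -> Ez']]] : mul_graph x w z.
    by rewrite Ey; congr pt; move: Ez'; rewrite Ez => /pt_inj; rewrite (pt_inj (etrans (esym Ex) Ex'))
      => /mulgI.
  apply: F_mul Fw _ => u /orP[ux|uy]; first by apply: (pg_self pg); right; rewrite /= mem_cat ux.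
  rewrite Ey in uy; apply: (spanned_divl (g := g) (h := h) _ _ uy).
    by apply: self; rewrite -Ex !set_mem_cat; left.
  by apply: self; rewrite -Ez !set_mem_cat; right; right.
- suff [g' [h' [-> Ey' Ez']]] : mul_graph w y z.
    by rewrite Ex; congr pt; move: Ez'; rewrite Ez => /pt_inj; rewrite (pt_inj (etrans (esym Ey) Ey'))
      => /mulIg.
  apply: F_mul Fw _ => u /orP[ux|uy]; last by apply: (pg_self pg); right; rewrite /= !mem_cat uy orbT.
  rewrite Ex in ux; apply: (spanned_divr (g := g) (h := h) _ _ ux).
    by apply: self; rewrite -Ey !set_mem_cat; right; left.
  by apply: self; rewrite -Ez !set_mem_cat; right; right.
Qed.

(** * Independent sequences *)

Fixpoint independent (B : set K) (l : seq gT) : Prop :=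
  if l is g :: l' then generic B g /\ independent (B `|` pts g) l' else True.

Lemma independent_cl B B' l : B `<=` cl (AP `|` B') -> independent B' l -> independent B l.
Proof.
elim: l B B' => //= g l IH B B' BB' [gg gl]; split; first exact: generic_cl gg.
apply: IH gl => y [/BB'|yg]; first by apply: (pg_mono pg) => z [|]; [left|right; left].
by apply: (pg_self pg); right; right.
Qed.

Lemma independent_subset B B' l : B `<=` B' -> independent B' l -> independent B l.
Proof. by move=> BB'; apply: independent_cl => y /BB' ?; apply: (pg_self pg); right. Qed.

Lemma independent_ex k (D : seq K) : exists l : k.-tuple gT, independent [set` D] l.
Proof.
elim: k D => [|k IH] D; first by exists [tuple].
have [g gg] := generic_ex D; have [l gl] := IH (D ++ pt g).
by exists [tuple of g :: l]; split=> //; rewrite -set_mem_cat.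
Qed.

Lemma independent_generic B l g : independent B l -> g \in l -> generic B g.
Proof.
elim: l B => //= h l IH B [gh gl]; rewrite inE => /predU1P[->//|/(IH _ gl)].
by apply: generic_subset => y; left.
Qed.

Lemma independent_pair (J : eqType) (a : J -> gT) s B p q : independent B (map a s) ->
  p \in s -> q \in s -> p != q -> generic_pair B (pt (a p)) (pt (a q)).
Proof.
elim: s B => //= i s IH B [gi gs]; have pair_i j : j \in s -> generic_pair B (pt (a i)) (pt (a j)).
  move=> js; rewrite /generic_pair rk_cat leq_add // -setUA.
  exact: (independent_generic gs (map_f _ js)).
rewrite !inE => /predU1P[->|ps] /predU1P[->|qs]; [by rewrite eqxx|by move=> _; apply: pair_i| |].
- by move=> _; rewrite /generic_pair (rk_perm pg _ (permEl (perm_catC _ _))); apply: pair_i.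
- move=> pq; apply: leq_trans (IH _ gs ps qs pq) _; apply: (rk_subset pg).
  by apply: setUS; apply: subsetUl.
Qed.

Lemma independent_drop1 (J : eqType) (a : J -> gT) (s : seq J) B y : independent B (map a s) ->
  exists s', [/\ subseq s' s, size s <= (size s').+1 & independent (B `|` [set y]) (map a s')].
Proof.
elim: s B => [|i s IH] B /=; first by exists [::].
move=> [gi gs]; case: (pselect (cl (AP `|` (B `|` pts (a i))) y)) => cy.
  exists s; split=> //; first exact: subseq_cons.
  by apply: independent_cl gs => z [Bz|->//]; apply: (pg_self pg); right; left.
have [s' [ss' sz gs']] := IH _ gs; exists (i :: s'); split=> /=; [by rewrite eqxx|by rewrite ltnS|].
split; last by apply: independent_subset gs'; rewrite -!setUA (setUC [set y]).
rewrite /generic setUA in gi cy *; have := rk_exchange pg (AP `|` B) [:: y] (pt (a i)).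
rewrite /= !asboolF //; last by move=> cBy; apply: cy; apply: (pg_mono pg) cBy => z; left.
have -> : [set` [:: y]] = [set y] by apply/seteqP; split=> z; rewrite /= inE => /eqP.
by rewrite setUA; lia.
Qed.

Lemma independent_drop (J : eqType) (a : J -> gT) (s : seq J) B (D : seq K) : independent B (map a s) ->
  exists s', [/\ subseq s' s, size s <= size s' + size D & independent (B `|` [set` D]) (map a s')].
Proof.
elim: D B s => [|y D IH] B s gs.
  exists s; split=> //; first by rewrite addn0.
  by apply: independent_subset gs => z [].
have [s1 [ss1 sz1 gs1]] := independent_drop1 y gs; have [s2 [ss2 sz2 gs2]] := IH _ _ gs1.
exists s2; split; first exact: subseq_trans ss1.
  by apply: (leq_trans sz1); rewrite /= addnS ltnS.
by rewrite setU_mem_cons.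
Qed.

Definition misses_at_most k N (S : {set 'I_k}) : Prop := k <= #|S| + N.

Lemma misses_at_mostI k N N' (S S' : {set 'I_k}) : misses_at_most N S -> misses_at_most N' S' ->
  misses_at_most (N + N') (finset.setI S S').
Proof.
rewrite /misses_at_most => HS HS'; have := cardsUI S S'.
suff : #|finset.setU S S'| <= k by lia.
by apply: leq_trans (max_card _) _; rewrite card_ord.
Qed.

Lemma independent_almost_all k (a : 'I_k -> gT) B (D : seq K) : independent B (map a (enum 'I_k)) ->
  exists S : {set 'I_k}, [/\ misses_at_most (size D) S,
    forall p, p \in S -> generic (B `|` [set` D]) (a p) &
    forall p q, p \in S -> q \in S -> p != q -> generic_pair (B `|` [set` D]) (pt (a p)) (pt (a q))].
Proof.
move=> ga; have [s [ss sz gs]] := independent_drop D ga; rewrite size_enum_ord in sz.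
have us : uniq s by apply: subseq_uniq ss (enum_uniq _).
exists [set i in s]%SET; split=> [|p|p q]; rewrite ?inE.
- by rewrite /misses_at_most cardsE (card_uniqP us).
- by move=> ps; apply: (independent_generic gs); apply: map_f.
- exact: (independent_pair gs).
Qed.

Lemma generic_pair_span B x y x' y' : generic_pair B x y ->
  spanned (B `|` [set` tval x'] `|` [set` tval y']) x ->
  spanned (B `|` [set` tval x'] `|` [set` tval y']) y -> generic_pair set0 x' y'.
Proof.
move=> gxy sx sy; rewrite /generic_pair setU0; apply: (leq_trans gxy).
apply: (@leq_trans (rk (AP `|` B) (x' ++ y'))); last by apply: (rk_subset pg); left.
by apply: (rk_le_span pg) => z; rewrite set_mem_cat mem_cat !setUA => /orP[/sx|/sy]; rewrite !setUA.
Qed.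

(** * Charts *)

Section Charts.
Variable F : n.-tuple K -> n.-tuple K -> n.-tuple K -> Prop.
Hypothesis lF : generic_law F.

Lemma law_mul_graph x y z : generic_pair set0 x y -> F x y z <-> mul_graph x y z.
Proof.
rewrite /generic_pair setU0 => gxy; apply: (law_generic lF).
by rewrite catA rk_cat; apply: (leq_trans gxy); apply: leq_addr.
Qed.

Lemma law_mul g h z : generic_pair set0 (pt g) (pt h) -> F (pt g) (pt h) z <-> z = pt (g * h).
Proof. by move=> gh; rewrite law_mul_graph // mul_graphE. Qed.

Lemma law_spanned B x y z : F x y z -> spanned B x -> spanned B z -> spanned B y.
Proof.
move=> Fxyz sx sz; apply: spanned_supp_cl sx sz _.
apply: (@unique_solution_cl _ (fun x z y => F x y z)) => // [|y' Fy']; last exact: (law_injr lF) Fxyz.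
by have DF := law_definable lF; rewrite /definable_ternary; fo.
Qed.

(* m is large enough for two chart products, each defined up to 8n of the test
   points, to share three of them. *)
Local Notation m := (16 * n).+3.
Variables (e : n.+1.-tuple gT) (a : m.-tuple gT).
Local Notation e_ i := (tnth e i).
Local Notation a_ p := (tnth a p).

Definition points (s : seq gT) : seq K := flatten [seq tval (pt g) | g <- s].

Hypothesis ind_e : independent set0 e.
Hypothesis ind_a : independent [set` points e] a.

Lemma spanned_points B s g : [set` points s] `<=` B -> g \in s -> spanned B (pt g).
Proof.
move=> sB gs; apply: spanned_self => y yg; apply: sB.
by apply/flattenP; exists (tval (pt g)) => //; apply: map_f.
Qed.

Lemma generic_translation g : exists i, generic set0 (g * e_ i).
Proof.
have [|S [Sn Sg _]] := @independent_almost_all _ (tnth e) set0 (pt g); first by rewrite map_tnth_enum.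
have /card_gt0P[i /Sg] : 0 < #|S| by rewrite /misses_at_most size_tuple in Sn; lia.
rewrite set0U => gi; exists i; apply: (@generic0 (pts g)).
by apply: generic_mull gi _; apply: spanned_self.
Qed.

Lemma test_points (D : seq K) : exists S : {set 'I_m}, [/\ misses_at_most (size D) S,
  forall p, p \in S -> generic ([set` points e] `|` [set` D]) (a_ p) &
  forall p q, p \in S -> q \in S -> p != q ->
    generic_pair ([set` points e] `|` [set` D]) (pt (a_ p)) (pt (a_ q))].
Proof. by apply: independent_almost_all; rewrite map_tnth_enum. Qed.

(* For g e_i generic, y = pt (g e_i) sends the test point a_p to the value
   pt (g a_p), for almost all p. *)
Definition chart_value i y p c : Prop := F y (pt ((e_ i)^-1 * a_ p)) c.

(* Genericity of the test points over y is not definable; being charted, which is,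
   expresses that the values at almost all test points come from a single g. *)
Definition charted i y : Prop := exists S : {set 'I_m}, misses_at_most n S /\
  forall p q, p \in S -> q \in S -> p != q -> exists c d,
    [/\ chart_value i y p c, chart_value i y q d & F c (pt ((a_ p)^-1 * a_ q)) d].

Definition represents i y g : Prop := exists S : {set 'I_m}, misses_at_most (2 * n) S /\
  forall p, p \in S -> chart_value i y p (pt (g * a_ p)).

Lemma represents_common i y g i' y' g' : represents i y g -> represents i' y' g' ->
  exists S : {set 'I_m}, misses_at_most (4 * n) S /\ forall p, p \in S ->
    chart_value i y p (pt (g * a_ p)) /\ chart_value i' y' p (pt (g' * a_ p)).
Proof.
move=> [S [Sn Sg]] [S' [Sn' Sg']]; exists (finset.setI S S'); split.
  by have := misses_at_mostI Sn Sn'; rewrite /misses_at_most; lia.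
by move=> p; rewrite inE => /andP[/Sg ? /Sg' ?].
Qed.

Lemma misses_at_most_nonempty N (S : {set 'I_m}) : misses_at_most N S -> N <= 16 * n -> exists p, p \in S.
Proof.
move=> SN Nn; have /card_gt0P[p pS] : 0 < #|S| by rewrite /misses_at_most in SN; lia.
by exists p.
Qed.

Lemma represents_unique i y g g' : represents i y g -> represents i y g' -> g = g'.
Proof.
move=> yg yg'; have [S [Sn Sgg']] := represents_common yg yg'.
have [|p /Sgg'[Fg Fg']] := misses_at_most_nonempty Sn; first by lia.
by apply: (mulIg (a_ p)); apply: pt_inj; apply: (law_unique lF) Fg Fg'.
Qed.

Lemma represents_injective i y y' g : represents i y g -> represents i y' g -> y = y'.
Proof.
move=> yg yg'; have [S [Sn Sgg']] := represents_common yg yg'.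
have [|p /Sgg'[Fy Fy']] := misses_at_most_nonempty Sn; first by lia.
exact: (law_injl lF) Fy Fy'.
Qed.

Lemma generic_pair_chart_value i y p q c B : [set` points e] `<=` B -> [set` tval y] `<=` B ->
  generic_pair B (pt (a_ p)) (pt (a_ q)) -> chart_value i y p c ->
  generic_pair set0 c (pt ((a_ p)^-1 * a_ q)).
Proof.
move=> eB yB pq Fc; set x := pt ((a_ p)^-1 * a_ q).
pose B' := B `|` [set` tval c] `|` [set` tval x].
have BB' : B `<=` B' by move=> ? ?; left; left.
have sp : spanned B' (pt (a_ p)).
  apply: (@spanned_divl _ (e_ i)^-1).
    by apply: spanned_inv; apply: (spanned_points (subset_trans eB BB')); apply: mem_tnth.
  by apply: law_spanned Fc _ _; apply: spanned_self; [apply: subset_trans yB BB'|left; right].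
apply: generic_pair_span pq _ _ => //; apply: (@spanned_divl _ (a_ p)^-1); first exact: spanned_inv.
by apply: spanned_self; right.
Qed.

Lemma charted_represents i y : charted i y -> exists g, represents i y g.
Proof.
move=> [S [Sn Sy]]; have [S' [Sn' _ gS']] := test_points y; rewrite size_tuple in Sn'.
have := misses_at_mostI Sn Sn'; set T := finset.setI S S' => Tn.
have TS p : p \in T -> p \in S by rewrite inE => /andP[].
have mul_T p q c d : p \in T -> q \in T -> p != q -> chart_value i y p c ->
    F c (pt ((a_ p)^-1 * a_ q)) d -> mul_graph c (pt ((a_ p)^-1 * a_ q)) d.
  rewrite !inE => /andP[_ pS'] /andP[_ qS'] pq Fc /law_mul_graph; apply.
  by apply: generic_pair_chart_value (gS' _ _ pS' qS' pq) Fc; [left|right].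
have /card_gt1P[p [q [pT qT pq]]] : 1 < #|T| by rewrite /misses_at_most in Tn; lia.
have [c [d [Fc _ /(mul_T _ _ _ _ pT qT pq Fc)]]] := Sy p q (TS p pT) (TS q qT) pq.
move=> [g [_ [Ec _ _]]]; rewrite {}Ec in Fc.
exists (g * (a_ p)^-1); exists T; split.
  by rewrite /misses_at_most in Tn *; lia.
move=> s sT; case: (eqVneq p s) => [<-|ps]; first by rewrite mulgVK.
have [c' [d' [Fc' Fd' /(mul_T _ _ _ _ pT sT ps Fc')]]] := Sy p s (TS p pT) (TS s sT) ps.
by rewrite (law_unique lF Fc' Fc) => /mul_graphE Ed'; rewrite -mulgA -Ed'.
Qed.

Lemma generic_charted g i : generic set0 (g * e_ i) ->
  charted i (pt (g * e_ i)) /\ represents i (pt (g * e_ i)) g.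
Proof.
move=> ge; have [S [Sn gS gSS]] := test_points (pt (g * e_ i)); rewrite size_tuple in Sn.
set B := _ `|` _ in gS gSS; have eB : spanned B (pt (e_ i)).
  by apply: (@spanned_points _ e); [left|apply: mem_tnth].
have Fg p : p \in S -> chart_value i (pt (g * e_ i)) p (pt (g * a_ p)).
  move=> /gS gp; apply/law_mul; last by rewrite mulgA mulgK.
  rewrite /generic_pair rk_cat setU0; apply: leq_add; first by move: ge; rewrite /generic setU0.
  apply: (@generic_subset (pts (g * e_ i)) B); first by right.
  by apply: generic_mull gp _; apply: spanned_inv.
split; last by exists S; split=> //; rewrite /misses_at_most in Sn *; lia.
exists S; split=> // p q pS qS pq; exists (pt (g * a_ p)), (pt (g * a_ q)).
split; [exact: Fg|exact: Fg|]; apply/law_mul; last by rewrite -mulgA mulVKg.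
by apply: generic_pair_chart_value (gSS _ _ pS qS pq) (Fg _ pS); [left|right].
Qed.

Definition same_values i y j z : Prop := exists S : {set 'I_m}, misses_at_most (4 * n) S /\
  forall p, p \in S -> exists c, chart_value i y p c /\ chart_value j z p c.

Lemma same_valuesP i y j z g h : represents i y g -> represents j z h ->
  same_values i y j z <-> g = h.
Proof.
move=> yg zh; have [T [Tn Tgh]] := represents_common yg zh; split=> [[S [Sn Syz]]|gh].
  have [|p] := misses_at_most_nonempty (misses_at_mostI Sn Tn); first by lia.
  rewrite inE => /andP[/Syz[c [Fy Fz]] /Tgh[Fg Fh]].
  apply: (mulIg (a_ p)); apply: pt_inj.
  by rewrite -(law_unique lF Fy Fg) -(law_unique lF Fz Fh).
by exists T; split=> // p /Tgh[Fy Fz]; exists (pt (g * a_ p)); rewrite {2}gh.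
Qed.

Lemma law_chain B g h x y z d : generic_pair B (pt x) (pt y) -> generic_pair B (pt y) (pt z) ->
  spanned B (pt g) -> spanned B (pt h) ->
  (exists b b', [/\ F (pt x^-1) (pt (h * y)) b, F (pt (g * x)) b b' & F b' (pt (y^-1 * z)) d]) <->
  d = pt (g * h * z).
Proof.
move=> gxy gyz sg sh.
have spanned_pair u v B' : B' = B `|` pts u `|` pts v ->
    [/\ spanned B' (pt u), spanned B' (pt v), spanned B' (pt g) & spanned B' (pt h)].
  move=> ->; split; [by apply: spanned_self; left; right|by apply: spanned_self; right|..];
    by [apply: spanned_subset sg => ? ?; left; left|apply: spanned_subset sh => ? ?; left; left].
have pair1 : generic_pair set0 (pt x^-1) (pt (h * y)).
  have [sx shy _ sh'] := spanned_pair x^-1 (h * y) _ erefl.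
  apply: generic_pair_span gxy _ (spanned_divl sh' shy).
  by have := spanned_inv sx; rewrite invgK.
have pair2 : generic_pair set0 (pt (g * x)) (pt (x^-1 * (h * y))).
  have [sgx sxhy sg' sh'] := spanned_pair (g * x) (x^-1 * (h * y)) _ erefl.
  have sx := spanned_divl sg' sgx.
  exact: generic_pair_span gxy sx (spanned_divl sh' (spanned_divl (spanned_inv sx) sxhy)).
have pair3 : generic_pair set0 (pt (g * h * y)) (pt (y^-1 * z)).
  have [sghy syz sg' sh'] := spanned_pair (g * h * y) (y^-1 * z) _ erefl.
  have sy := spanned_divl (spanned_mul sg' sh') sghy.
  exact: generic_pair_span gyz sy (spanned_divl (spanned_inv sy) syz).
have ghy : g * x * (x^-1 * (h * y)) = g * h * y by rewrite -!mulgA mulVKg.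
have ghz : g * h * y * (y^-1 * z) = g * h * z by rewrite -[in LHS]mulgA mulVKg.
split=> [[b [b' []]]|->].
  move=> /(law_mul _ pair1)-> /(law_mul _ pair2)->; rewrite ghy => /(law_mul _ pair3)->.
  by rewrite ghz.
exists (pt (x^-1 * (h * y))), (pt (g * h * y)); split.
- exact/(law_mul _ pair1).
- by apply/(law_mul _ pair2); rewrite ghy.
- by apply/(law_mul _ pair3); rewrite ghz.
Qed.

(* With c = g a_s, b = h a_p and d = l a_q the last three relations read
   d = c a_s^-1 b a_p^-1 a_q. *)
Definition chart_product i y j z k w : Prop := exists S : {set 'I_m}, misses_at_most (8 * n) S /\
  forall p q s, p \in S -> q \in S -> s \in S -> uniq [:: p; q; s] ->
  exists c b d, [/\ chart_value i y s c, chart_value j z p b & chart_value k w q d] /\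
    exists b' b'', [/\ F (pt (a_ s)^-1) b b', F c b' b'' & F b'' (pt ((a_ p)^-1 * a_ q)) d].

Lemma chart_productP i y j z k w g h l : represents i y g -> represents j z h -> represents k w l ->
  chart_product i y j z k w <-> l = g * h.
Proof.
move=> [Sy [Syn Fy]] [Sz [Szn Fz]] [Sw [Swn Fw]].
have [S0 [S0n _ gS0]] := test_points (pt g ++ pt h); rewrite size_cat !size_tuple in S0n.
have := misses_at_mostI S0n (misses_at_mostI Syn (misses_at_mostI Szn Swn)).
set T := finset.setI _ _ => Tn; have {}Tn : misses_at_most (8 * n) T.
  by rewrite /misses_at_most in Tn *; lia.
have chain p q s d : p \in T -> q \in T -> s \in T -> uniq [:: p; q; s] ->
    (exists b b', [/\ F (pt (a_ s)^-1) (pt (h * a_ p)) b, F (pt (g * a_ s)) b b' &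
      F b' (pt ((a_ p)^-1 * a_ q)) d]) <-> d = pt (g * h * a_ q).
  rewrite !inE => /andP[pS _] /andP[qS _] /andP[sS _] /=; rewrite !inE negb_or.
  move=> /andP[/andP[pq ps] _]; have sg_sh := @set_mem_cat _ (pt g) (pt h).
  apply: law_chain (gS0 _ _ sS pS _) (gS0 _ _ pS qS pq) _ _; first by rewrite eq_sym.
    by apply: spanned_self; rewrite sg_sh => ? ?; right; left.
  by apply: spanned_self; rewrite sg_sh => ? ?; right; right.
have values p q s : p \in T -> q \in T -> s \in T ->
    [/\ chart_value i y s (pt (g * a_ s)), chart_value j z p (pt (h * a_ p)) &
        chart_value k w q (pt (l * a_ q))].
  by rewrite !inE => /and4P[_ _ /Fz ? _] /and4P[_ _ _ /Fw ?] /and4P[_ /Fy ? _ _].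
split=> [[S [Sn Sprod]]|El].
  have := misses_at_mostI Sn Tn; rewrite /misses_at_most => Hn.
  have /card_gt2P[p [q [s [[]]]]] : 2 < #|finset.setI S T| by lia.
  rewrite !(@finset.in_setI _ _ S T) => /andP[pS pT] /andP[qS qT] /andP[sS sT] [pq qs sp].
  have u3 : uniq [:: p; q; s] by rewrite /= !inE negb_or pq qs (eq_sym p s) sp.
  have [c [b [d [[Fc Fb Fd] bb]]]] := Sprod p q s pS qS sS u3.
  have [Fgs Fhp Flq] := values p q s pT qT sT.
  rewrite (law_unique lF Fc Fgs) (law_unique lF Fb Fhp) (law_unique lF Fd Flq) in bb.
  by move/(chain _ _ _ _ pT qT sT u3): bb => /pt_inj/mulIg.
exists T; split=> // p q s pT qT sT u3.
exists (pt (g * a_ s)), (pt (h * a_ p)), (pt (l * a_ q)); split; first exact: values.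
by apply/chain => //; rewrite El.
Qed.

Variable label : 'I_n.+1 -> K.
Hypothesis label_inj : injective label.

Definition code i (y : n.-tuple K) : n.+1.-tuple K := [tuple of label i :: y].

Lemma code_eq t i y : t = code i y <-> tnth t ord0 = label i /\ forall j, tnth t (lift ord0 j) = tnth y j.
Proof.
split=> [->|[t0 tS]]; first by split=> // j; rewrite tnthS.
by apply: eq_from_tnth => j; case: (unliftP ord0 j) => [j'|] ->; rewrite ?tS ?tnthS.
Qed.

Lemma code_inj i y j z : code i y = code j z -> i = j /\ y = z.
Proof. by move/(congr1 val) => [/label_inj-> /val_inj->]. Qed.

(* Minimality of i makes the code of a group element unique. *)
Definition valid i y : Prop := charted i y /\
  forall j : 'I_n.+1, j < i -> ~ exists z, charted j z /\ same_values i y j z.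

Definition is_code t : Prop := exists i y, t = code i y /\ valid i y.

Definition codes g t : Prop := exists i y, [/\ t = code i y, valid i y & represents i y g].

Definition code_mul t t' t'' : Prop := exists i y j z k w,
  [/\ t = code i y, t' = code j z & t'' = code k w] /\
  [/\ valid i y, valid j z, valid k w & chart_product i y j z k w].

Lemma codes_ex g : exists t, codes g t.
Proof.
have ex : exists k, `[< exists i : 'I_n.+1, val i = k /\ exists y, charted i y /\ represents i y g >].
  have [i gi] := generic_translation g; exists (val i); apply/asboolP; exists i; split=> //.
  by exists (pt (g * e_ i)); apply: generic_charted.
have [k /asboolP[i [ik [y [cy yg]]]] kmin] := ex_minnP ex.
exists (code i y), i, y; split=> //; split=> // j ji [z [cz yz]].
have [h zh] := charted_represents cz; move: yz; rewrite (same_valuesP yg zh) => gh.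
have : k <= j by apply: kmin; apply/asboolP; exists j; split=> //; exists z; rewrite gh.
by rewrite -ik leqNgt ji.
Qed.

Lemma codes_unique g t t' : codes g t -> codes g t' -> t = t'.
Proof.
move=> [i [y [-> [cy miny] yg]]] [j [z [-> [cz minz] zg]]].
have yz := (same_valuesP yg zg).2 erefl; have zy := (same_valuesP zg yg).2 erefl.
case: (ltngtP i j) => [ij|ji|/val_inj ij]; first by case: (minz i ij); exists y.
  by case: (miny j ji); exists z.
by rewrite -{}ij in zg *; rewrite (represents_injective yg zg).
Qed.

Lemma codes_injective g g' t : codes g t -> codes g' t -> g = g'.
Proof.
move=> [i [y [-> _ yg]]] [j [z [/code_inj[<- <-] _ yg']]].
exact: represents_unique yg yg'.
Qed.

Lemma is_code_codes t : is_code t -> exists g, codes g t.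
Proof. by move=> [i [y [-> vy]]]; have [g yg] := charted_represents vy.1; exists g, i, y. Qed.

Lemma code_mulP g h l t t' t'' : codes g t -> codes h t' -> codes l t'' ->
  code_mul t t' t'' <-> l = g * h.
Proof.
move=> [i [y [-> vy yg]]] [j [z [-> vz zh]]] [k [w [-> vw wl]]].
rewrite -(chart_productP yg zh wl); split=> [|prod]; last by exists i, y, j, z, k, w.
by move=> [_ [_ [_ [_ [_ [_ [[]]]]]]]] /code_inj[<- <-] /code_inj[<- <-] /code_inj[<- <-] [].
Qed.

Lemma code_mul_codes t t' t'' : code_mul t t' t'' -> [/\ is_code t, is_code t' & is_code t''].
Proof.
by move=> [i [y [j [z [k [w [[-> -> ->] [vy vz vw _]]]]]]]]; split; [exists i, y|exists j, z|exists k, w].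
Qed.

Definition code_graph x t : Prop := exists g, x = pt g /\ codes g t.

Lemma code_graph_iso :
  group_iso_graph (range pt) mul_graph is_code code_mul code_graph.
Proof.
split; split.
- by move=> x t [g [-> [i [y [Et vy _]]]]]; split; [exists g|exists i, y].
- by move=> _ [g _ <-]; have [t gt] := codes_ex g; exists t, g.
- by move=> x t t' [g [-> gt]] [g' [/pt_inj<- gt']]; apply: codes_unique gt gt'.
- by move=> x x' t [g [-> gt]] [g' [-> gt']]; rewrite (codes_injective gt gt').
- by move=> t /is_code_codes[g gt]; exists (pt g), g.
- exact: code_mul_codes.
- move=> _ _ _ t t' t'' [g [h [-> -> ->]]] [g' [/pt_inj<- gt]] [h' [/pt_inj<- ht']].
  split=> [gh|[l [/pt_inj<- lt'']]]; last exact/(code_mulP gt ht' lt'').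
  have [_ _ /is_code_codes[l lt'']] := code_mul_codes gh.
  by exists l; split=> //; rewrite ((code_mulP gt ht' lt'').1 gh).
Qed.

Lemma fo_code_eq (T : Type) b (E : set (T -> K)) i (t : T -> n.+1.-tuple K) y :
  consts setT `<=` E -> term (s := fun=> K) E t -> term (s := fun=> K) E y ->
  first_order (s := fun=> K) b E (fun u => t u = code i (y u)).
Proof.
move=> cE tE yE; apply: fo_iff (fun u => iff_sym (code_eq (t u) i (y u))) _; fo.
by apply: fo_eq; [apply: tE|apply: cE; exists (label i)].
Qed.

#[local] Hint Extern 1 (first_order _ _ (fun _ => _ = code _ _)) =>
  apply: fo_code_eq; [consts_in|move=> ?; coord|move=> ?; coord] : fo.

Lemma definable_is_code : definable_tuples true setT is_code.
Proof.
have DF := law_definable lF; rewrite /definable_tuples /is_code /valid /charted /same_values /chart_value.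
fo.
Qed.

Lemma definable_code_mul : definable_ternary true setT code_mul.
Proof.
have DF := law_definable lF.
rewrite /definable_ternary /code_mul /valid /charted /same_values /chart_product /chart_value.
fo.
Qed.

Lemma definable_code_graph : definable_binary false setT code_graph.
Proof.
have DF := law_definable lF.
apply: (fo_iff (X := fun p => range pt p.1 /\ exists i y, [/\ p.2 = code i y, valid i y &
  exists S : {set 'I_m}, misses_at_most (2 * n) S /\ forall q, q \in S ->
    exists c, mul_graph p.1 (pt (a_ q)) c /\ chart_value i y q c])).
  move=> [x t] /=; split=> [[[g _ <-] [i [y [-> vy [S [Sn Sg]]]]]]|[g [-> [i [y [-> vy [S [Sn Sg]]]]]]]].
    exists g; split=> //; exists i, y; split=> //; exists S; split=> // q /Sg[c [gc]].
    by move/mul_graphE: gc => ->.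
  split; first by exists g.
  exists i, y; split=> //; exists S; split=> // q /Sg Fg; exists (pt (g * a_ q)).
  by split; first exact/mul_graphE.
rewrite /valid /charted /same_values /chart_value; fo.
Qed.

End Charts.
End DefinableGroup.

Section TameGroup.
Local Open Scope classical_set_scope.
Variables (I : Type) (ar : I -> nat) (L : ordered_group_language ar) (K : structure ar).
Hypothesis tK : tame L K.
Local Notation P := (@in_P _ ar K : set K).
Local Notation cl := (@cl _ ar L K).
Local Notation rk := (rk cl).
Local Notation supp := (supp cl P).
Local Notation pg := (cl_pregeometry tK).

Lemma labels_exist k : exists label : 'I_k -> K, injective label.
Proof.
have [x [y xy]] := tame_nontrivial tK.
have [s us ss] : exists2 s : seq K, uniq s & size s = k.
  elim: k => [|k [s us ss]]; first by exists [::].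
  have [p [_ _ _ ps]] := dense_P_avoid tK s xy.
  by exists (p :: s); rewrite /= ?ps ?us ?ss.
exists (fun i => nth x s i) => i j /eqP.
by rewrite nth_uniq ?ss // => /eqP/val_inj.
Qed.

Lemma supported_params n (X : n.-tuple K -> Prop) (R : n.-tuple K -> n.-tuple K -> n.-tuple K -> Prop) :
  definable_tuples false setT X -> definable_ternary false setT R ->
  exists A : seq K, [/\ supp [set` A] `<=` [set` A], definable_tuples false [set` A] X &
    definable_ternary false [set` A] R].
Proof.
move=> /fo_finite_params[l _ DX] /fo_finite_params[l' _ DR].
have [s Es] := supp_seq tK (l ++ l'); exists (l ++ l' ++ s).
have lA : [set` l] `<=` [set` l ++ l' ++ s] by move=> x /= xl; rewrite mem_cat xl.
have lA' : [set` l'] `<=` [set` l ++ l' ++ s] by move=> x /= xl; rewrite !mem_cat xl orbT.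
split.
- rewrite catA set_mem_cat Es => p /(supp_idem pg) sp; by right.
- by apply: fo_sub DX => c; apply: setUS; apply: sub_consts.
- by apply: fo_sub DR => c; apply: setUS; apply: sub_consts.
Qed.

Lemma maximal_rank (gT : groupType) n (pt : gT -> n.-tuple K) (B : set K) :
  exists r, (forall g, rk B (pt g) <= r) /\ exists g, r <= rk B (pt g).
Proof.
have attained : exists r, `[< exists g, r <= rk B (pt g) >] by exists 0; apply/asboolP; exists 1%g.
have bounded r : `[< exists g, r <= rk B (pt g) >] -> r <= n.
  by move=> /asboolP[g /leq_trans]; apply; rewrite -[n in _ <= n](size_tuple (pt g)) rk_le_size.
have [r /asboolP rg rmax] := ex_maxnP attained bounded.
by exists r; split=> // g; apply: rmax; apply/asboolP; exists g.
Qed.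

Theorem tame_group_iso_P_free n (G : n.-tuple K -> Prop)
    (M : n.-tuple K -> n.-tuple K -> n.-tuple K -> Prop) :
  group_graph G M -> definable_tuples false setT G -> definable_ternary false setT M ->
  exists (H : n.+1.-tuple K -> Prop) (N : n.+1.-tuple K -> n.+1.-tuple K -> n.+1.-tuple K -> Prop) f,
    [/\ definable_tuples true setT H, definable_ternary true setT N, definable_binary false setT f &
        group_iso_graph G M H N f].
Proof.
move=> /group_graph_groupType[gT [pt [pt_inj -> ->]]] DG DM.
have [A [supp_A {}DG {}DM]] := supported_params DG DM.
have [r [rk_max rk_attained]] := maximal_rank pt ([set` A] `|` P).
have [F lF] := generic_law_exists tK supp_A pt_inj DG DM rk_max rk_attained.
have [e ind_e] := independent_ex tK supp_A DG rk_attained n.+1 [::].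
have [a ind_a] := independent_ex tK supp_A DG rk_attained (16 * n).+3 (points pt e).
have [label label_inj] := labels_exist n.+1.
exists (is_code pt F e a label), (code_mul pt F e a label), (code_graph pt F e a label); split.
- exact: (definable_is_code lF e a label).
- exact: (definable_code_mul lF e a label).
- exact: (definable_code_graph pt_inj DG DM lF e a label).
- by apply: (code_graph_iso tK pt_inj DM lF _ ind_a label_inj); apply: independent_subset ind_e.
Qed.

End TameGroup.

(** * Translations between languages *)

Section Translation.
Variables (M J' J : Type) (a' : J' -> nat) (a : J -> nat).
Variables (R' : forall j : J', (a' j).-tuple M -> Prop) (R : forall j : J, (a j).-tuple M -> Prop).
Variable atom : forall j : J', (a' j).-tuple nat -> formula a.
Hypothesis sat_atom : forall v j (vs : (a' j).-tuple nat), sat R v (atom vs) <-> R' (map_tuple v vs).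

Fixpoint translate (f : formula a') : formula a :=
  match f with
  | FRel _ vs => atom vs
  | FEq x y => FEq _ x y
  | FNot g => FNot (translate g)
  | FAnd g h => FAnd (translate g) (translate h)
  | FEx x g => FEx x (translate g)
  end.

Lemma sat_translate v f : sat R v (translate f) <-> sat R' v f.
Proof.
elim: f v => [i vs|x y|f IH|f IHf g IHg|x f IH] v //=.
- by have := IH v; tauto.
- by have := IHf v; have := IHg v; tauto.
- by split=> -[c /IH]; exists c.
Qed.

Lemma definable_translate n (X : n.-tuple M -> Prop) : definable R' X -> definable R X.
Proof. by move=> [f [w Xf]]; exists (translate f), w => x; rewrite sat_translate. Qed.

Lemma in_dcl_translate A x : in_dcl R' A x -> in_dcl R A x.
Proof.
by move=> [f [m [y [Ay fx]]]]; exists (translate f), m, y; split=> // z w; rewrite sat_translate.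
Qed.

End Translation.

Section Symbols.
Variables (J : eqType) (a : J -> nat).

Fixpoint symbols (f : formula a) : seq J :=
  match f with
  | FRel j _ => [:: j]
  | FEq _ _ => [::]
  | FNot g => symbols g
  | FAnd g h => symbols g ++ symbols h
  | FEx _ g => symbols g
  end.

Variables (J' : Type) (a' : J' -> nat) (atom : forall j : J', (a' j).-tuple nat -> formula a).

Lemma translate_surj f : (forall j (vs : (a j).-tuple nat), j \in symbols f ->
    exists j' (vs' : (a' j').-tuple nat), atom vs' = FRel vs) ->
  exists g, translate atom g = f.
Proof.
elim: f => [i vs|x y|f IH|f IHf g IHg|x f IH] /= Hf.
- by have [|j [vs' <-]] := Hf i vs; [rewrite mem_head|exists (FRel vs')].
- by exists (FEq _ x y).
- by have [g <-] := IH Hf; exists (FNot g).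
- have [|f' <-] := IHf; first by move=> j vs jf; apply: Hf; rewrite mem_cat jf.
  have [|g' <-] := IHg; first by move=> j vs jg; apply: Hf; rewrite mem_cat jg orbT.
  by exists (FAnd f' g').
- by have [g <-] := IH Hf; exists (FEx x g).
Qed.

End Symbols.

Section Expansion.
Local Open Scope classical_set_scope.
Variables (M : Type) (I : Type) (ar : I -> nat) (rel : forall i : I, (ar i).-tuple M -> Prop).
Variables (P : M -> Prop) (e : M).

Definition expand : formula ar -> formula (ar_P ar) := translate (fun i => @FRel _ (ar_P ar) (Some i)).

Lemma P_free_expand f : P_free (expand f).
Proof. by elim: f => //= f -> g ->. Qed.

Lemma P_free_symbols (f : formula (ar_P ar)) :
  P_free f = (None \notin @symbols (option {classic I}) (ar_P ar) f).
Proof.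
by elim: f => [[i|] vs|x y|f IH|f IHf g IHg|x f IH] //=; rewrite mem_cat negb_or IHf IHg.
Qed.

Lemma expand_surj f : P_free f -> exists g, expand g = f.
Proof.
rewrite P_free_symbols => nP; apply: (@translate_surj (option {classic I})) => -[i|] vs fo.
  by exists i, vs.
by rewrite fo in nP.
Qed.

Lemma sat_expand v f : sat (rel_P rel P) v (expand f) <-> sat rel v f.
Proof. exact: sat_translate. Qed.

Definition base : structure ar := @Structure _ ar {classic M} e (rel_P rel P).

Lemma base_definable n (X : n.-tuple M -> Prop) :
  definable (rel_P rel P) X <-> definable_tuples (K := base) false setT X.
Proof.
rewrite definable_tuples_extend; split=> [[f [w Xf]]|[f [w [_ Xf]]]]; last by exists f, w.
by exists f, w; split.
Qed.

Lemma base_definable_P_free n (X : n.-tuple M -> Prop) :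
  definable rel X <-> definable_tuples (K := base) true setT X.
Proof.
rewrite definable_tuples_extend; split=> [[f [w Xf]]|[f [w [/expand_surj[g <-] Xg]]]].
  by exists (expand f), w; split=> [|x]; [apply: P_free_expand|rewrite Xf -sat_expand].
by exists g, w => x; rewrite Xg -sat_expand.
Qed.

Lemma base_in_dcl A p : definable_set (K := base) true A (eq^~ p) -> in_dcl rel A p.
Proof.
move=> /fo_finite_params[l lA Dp].
have Dp1 : definable_tuples (K := base) true [set` l] (fun x : 1.-tuple base => thead x = p).
  by rewrite /definable_tuples; apply: (fo_set (X := eq^~ p) _ _ Dp);
    [by []|exact: subsetUr|left; exists ord0].
have [f /expand_surj[g <-] gp] := definable_tuples_formula Dp1.
exists g, (size l), (in_tuple l); split=> [j|y w]; first by apply: lA; apply: mem_tnth.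
by rewrite -sat_expand -[y = p]/(thead [tuple y] = p) (gp [tuple y] w).
Qed.

End Expansion.

(** * The ultrapower of an o-minimal group with an independent dense set *)

Section Base.
Local Open Scope classical_set_scope.
Variables (M : Type) (I : Type) (ar : I -> nat) (rel : forall i : I, (ar i).-tuple M -> Prop).
Variables (lt : M -> M -> Prop) (op : M -> M -> M) (e : M) (inv : M -> M).
Hypothesis ogM : ordered_group lt op e inv.
Variables (lt_fm op_fm : formula ar).
Hypothesis lt_fmP : forall (x : 2.-tuple M) (w : nat -> M),
  lt (tnth x ord0) (tnth x ord_max) <-> sat rel (extend x w) lt_fm.
Hypothesis op_fmP : forall (t : 3.-tuple M) (w : nat -> M),
  op (tnth t ord0) (tnth t (Ordinal (isT : 1 < 3))) = tnth t ord_max <-> sat rel (extend t w) op_fm.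
Hypothesis o_minimal_M : o_minimal rel lt.
Variable P : M -> Prop.
Hypotheses (dense_P : dense_in lt P) (independent_P : dcl_independent rel P).
Hypothesis nontrivial_M : exists x, lt e x.

Local Notation S := (base rel P e).
Definition expanded_language : ordered_group_language ar :=
  OrderedGroupLanguage (P_free_expand lt_fm) (P_free_expand op_fm).
Local Notation L := expanded_language.

Lemma base_lt (x y : S) : lt_in L x y <-> lt x y.
Proof.
rewrite /lt_in /holds sat_expand; have := @lt_fmP [tuple x; y] (fun=> y).
rewrite [tnth _ ord0]/= [tnth _ ord_max]/= => ->.
suff -> : extend [tuple x; y] (fun=> y) = scons x (fun=> y) by [].
by apply/funext => -[|[|k]] //; rewrite /extend /= nth_nil.
Qed.

Lemma base_op (x y z : S) : op_in L x y z <-> op x y = z.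
Proof.
rewrite /op_in /holds sat_expand; have := @op_fmP [tuple x; y; z] (fun=> z).
rewrite [tnth _ ord0]/= [tnth _ (Ordinal _)]/= [tnth _ ord_max]/= => ->.
suff -> : extend [tuple x; y; z] (fun=> z) = scons x (scons y (fun=> z)) by [].
by apply/funext => -[|[|[|k]]] //; rewrite /extend /= nth_nil.
Qed.

Lemma base_ltE : @lt_in _ ar L S = lt.
Proof. by apply/funext => x; apply/funext => y; apply/propext; apply: base_lt. Qed.

Lemma base_dense (x y : S) : lt_in L x y -> exists p : S, [/\ in_P p, lt_in L x p & lt_in L p y].
Proof. by move=> /base_lt/dense_P[p [Pp [xp py]]]; exists p; split=> //; apply/base_lt. Qed.

Lemma base_o_minimal (X : S -> Prop) : definable_set true setT X ->
  exists ps, forall y, X y <-> in_pieces L ps y.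
Proof.
move=> DX; have [|ps Xps] := @o_minimal_M (fun t : 1.-tuple M => X (thead t)).
  apply/(base_definable_P_free rel P e); rewrite /definable_tuples.
  by apply: (fo_set _ _ DX); [by []|exact: subsetUr|left; exists ord0].
exists ps => y; have -> : X y <-> X (thead [tuple y]) by [].
rewrite Xps; elim: ps {Xps} => [|p ps IH] /=; first by split=> [[]|].
rewrite base_ltE; split=> [[[|k] kp py]|[py|/IH[k kp py]]].
- by left.
- by right; apply/IH; exists k.
- by exists 0.
- by exists k.+1.
Qed.

Lemma base_ominimal_group : ominimal_group L (op : S -> S -> S) e inv.
Proof.
have [opA [op1 [opV [irr [trans [total mono]]]]]] := ogM.
split; rewrite ?base_ltE //.
- exact: base_op.
- by move=> x; have [] := op1 x.
- by move=> x; have [] := op1 x.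
- by move=> x; have [] := opV x.
- by move=> x; have [] := opV x.
- by move=> x y z /(mono _ _ z)[].
- by move=> x y z /(mono _ _ z)[].
- by move=> x y /dense_P[z [_ xzy]]; exists z.
- exact: base_o_minimal.
Qed.
Local Notation og := base_ominimal_group.

Lemma base_independent (A X : S -> Prop) p : A `<=` P -> P p -> ~ A p ->
  definable_set true A X -> small L X -> ~ X p.
Proof.
move=> AP Pp nAp DX sX Xp.
have [l Xl] : exists l : seq S, forall x, X x -> x \in l.
  by apply: (small_finite og) sX; apply: definable_sub DX.
have [f [m [a [Aa fp]]]] := base_in_dcl (finite_definable_point og DX Xl Xp).
apply: (independent_P Pp); exists f, m, a; split=> // j.
by split; [apply/AP/Aa|move=> jp; apply: nAp; rewrite -jp].
Qed.

Lemma base_pretame : pretame L S.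
Proof.
split.
- exact: og_irr og.
- exact: og_trans og.
- exact: base_dense.
- by have [x ex] := og_nontrivial og; exists e, x.
- move=> c x y xy; exists (op (inv c) x), (op (inv c) y); split=> [|z xz zy]; first exact: (og_ltl og).
  have opVK t : op c (op (inv c) t) = t by rewrite -(og_opA og) (og_opVr og) (og_op1l og).
  exists (op c z); split; first exact/base_op.
  + by rewrite -(opVK x); apply: (og_ltl og).
  + by rewrite -(opVK y); apply: (og_ltl og).
- by move=> x y z z' /base_op<- /base_op<-.
- move=> x y y' z /base_op<- /base_op E.
  by rewrite -(og_op1l og y) -(og_opVl og x) (og_opA og) -E -(og_opA og) (og_opVl og) (og_op1l og).
- move=> x x' y z /base_op<- /base_op E.
  by rewrite -(og_op1r og x) -(og_opVr og y) -(og_opA og) -E (og_opA og) (og_opVr og) (og_op1r og).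
- exact: small_bigcup og.
- by move=> R DR sR; apply: (small_swap og DR sR).
- exact: base_independent.
Qed.

End Base.

Section UltrapowerTame.
Local Open Scope classical_set_scope.
Variables (I : Type) (ar : I -> nat) (L : ordered_group_language ar) (M : structure ar).
Hypothesis tM : pretame L M.
Variable U : set_system nat.
Context {UF : UltraFilter U}.
Local Notation K := (ultrapower M U).

Lemma transfer_sentence b (X : structure ar -> Prop) :
  first_order b (@var_coord _ ar void) (fun t => X (tag t)) -> X M -> X K.
Proof.
move=> FX XM; apply: (transfer (V := void) (X := fun s _ => X s) FX) => //.
Qed.

Lemma uniform_on (V : Type) b n (X : forall s : structure ar, (V -> s) -> n.-tuple s -> Prop) s v :
  uniform b X -> definable_tuples b setT (X s v).
Proof. by move/(uniform_definable v); apply: fo_sub => c [?|[a _ <-]]; [left|right; exists a]. Qed.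

Lemma ultrapower_bigcup (Y : K -> Prop) (R : K -> K -> Prop) :
  definable_set true setT Y -> definable_rel true setT R -> small L Y ->
  (forall c, Y c -> small L (R c)) -> small L (fun y => exists c, Y c /\ R c y).
Proof.
move=> DY DR.
have [|Y_ UY YE] := @uniformize _ _ K K id true 1 (fun t => Y (thead t)).
  by rewrite image_id /definable_tuples; fo.
have [|R_ UR RE] := @uniformize _ _ K K id true 2 (fun t => R (tnth t ord0) (tnth t ord_max)).
  by rewrite image_id /definable_tuples; fo.
have -> : Y = (fun c => Y_ K id [tuple c]) by apply/funext => c; apply/propext; apply: (YE [tuple c]).
have -> : R = (fun c y => R_ K id [tuple c; y]).
  by apply/funext => c; apply/funext => y; apply/propext; apply: (RE [tuple c; y]).
apply: (transfer (b := true) (X := fun s v => small L (fun c => Y_ s v [tuple c]) ->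
  (forall c, Y_ s v [tuple c] -> small L (fun y => R_ s v [tuple c; y])) ->
  small L (fun y => exists c, Y_ s v [tuple c] /\ R_ s v [tuple c; y]))); first by fo.
move=> v; have DY_ := uniform_on v UY; have DR_ := uniform_on v UR.
apply: (tame_bigcup tM); rewrite /definable_set /definable_rel; fo.
Qed.

Lemma ultrapower_swap (R : K -> K -> Prop) : definable_rel true setT R ->
  (forall x, small L (R x)) -> small L (fun y => ~ small L (R^~ y)).
Proof.
move=> DR.
have [|R_ UR RE] := @uniformize _ _ K K id true 2 (fun t => R (tnth t ord0) (tnth t ord_max)).
  by rewrite image_id /definable_tuples; fo.
have -> : R = (fun c y => R_ K id [tuple c; y]).
  by apply/funext => c; apply/funext => y; apply/propext; apply: (RE [tuple c; y]).
apply: (transfer (b := true) (X := fun s v => (forall x, small L (fun y => R_ s v [tuple x; y])) ->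
  small L (fun y => ~ small L (fun x => R_ s v [tuple x; y])))); first by fo.
move=> v; have DR_ := uniform_on v UR.
by apply: (tame_swap tM (R := fun x y => R_ M v [tuple x; y])); rewrite /definable_rel; fo.
Qed.

Lemma ultrapower_independent (A X : set K) p : A `<=` @in_P _ ar K -> in_P p -> ~ A p ->
  definable_set true A X -> small L X -> ~ X p.
Proof.
move=> AP Pp nAp /fo_finite_params[l lA]; rewrite -/(definable_set _ _ _) => DX.
have [|X_ UX XE] := @uniformize _ _ K _ (tnth (in_tuple l)) true 1 (fun t => X (thead t)).
  have -> : range (tnth (in_tuple l)) = [set` l].
    apply/seteqP; split=> [_ [i _ <-]|a al]; first exact: mem_tnth.
    by have /(@tnthP _ _ (in_tuple l))[i ->] : a \in in_tuple l by []; exists i.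
  by rewrite /definable_tuples; fo.
have -> : X = (fun y => X_ K (tnth (in_tuple l)) [tuple y]).
  by apply/funext => y; apply/propext; apply: (XE [tuple y]).
have avoid (v : 'I_(size l) -> K) : forall q, in_P q -> (forall i, in_P (v i)) ->
    (forall i, v i <> q) -> small L (fun y => X_ K v [tuple y]) -> ~ X_ K v [tuple q].
  move: v; apply: (transfer (b := false) (X := fun s v => forall q, in_P q -> (forall i, in_P (v i)) ->
    (forall i, v i <> q) -> small L (fun y => X_ s v [tuple y]) -> ~ X_ s v [tuple q])).
    by fo.
  move=> v q Pq Pv vq; apply: (@tame_indep _ _ _ _ tM (range v)) => //; first by move=> _ [i _ <-].
    by move=> [i _ /vq].
  rewrite /definable_set; apply: (fo_tuples _ _ (uniform_definable v UX)) => //; first exact: subsetUr.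
  by fo_term.
apply: avoid => // [i|i ip]; first by apply/AP/lA; apply: mem_tnth.
by apply: nAp; rewrite -ip; apply: lA; apply: mem_tnth.
Qed.

Lemma ultrapower_pretame : pretame L K.
Proof.
split; [..|exact: ultrapower_bigcup|exact: ultrapower_swap|exact: ultrapower_independent].
- apply: (transfer_sentence (b := true) (X := fun s => forall x : s, ~ lt_in L x x));
    [by fo|exact: tame_irr tM].
- apply: (transfer_sentence (b := true) (X := fun s => forall x y z : s, lt_in L x y ->
    lt_in L y z -> lt_in L x z)); [by fo|exact: tame_trans tM].
- apply: (transfer_sentence (b := false) (X := fun s => forall x y : s, lt_in L x y ->
    exists p, [/\ in_P p, lt_in L x p & lt_in L p y])); [by fo|exact: tame_dense tM].
- apply: (transfer_sentence (b := true) (X := fun s => exists x y : s, lt_in L x y));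
    [by fo|exact: tame_nontrivial tM].
- apply: (transfer_sentence (b := true) (X := fun s => forall c x y : s, lt_in L x y ->
    exists x' y', lt_in L x' y' /\ forall z, lt_in L x' z -> lt_in L z y' ->
    exists w, [/\ op_in L c z w, lt_in L x w & lt_in L w y])); [by fo|exact: tame_translate tM].
- apply: (transfer_sentence (b := true) (X := fun s => forall x y z z' : s, op_in L x y z ->
    op_in L x y z' -> z = z')); [by fo|exact: tame_op_unique tM].
- apply: (transfer_sentence (b := true) (X := fun s => forall x y y' z : s, op_in L x y z ->
    op_in L x y' z -> y = y')); [by fo|exact: tame_op_injr tM].
- apply: (transfer_sentence (b := true) (X := fun s => forall x x' y z : s, op_in L x y z ->
    op_in L x' y z -> x = x')); [by fo|exact: tame_op_injl tM].
Qed.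

End UltrapowerTame.

(** * Transfer of definable groups *)

Section GroupTransfer.
Local Open Scope classical_set_scope.
Variables (I : Type) (ar : I -> nat).
Local Notation family V n := (forall s : structure ar, (V -> s) -> n.-tuple s -> Prop).

Definition ternary V n (R : family V (n + (n + n))) (s : structure ar) (v : V -> s)
  (x y z : n.-tuple s) : Prop := R s v (cat_tuple x (cat_tuple y z)).

Definition binary V n m (R : family V (n + m)) (s : structure ar) (v : V -> s)
  (x : n.-tuple s) (y : m.-tuple s) : Prop := R s v (cat_tuple x y).

Lemma uniformize_tuples (K : structure ar) b n (X : n.-tuple K -> Prop) :
  definable_tuples b setT X -> exists2 X_ : family K n, uniform b X_ & X = X_ K id.
Proof.
move=> DX; have [|X_ UX XE] := @uniformize _ _ K K id b _ X; first by rewrite image_id.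
by exists X_ => //; apply/funext => x; apply/propext.
Qed.

Lemma uniformize_ternary (K : structure ar) b n (R : n.-tuple K -> n.-tuple K -> n.-tuple K -> Prop) :
  definable_ternary b setT R -> exists2 R_ : family K (n + (n + n)), uniform b R_ & R = ternary R_ id.
Proof.
move=> /definable_ternary_cat/uniformize_tuples[R_ UR RE]; exists R_ => //.
apply/funext => x; apply/funext => y; apply/funext => z.
have := congr1 (fun X => X (cat_tuple x (cat_tuple y z))) RE.
by rewrite !(lpart_cat, rpart_cat).
Qed.

Lemma uniformize_binary (K : structure ar) b n m (R : n.-tuple K -> m.-tuple K -> Prop) :
  definable_binary b setT R -> exists2 R_ : family K (n + m), uniform b R_ & R = binary R_ id.
Proof.
move=> /definable_binary_cat/uniformize_tuples[R_ UR RE]; exists R_ => //.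
apply/funext => x; apply/funext => y; have := congr1 (fun X => X (cat_tuple x y)) RE.
by rewrite lpart_cat rpart_cat.
Qed.

Lemma definable_ternary_on V b n (R : family V (n + (n + n))) (s : structure ar) (v : V -> s) :
  uniform b R -> definable_ternary b setT (ternary R v).
Proof.
move/(uniform_on v) => DR; apply/definable_ternary_cat; apply: fo_iff DR => t.
by rewrite /ternary !cat_lrpart.
Qed.

Lemma definable_binary_on V b n m (R : family V (n + m)) (s : structure ar) (v : V -> s) : uniform b R ->
  definable_binary b setT (binary R v).
Proof.
move/(uniform_on v) => DR; apply/definable_binary_cat; apply: fo_iff DR => t.
by rewrite /binary cat_lrpart.
Qed.

Lemma fo_group_graph V b n (G : family V n) (R : family V (n + (n + n))) :
  uniform b G -> uniform b R -> first_order b (@var_coord _ ar V) (fun t =>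
    group_graph (G (tag t) (tagged t)) (ternary R (tagged t))).
Proof. by move=> UG UR; rewrite /group_graph /ternary; fo. Qed.

Lemma fo_group_iso_graph V W n m (G : family V n) R (H : family W m) N (f : family W (n + m)) :
  uniform false G -> uniform false R -> uniform true H -> uniform true N -> uniform false f ->
  first_order false (@var_coord _ ar (V + W)) (fun t =>
    let v := tagged t \o inl in let w := tagged t \o inr in
    group_iso_graph (G _ v) (ternary R v) (H _ w) (ternary N w) (binary f w)).
Proof. by move=> UG UR UH UN Uf; rewrite /group_iso_graph /ternary /binary /=; fo. Qed.

Variables (M : structure ar) (U : set_system nat).
Context {UF : UltraFilter U}.
Local Notation K := (ultrapower M U).

Lemma ultrapower_group_graph n (G : family M n) R : uniform false G -> uniform false R ->
  group_graph (G M id) (ternary R id) ->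
  group_graph (G K (fun a => ultra_class U (fun=> a))) (ternary R (fun a => ultra_class U (fun=> a) : K)).
Proof.
move=> UG UR gG.
apply/(Los (X := fun s v => group_graph (G s v) (ternary R v)) (fun a _ => a) (fo_group_graph UG UR)).
by apply: filterS filterT => j _.
Qed.

Lemma ultrapower_group_iso_graph n m (G : family M n) R (H : family K m) N (f : family K (n + m)) :
  uniform false G -> uniform false R -> uniform true H -> uniform true N -> uniform false f ->
  group_iso_graph (G K (fun a => ultra_class U (fun=> a)))
    (ternary R (fun a => ultra_class U (fun=> a) : K)) (H K id) (ternary N id) (binary f id) ->
  exists v : K -> M, group_iso_graph (G M id) (ternary R id) (H M v) (ternary N v) (binary f v).
Proof.
move=> UG UR UH UN Uf corr.
pose g (x : M + K) : nat -> M := match x with inl a => fun=> a | inr a => @ultra_repr _ _ M U UF a end.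
have gK : (fun x => ultra_class U (g x) : K) \o inr = id.
  by apply/funext => a /=; rewrite ultra_reprK.
have : U [set j | group_iso_graph (G M id) (ternary R id) (H M (fun a => g (inr a) j))
    (ternary N (fun a => g (inr a) j)) (binary f (fun a => g (inr a) j))].
  apply/(Los (X := fun s v => group_iso_graph (G s (v \o inl)) (ternary R (v \o inl))
    (H s (v \o inr)) (ternary N (v \o inr)) (binary f (v \o inr))) g).
    exact: fo_group_iso_graph.
  by rewrite gK.
by move=> /filter_ex[j]; exists (fun a => g (inr a) j).
Qed.

End GroupTransfer.

Theorem pretame_group_iso_P_free (I : countType) (ar : I -> nat) (L : ordered_group_language ar)
    (M : structure ar) n (G : n.-tuple M -> Prop) (R : n.-tuple M -> n.-tuple M -> n.-tuple M -> Prop) :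
  pretame L M -> group_graph G R ->
  definable_tuples false setT G -> definable_ternary false setT R ->
  exists (H : n.+1.-tuple M -> Prop) (N : n.+1.-tuple M -> n.+1.-tuple M -> n.+1.-tuple M -> Prop) f,
    [/\ definable_tuples true setT H, definable_ternary true setT N, definable_binary false setT f &
        group_iso_graph G R H N f].
Proof.
move=> pM gG /uniformize_tuples[G_ UG EG] /uniformize_ternary[R_ UR ER].
have [U [UU cofinite_U]] := ultraFilterLemma eventually_filter.
have tK := Tame (@ultrapower_pretame _ _ _ _ pM U UU) (@ultrapower_saturated _ _ M U UU cofinite_U).
rewrite {}EG {}ER in gG *; have gK := @ultrapower_group_graph _ _ M U UU _ _ _ UG UR gG.
have [H [N [f [DH DN Df corr]]]] :=
  tame_group_iso_P_free tK gK (uniform_on _ UG) (definable_ternary_on _ UR).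
have [[H_ UH EH] [N_ UN EN] [f_ Uf Ef]] :=
  And3 (uniformize_tuples DH) (uniformize_ternary DN) (uniformize_binary Df).
rewrite EH EN Ef in corr.
have [v corrM] := ultrapower_group_iso_graph UG UR UH UN Uf corr.
exists (H_ M v), (ternary N_ v), (binary f_ v); split => //.
- exact: uniform_on.
- exact: definable_ternary_on.
- exact: definable_binary_on.
Qed.

Section GroupIsomorphism.
Local Open Scope classical_set_scope.

Lemma group_iso_graph_map (T T' : Type) (G : T -> Prop) mul (H : T' -> Prop) N f :
  is_group_on G mul -> group_iso_graph G (op_graph G mul) H N f ->
  exists mulH F, [/\ is_group_on H mulH, N = op_graph H mulH, f = (fun x t => G x /\ F x = t) &
    [/\ forall x, G x -> H (F x), forall x y, G x -> G y -> F x = F y -> x = y,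
        forall z, H z -> exists x, G x /\ F x = z &
        forall x y, G x -> G y -> F (mul x y) = mulH (F x) (F y)]].
Proof.
move=> /group_graph_op/group_graph_groupType[gT [pt [pt_inj EG Emul]]].
have mulE g h : mul (pt g) (pt h) = pt (g * h)%g.
  suff [_ _ //] : op_graph G mul (pt g) (pt h) (pt (g * h)%g) by [].
  by rewrite Emul; exists g, h.
rewrite Emul EG => /(group_iso_graph_transport pt_inj)[pt' [pt'_inj -> -> ->]].
have [mulH [gH mulHE]] := is_group_on_range pt'_inj.
have /choice[F HF] x : exists t, forall g, x = pt g -> t = pt' g.
  case: (pselect (exists g, x = pt g)) => [[g ->]|nx]; first by exists (pt' g) => h /pt_inj<-.
  by exists (pt' 1%g) => g xg; case: nx; exists g.
have FE g : F (pt g) = pt' g by apply: HF.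
exists mulH, F; split=> //.
- apply/funext => x; apply/funext => y; apply/funext => z; apply/propext.
  split=> [[g [h [-> -> ->]]]|[[g _ <-] [h _ <-] <-]]; first by split; [exists g|exists h|].
  by exists g, h; rewrite mulHE.
- apply/funext => x; apply/funext => t; apply/propext.
  by split=> [[g [-> ->]]|[[g _ <-] <-]]; [split=> //; exists g|exists g].
- split.
  + by move=> _ [g _ <-]; rewrite FE; exists g.
  + by move=> _ _ [g _ <-] [h _ <-]; rewrite !FE => /pt'_inj->.
  + by move=> _ [g _ <-]; exists (pt g); split; first by exists g.
  + by move=> _ _ [g _ <-] [h _ <-]; rewrite mulE !FE mulHE.
Qed.

Lemma graph_op_parts (M : Type) n (G : n.-tuple M -> Prop) mul t :
  graph_op G mul t <-> op_graph G mul (lpart t) (lpart (rpart t)) (rpart (rpart t)).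
Proof.
split=> [[x [y [Gx [Gy ->]]]]|[Gx Gy mulE]]; first by rewrite !(lpart_cat, rpart_cat).
by exists (lpart t), (lpart (rpart t)); rewrite mulE !cat_lrpart.
Qed.

Lemma graph_map_parts (M : Type) n m (G : n.-tuple M -> Prop) (F : n.-tuple M -> m.-tuple M) t :
  graph_map G F t <-> G (lpart t) /\ F (lpart t) = rpart t.
Proof.
split=> [[x [Gx ->]]|[Gx FE]]; first by rewrite lpart_cat rpart_cat.
by exists (lpart t); rewrite FE cat_lrpart.
Qed.

End GroupIsomorphism.

Section CountableLanguage.
Local Open Scope classical_set_scope.
Variables (M : Type) (I : countType) (ar : I -> nat) (rel : forall i : I, (ar i).-tuple M -> Prop).
Variables (lt : M -> M -> Prop) (op : M -> M -> M) (e : M) (inv : M -> M).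
Hypothesis ogM : ordered_group lt op e inv.
Hypothesis definable_lt : definable0 rel (fun t : 2.-tuple M => lt (tnth t ord0) (tnth t ord_max)).
Hypothesis definable_op : definable0 rel (fun t : 3.-tuple M =>
  op (tnth t ord0) (tnth t (Ordinal (isT : 1 < 3))) = tnth t ord_max).
Hypothesis o_minimal_M : o_minimal rel lt.
Variable P : M -> Prop.
Hypotheses (dense_P : dense_in lt P) (independent_P : dcl_independent rel P).
Hypothesis nontrivial_M : exists x, lt e x.

Lemma definable_group_iso_countable n (G : n.-tuple M -> Prop) mulG :
  definable_group (rel_P rel P) G mulG ->
  exists (m : nat) (H : m.-tuple M -> Prop) mulH f,
    definable_group rel H mulH /\ definable_iso (rel_P rel P) G mulG H mulH f.
Proof.
move=> [/(base_definable rel P e) DG [/(base_definable rel P e) DmulG gG]].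
have [lt_fm lt_fmP] := definable_lt; have [op_fm op_fmP] := definable_op.
have pS := base_pretame ogM lt_fmP op_fmP o_minimal_M dense_P independent_P nontrivial_M.
have Dop : definable_ternary (K := base rel P e) false setT (op_graph G mulG).
  by apply/definable_ternary_cat; apply: fo_iff DmulG => t; apply: graph_op_parts.
have [H [N [f [DH DN Df corr]]]] := pretame_group_iso_P_free pS (group_graph_op gG) DG Dop.
have [mulH [F [gH EN Ef [FH F_inj F_surj F_mul]]]] := group_iso_graph_map gG corr.
exists n.+1, H, mulH, F; split.
  split; first exact/(base_definable_P_free rel P e).
  split=> //; apply/(base_definable_P_free rel P e); rewrite EN in DN.
  by apply: fo_iff ((definable_ternary_cat _ _ _).1 DN) => t; symmetry; apply: graph_op_parts.
do !split=> //; apply/(base_definable rel P e); rewrite Ef in Df.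
by apply: fo_iff ((definable_binary_cat _ _ _).1 Df) => t; symmetry; apply: graph_map_parts.
Qed.

End CountableLanguage.

(** * Reduction to a finite language *)

Section Sublanguage.
Variables (M I : Type) (ar : I -> nat) (rel : forall i : I, (ar i).-tuple M -> Prop) (P : M -> Prop).
Variable l : seq {classic I}.

Definition sub_ar (j : seq_sub l) : nat := ar (ssval j).

Definition sub_rel (j : seq_sub l) : (sub_ar j).-tuple M -> Prop := @rel (ssval j).

Definition sub_atom (j : seq_sub l) (vs : (sub_ar j).-tuple nat) : formula ar := @FRel _ ar (ssval j) vs.

Definition sub_atom_P (o : option (seq_sub l)) : (ar_P sub_ar o).-tuple nat -> formula (ar_P ar) :=
  match o with
  | Some j => @FRel _ (ar_P ar) (Some (ssval j : I))
  | None => @FRel _ (ar_P ar) None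
  end.

Lemma sat_sub_atom v j (vs : (sub_ar j).-tuple nat) :
  sat rel v (sub_atom vs) <-> sub_rel (map_tuple v vs).
Proof. by []. Qed.

Lemma sat_sub_atom_P v o (vs : (ar_P sub_ar o).-tuple nat) :
  sat (rel_P rel P) v (sub_atom_P vs) <-> rel_P sub_rel P (map_tuple v vs).
Proof. by case: o vs. Qed.

Lemma definable0_sublanguage n (X : n.-tuple M -> Prop) f :
  {subset @symbols {classic I} ar f <= l} -> (forall x w, X x <-> sat rel (extend x w) f) ->
  definable0 sub_rel X.
Proof.
move=> fl Xf; have [j vs /fl jl|g gf] := @translate_surj {classic I} ar _ _ sub_atom f.
  by exists (SeqSub jl), vs.
by exists g => x w; rewrite (Xf x w) -gf (sat_translate sat_sub_atom).
Qed.

Lemma definable_sublanguage_P n (X : n.-tuple M -> Prop) f w :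
  {subset pmap id (@symbols (option {classic I}) (ar_P ar) f) <= l} ->
  (forall x, X x <-> sat (rel_P rel P) (extend x w) f) -> definable (rel_P sub_rel P) X.
Proof.
move=> fl Xf; have [o vs of_|g gf] := @translate_surj (option {classic I}) (ar_P ar) _ _ sub_atom_P f.
  case: o vs of_ => [j|] vs of_; last by exists None, vs.
  have jl : j \in l by apply: fl; rewrite mem_pmap; apply/mapP; exists (Some j).
  by exists (Some (SeqSub jl)), vs.
by exists g, w => x; rewrite Xf -gf (sat_translate sat_sub_atom_P).
Qed.

End Sublanguage.

Section ArbitraryLanguage.
Variables (M I : Type) (ar : I -> nat) (rel : forall i : I, (ar i).-tuple M -> Prop).
Variables (lt : M -> M -> Prop) (op : M -> M -> M) (e : M) (inv : M -> M).
Hypothesis ogM : ordered_group lt op e inv.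
Variables (P : M -> Prop) (n : nat) (G : n.-tuple M -> Prop).
Variable mulG : n.-tuple M -> n.-tuple M -> n.-tuple M.
Hypothesis gG : definable_group (rel_P rel P) G mulG.

Lemma definable_group_iso_nontrivial :
  definable0 rel (fun t : 2.-tuple M => lt (tnth t ord0) (tnth t ord_max)) ->
  definable0 rel (fun t : 3.-tuple M =>
    op (tnth t ord0) (tnth t (Ordinal (isT : 1 < 3))) = tnth t ord_max) ->
  o_minimal rel lt -> dense_in lt P -> dcl_independent rel P -> (exists x, lt e x) ->
  exists (m : nat) (H : m.-tuple M -> Prop) mulH f,
    definable_group rel H mulH /\ definable_iso (rel_P rel P) G mulG H mulH f.
Proof.
move=> [lt_fm ltP] [op_fm opP] omin denseP indepP nontriv.
have [[G_fm [Gw GP]] [[mul_fm [mulw mulP]] groupG]] := gG.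
pose symb := @symbols {classic I} ar; pose symb_P f := pmap id (@symbols (option {classic I}) (ar_P ar) f).
pose l := (symb lt_fm ++ symb op_fm) ++ (symb_P G_fm ++ symb_P mul_fm).
have atomE := @sat_sub_atom M I ar rel l; have atomPE := @sat_sub_atom_P M I ar rel P l.
have [|||||m [H [mulH [f [[DH [DmulH gH]] [fH [f_inj [f_surj [f_mul Df]]]]]]]]] :=
  @definable_group_iso_countable M _ (@sub_ar I ar l) (@sub_rel M I ar rel l) lt op e inv ogM _ _ _
    P denseP _ nontriv n G mulG.
- by apply: definable0_sublanguage ltP => i il; rewrite !mem_cat il.
- by apply: definable0_sublanguage opP => i il; rewrite !mem_cat il orbT.
- by move=> X /(definable_translate atomE)/omin.
- by move=> p Pp /(in_dcl_translate atomE); apply: indepP.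
- split; first by apply: definable_sublanguage_P GP => i il; rewrite !mem_cat il !orbT.
  by split=> //; apply: definable_sublanguage_P mulP => i il; rewrite !mem_cat il !orbT.
exists m, H, mulH, f; split.
  by split; [|split=> //]; apply: definable_translate atomE _ _ _.
by do 4!split=> //; apply: definable_translate atomPE _ _ _.
Qed.

Lemma ordered_group_trivial : ~ (exists x, lt e x) -> forall x, x = e.
Proof.
move=> triv x; have [_ [op1 [opV [_ [_ [total mono]]]]]] := ogM.
case: (total e x) => [ex|[//|xe]]; first by case: triv; exists x.
case: triv; exists (inv x); have [] := mono _ _ (inv x) xe.
by rewrite (proj1 (opV x)) (proj2 (op1 (inv x))).
Qed.

Lemma definable_trivial (J : Type) (a : J -> nat) (R : forall j : J, (a j).-tuple M -> Prop) k
  (X : k.-tuple M -> Prop) : (forall x : M, x = e) -> definable R X.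
Proof.
move=> M_e; have all_eq (x y : k.-tuple M) : x = y.
  by apply: eq_from_tnth => i; rewrite (M_e (tnth x i)) (M_e (tnth y i)).
case: (pselect (exists x, X x)) => [[x Xx]|nX].
  by exists (FEq _ 0 0), (fun=> e) => y; rewrite (all_eq y x).
by exists (FNot (FEq _ 0 0)), (fun=> e) => y; split=> [Xy|[]//]; case: nX; exists y.
Qed.

Lemma definable_group_iso_trivial : (forall x : M, x = e) ->
  definable_group rel G mulG /\ definable_iso (rel_P rel P) G mulG G mulG id.
Proof.
move=> M_e; have [_ [_ groupG]] := gG.
split; first by do 2?split=> //; apply: definable_trivial.
do 2!split=> //; split; first by move=> z Gz; exists z.
by split=> //; apply: definable_trivial.
Qed.

End ArbitraryLanguage.

Theorem theorem1p2
  (M : Type) (I : Type) (ar : I -> nat) (rel : forall i : I, (ar i).-tuple M -> Prop)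
  (lt : M -> M -> Prop) (op : M -> M -> M) (e : M) (inv : M -> M)
  (Hog : ordered_group lt op e inv)
  (Hlt : definable0 rel (fun t : 2.-tuple M => lt (tnth t ord0) (tnth t ord_max)))
  (Hop : definable0 rel (fun t : 3.-tuple M =>
           op (tnth t ord0) (tnth t (Ordinal (isT : 1 < 3))) = tnth t ord_max))
  (Hom : o_minimal rel lt)
  (P : M -> Prop) (Hdense : dense_in lt P) (Hind : dcl_independent rel P)
  (n : nat) (G : n.-tuple M -> Prop) (mulG : n.-tuple M -> n.-tuple M -> n.-tuple M)
  (HG : definable_group (rel_P rel P) G mulG) :
  exists (m : nat) (H : m.-tuple M -> Prop) (mulH : m.-tuple M -> m.-tuple M -> m.-tuple M)
         (f : n.-tuple M -> m.-tuple M),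
    definable_group rel H mulH /\ definable_iso (rel_P rel P) G mulG H mulH f.
Proof.
case: (pselect (exists x, lt e x)) => [nontrivial|/(ordered_group_trivial Hog) M_e].
  exact: (definable_group_iso_nontrivial Hog HG Hlt Hop Hom Hdense Hind nontrivial).
by exists n, G, mulG, id; apply: definable_group_iso_trivial HG M_e.
Qed.
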